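(* Assume that $\gamma<1$ and $\delta<1/2$. Then, as $n\to\infty$, $\frac{S_n}{\sqrt n}$ converges in distribution to $$\mathcal{N}_d\left(0,\ \frac{1}{m(1-2\delta)}\sum_{v\in V_{\mathfrak{o}}}(v-\bar v)(v-\bar v)^\top\right).$$
   Context: Setting. Let $d\ge 1$ and let $\mathcal{S}_{\mathfrak{e}},\mathcal{S}_{\mathfrak{o}},V_{\mathfrak{e}},V_{\mathfrak{o}}\subset\mathbf{R}^d$, with $V_{\mathfrak{o}},V_{\mathfrak{e}}$ finite, satisfy: (1) $x+v\in\mathcal{S}_{\mathfrak{o}}$ for $x\in\mathcal{S}_{\mathfrak{e}}$, $v\in V_{\mathfrak{o}}$; (2) $x+v\in\mathcal{S}_{\mathfrak{e}}$ for $x\in\mathcal{S}_{\mathfrak{o}}$, $v\in V_{\mathfrak{e}}$; (3) $V_{\mathfrak{o}}=-V_{\mathfrak{e}}$; (4) $0\in\mathcal{S}_{\mathfrak{e}}$; (5) $V_{\mathfrak{o}}\cap V_{\mathfrak{e}}=\emptyset$. Put $V=V_{\mathfrak{o}}\cup V_{\mathfrak{e}}$, let $m$ be the common cardinality of $V_{\mathfrak{o}}$ and $V_{\mathfrak{e}}$, assume $m\ge2$, and set $\bar v=\frac1m\sum_{v\in V_{\mathfrak{o}}}v$. Fix $p,q\in[0,1]$ and set $\alpha=\frac{mp-1}{m-1}$, $\beta=\frac{mq-1}{m-1}$, $\gamma=\frac12(\alpha+\beta)$, $\delta=\frac12(\alpha-\beta)$. For each $k\ge2$ and $v\in V$ let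 $G_k(v)$ be a random variable with values in $V_{\mathfrak{o}}$ if $k$ is odd and in $V_{\mathfrak{e}}$ if $k$ is even, with the following law. Let $W$ denote $V_{\mathfrak{o}}$ if $k$ is odd and $V_{\mathfrak{e}}$ if $k$ is even, and let $w\in W$. If $v\in W$, then $\boldsymbol{P}(G_k(v)=w)=p$ for $w=v$ and $\frac{1-p}{m-1}$ for $w\ne v$. If $v\in V\setminus W$ (so $-v\in W$), then $\boldsymbol{P}(G_k(v)=w)=q$ for $w=-v$ and $\frac{1-q}{m-1}$ for $w\neq -v$. Let $X_1$ be uniform on $V_{\mathfrak{o}}$ and, for $n\ge1$, let $\mathcal{U}_n$ be uniform on $\{1,\dots,n\}$. The $\sigma$-fields $\sigma(X_1),\ \sigma(\mathcal{U}_1,\{G_2(v)\}_{v\in V}),\ \sigma(\mathcal{U}_2,\{G_3(v)\}_{v\in V}),\dots$ are independent, and for each $n\ge1$, $\mathcal{U}_n$ is independent of $\{G_{n+1}(v)\}_{v\in V}$. Define, for $n\geq 1$, $X_{n+1}=G_{n+1}(X_{\mathcal{U}_n})$; and $S_0=0$, $S_{n+1}=S_n+X_{n+1}$ for $n\ge0$ (the elephant random walk). $\mathcal{N}_d(0,\Sigma)$ is the $d$-dimensional Gaussian distribution with mean $0$ and (possibly singular) covariance matrix $\Sigma$. *)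

(* Defs.v *)
From HB Require Import structures.
From mathcomp Require Import all_boot all_order all_algebra finmap.
From mathcomp Require Import all_classical all_reals all_analysis.

Set Implicit Arguments.
Unset Strict Implicit.
Unset Printing Implicit Defensive.

Import Order.TTheory GRing.Theory Num.Theory.
Import numFieldNormedType.Exports.

Local Open Scope classical_set_scope.
Local Open Scope ring_scope.

(* R^d is 'rV[R]_d; this is the same type with its Borel sigma-algebra. *)
Notation borel_rV R d := (g_sigma_algebraType (@open 'rV[R]_d)).

Section Independence.
Context {d0 : measure_display} {T : measurableType d0} {R : realType}.
Variable P : probability T R.

Definition independent2 (F G : set (set T)) : Prop :=
  forall A B : set T, F A -> G B -> P (A `&` B) = (P A * P B)%E.

Definition mutually_independent (F : nat -> set (set T)) : Prop :=
  forall (J : {fset nat}) (A : nat -> set T),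
    (forall i, i \in J -> F i (A i)) ->
    P (\bigcap_(i in [set` J]) A i) = (\prod_(i <- J) P (A i))%E.

End Independence.

Definition sigma_of (d0 d1 : measure_display) (T : measurableType d0)
    (T' : measurableType d1) (Y : T -> T') : set (set T) :=
  preimage_set_system setT Y measurable.

Definition sigma_of_family (d0 d1 : measure_display) (T : measurableType d0)
    (T' : measurableType d1) (I : Type) (D : set I) (Y : I -> T -> T') :
    set (set T) :=
  <<s \bigcup_(i in D) sigma_of (Y i) >>.

Definition sigma_join (T : Type) (F G : set (set T)) : set (set T) :=
  <<s F `|` G >>.

(* The normal law on the line with variance s2, including the degenerate case:
   the library's [normal_prob a 0] is not the Dirac mass at a. *)
Definition normal_law (R : realType) (a s2 : R) (A : set R) : \bar R :=
  if s2 == 0 then \d_a A else normal_prob a (Num.sqrt s2) A.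

(* nu = N_d(mu, Sigma): every linear functional x |-> <t, x> has a (possibly
   degenerate) normal law, of mean <t, mu> and variance <t, Sigma t>. *)
Definition is_gaussian (R : realType) (d : nat) (mu : 'rV[R]_d)
    (Sigma : 'M[R]_d) (nu : probability (borel_rV R d) R) : Prop :=
  Sigma^T = Sigma /\
  forall t : 'rV[R]_d,
    0 <= (t *m Sigma *m t^T) ord0 ord0 /\
    forall A : set R, measurable A ->
      nu [set x : 'rV[R]_d | A ((x *m t^T) ord0 ord0)] =
      normal_law ((mu *m t^T) ord0 ord0) ((t *m Sigma *m t^T) ord0 ord0) A.

Definition cvg_in_distribution (d0 : measure_display) (T : measurableType d0)
    (R : realType) (P : probability T R) (d : nat) (Z : nat -> T -> 'rV[R]_d)
    (nu : probability (borel_rV R d) R) : Prop :=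
  (forall n, measurable_fun [set: T] (Z n : T -> borel_rV R d)) /\
  forall f : 'rV[R]_d -> R,
    continuous f -> (exists M : R, forall x, `|f x| <= M) ->
    (\int[P]_w (f (Z n w))%:E)%E @[n --> \oo] --> (\int[nu]_x (f x)%:E)%E.

Section Coefficients.
Variable R : realType.

(* alpha = memory_coef m p and beta = memory_coef m q *)
Definition memory_coef (m : nat) (p : R) : R := (m%:R * p - 1) / (m%:R - 1).

Definition gamma_coef (m : nat) (p q : R) : R :=
  (memory_coef m p + memory_coef m q) / 2.

Definition delta_coef (m : nat) (p q : R) : R :=
  (memory_coef m p - memory_coef m q) / 2.

Definition fset_mean (d : nat) (V : {fset 'rV[R]_d}) : 'rV[R]_d :=
  (#|` V|%:R)^-1 *: \sum_(v <- V) v.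

(* For row vectors, u^T *m u is the d x d matrix of the outer product. *)
Definition fset_scatter (d : nat) (V : {fset 'rV[R]_d}) : 'M[R]_d :=
  \sum_(v <- V) (v - fset_mean V)^T *m (v - fset_mean V).

End Coefficients.

Record step_system (R : realType) (d : nat) (Se So : set 'rV[R]_d)
    (Ve Vo : {fset 'rV[R]_d}) : Prop := {
  even_to_odd : forall x v, Se x -> v \in Vo -> So (x + v);
  odd_to_even : forall x v, So x -> v \in Ve -> Se (x + v);
  steps_opp : Vo = [fset - v | v in Ve]%fset;
  origin_even : Se 0;
  steps_disjoint : (Vo `&` Ve)%fset = fset0
}.

Section ElephantRandomWalk.
Context {R : realType} {d : nat} {d0 : measure_display}
  {T : measurableType d0}.
Variables (P : probability T R) (Ve Vo : {fset 'rV[R]_d}).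

(* The steps available at time k, called W in [elephant_walk]. *)
Definition steps_at (k : nat) : {fset 'rV[R]_d} := if odd k then Vo else Ve.

Definition all_steps : {fset 'rV[R]_d} := (Vo `|` Ve)%fset.

(* The values G k v for k < 2 or v outside Vo `|` Ve, U 0 and X 0 are junk. *)
Record elephant_walk (p q : R)
    (G : nat -> 'rV[R]_d -> {RV P >-> borel_rV R d})
    (U : nat -> {RV P >-> nat})
    (X1 : {RV P >-> borel_rV R d})
    (X S : nat -> T -> 'rV[R]_d) : Prop := {
  G_values : forall k v w, (2 <= k)%N -> v \in all_steps ->
    G k v w \in steps_at k;
  G_law_same : forall k v u, (2 <= k)%N -> v \in all_steps ->
    v \in steps_at k -> u \in steps_at k ->
    P [set w | G k v w = u] =
      (if u == v then p else (1 - p) / (#|` Vo|%:R - 1))%:E;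
  G_law_opp : forall k v u, (2 <= k)%N -> v \in all_steps ->
    v \notin steps_at k -> u \in steps_at k ->
    P [set w | G k v w = u] =
      (if u == - v then q else (1 - q) / (#|` Vo|%:R - 1))%:E;
  X1_values : forall w, X1 w \in Vo;
  X1_law : forall u, u \in Vo ->
    P [set w | X1 w = u] = (#|` Vo|%:R^-1)%:E;
  U_values : forall n w, (1 <= n)%N -> (1 <= U n w <= n)%N;
  U_law : forall n i, (1 <= n)%N -> (1 <= i <= n)%N ->
    P [set w | U n w = i] = (n%:R^-1)%:E;
  blocks_independent : mutually_independent P (fun n =>
    if n is 0%N then sigma_of X1
    else sigma_join (sigma_of (U n))
                    (sigma_of_family [set` all_steps] (G n.+1)));
  U_G_independent : forall n, (1 <= n)%N ->
    independent2 P (sigma_of (U n))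
                   (sigma_of_family [set` all_steps] (G n.+1));
  X_first : X 1%N = X1;
  X_next : forall n w, (1 <= n)%N -> X n.+1 w = G n.+1 (X (U n w) w) w;
  S_zero : forall w, S 0%N w = 0;
  S_next : forall n w, S n.+1 w = S n w + X n.+1 w
}.

End ElephantRandomWalk.

(* Main.v *)
Require Import Defs.
From HB Require Import structures.
From mathcomp Require Import all_boot all_order all_algebra finmap.
From mathcomp Require Import all_classical all_reals all_analysis.
From mathcomp Require Import measurable_realfun.
From mathcomp Require Import ring lra.

(** The walk is not Markovian, but only two numbers attached to the past matter
    for a scalar projection.  Let l be an odd function of the steps (a linear
    functional), let f be l minus its mean over Vo, and extend f to all steps
    both as an even and as an odd function.  Write C and D for the sums of these
    extensions over the first n steps, and eps = 1 or -1 according to whether the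
    time n + 1 of the next step is odd or even.  Averaging the law of the next step over the
    remembered time shows that, given the past, the next increments of C and D
    have means (gamma C + eps delta D) / n and (eps gamma C + delta D) / n
    ([step_mean_even_ext]).  The walk itself is D up to a bounded term
    ([sum_path_odd]), and its drift delta D / n gives the variance factor
    1 / (1 - 2 delta).  The remaining drift eps gamma C / n alternates in sign;
    it disappears in the compensated sum A = D + eps gamma C / (2 n), whose
    increments are bounded, have conditional mean delta A / n + O(1 / n)
    ([Aincr_mean]) and conditional second moment sigma^2 + o(1) in mean, where
    sigma^2 is the mean of f^2 over Vo ([Aincr_sqr_mean]).  Here delta < 1/2
    makes the second moment of A linear in n ([Asum_sqr_linear]), and gamma < 1
    makes C negligible with respect to n ([mean_Csum_cvg0]); with f^2 - sigma^2 in
    place of f, the same bounds control the conditional second moment.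

    The scalar limit theorem is then a contraction argument.  For the mean
    psi_n(t) of cos (t A / sqrt n + c), a second order expansion of one step gives
    psi_(n+1)(t) = (1 - t^2 sigma^2 / (2 (n + 1))) psi_n(lambda_n t) + |t| o(1/n)
    with lambda_n = (1 + delta / n) sqrt (n / (n + 1)) ([char_step]), and
    g(t) = cos c exp (- t^2 sigma^2 / (2 (1 - 2 delta))) satisfies the same
    relation.  Since lambda_n is at most 1 - k / (n + 1) for some k > 0, the best
    constant d_n in |psi_n(t) - g(t)| <= d_n |t| for |t| <= 1 satisfies
    d_(n+1) <= (1 - k / (n + 1)) d_n + o(1/n), whence d_n tends to 0
    ([psi_cvg], [path_char_cvg]).

    Convergence of the means of all cos (<t, x> + c) is upgraded to bounded
    continuous functions by tightness and a trigonometric version of the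
    Bernstein approximation ([levy_continuity]).  The same statement, applied to
    a constant sequence, shows that a law on the line is determined by these
    means ([law_eq_of_cos]), which identifies the projections of the Gaussian
    limit, built from independent normal coordinates ([gaussian_exists]).
    Finally the independence of the blocks (U_n, G_(n+1)) shows that integrals
    over the probability space are iterated means over finite paths
    ([path_law]). *)

Set Implicit Arguments.
Unset Strict Implicit.
Unset Printing Implicit Defensive.

Import Order.TTheory GRing.Theory Num.Theory.
Import numFieldNormedType.Exports.

Local Open Scope classical_set_scope.
Local Open Scope ring_scope.

(** * Recursive inequalities and expansions of the cosine *)

Ltac nonneg := repeat first [done | by apply: ltW | exact: sqr_ge0
  | exact: sqrtr_ge0 | exact: expR_ge0 | apply: divr_ge0 | apply: addr_ge0
  | apply: mulr_ge0 | apply: exprn_ge0].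

Lemma harmonic_series_unbounded (R : realType) (B : R) :
  exists n, B < series (@harmonic R) n.
Proof.
apply: contrapT => hB; apply: (@dvg_harmonic R).
apply: nondecreasing_is_cvgn.
  apply/nondecreasing_seqP => n.
  by rewrite /series /= big_nat_recr //= lerDl harmonic_ge0.
exists B => _ [n _ <-]; rewrite leNgt; apply/negP => Bn; apply: hB.
by exists n.
Qed.

(** The factors 1 - c/(n+1) multiply to 0 because the harmonic series diverges.
    Concretely, once e is below c eps/2, the excess of d over eps/2 decays at
    least like the inverse of 1 + c (H_n - H_M), with H the harmonic sums. *)
Lemma cvg0_of_contraction (R : realType) (d e : R^nat) (c : R) (N : nat) :
  0 < c -> (forall n, 0 <= d n) ->
  (forall n, (N <= n)%N ->
    d n.+1 <= (1 - c / n.+1%:R) * d n + e n / n.+1%:R) ->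
  e n @[n --> \oo] --> 0 -> d n @[n --> \oo] --> 0.
Proof.
move=> c0 d0 hd e0; apply/cvgrPdist_le => eps eps0.
have ce : 0 < c * (eps / 2) by rewrite mulr_gt0 // divr_gt0.
have /cvgrPdist_le/(_ _ ce) [M1 _ hM1] := e0.
have [M2 hM2] : exists M : nat, c <= M%:R.
  by exists (Num.bound c); rewrite ltW // archi_boundP // ltW.
pose M := maxn N (maxn M1 M2).
pose Z := Num.max 0 (d M - eps / 2).
have Z0 : 0 <= Z by rewrite le_max lexx.
pose H n := series (@harmonic R) n - series (@harmonic R) M.
have HS n : H n.+1 = H n + n.+1%:R^-1.
  by rewrite /H /series /= big_nat_recr //= addrAC.
have H0 k : 0 <= H (M + k)%N.
  by elim: k => [|k IH]; rewrite ?addn0 ?addnS ?HS /H ?subrr // addr_ge0 // invr_ge0.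
have key k : (d (M + k)%N - eps / 2) * (1 + c * H (M + k)%N) <= Z.
  elim: k => [|k IH].
    by rewrite addn0 /H subrr mulr0 addr0 mulr1 le_max lexx orbT.
  rewrite addnS; set n := (M + k)%N in IH *.
  have nN : (N <= n)%N by rewrite (leq_trans (leq_maxl N (maxn M1 M2))) ?leq_addr.
  have nM1 : (M1 <= n)%N.
    by rewrite (leq_trans (leq_trans (leq_maxl M1 M2) (leq_maxr N _))) ?leq_addr.
  have nM2 : (M2 <= n)%N.
    by rewrite (leq_trans (leq_trans (leq_maxr M1 M2) (leq_maxr N _))) ?leq_addr.
  have en : e n <= c * (eps / 2).
    by have := hM1 n nM1; rewrite /= sub0r normrN; apply: le_trans; rewrite ler_norm.
  have Hn : 0 <= H n by exact: H0.
  rewrite HS; have := hd n nN.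
  have i0 : 0 < n.+1%:R^-1 :> R by rewrite invr_gt0.
  have ci : c * n.+1%:R^-1 <= 1.
    rewrite ler_pdivrMr ?ltr0n // mul1r (le_trans hM2) // ler_nat.
    exact: leq_trans nM2 (leqnSn _).
  set i := n.+1%:R^-1 in i0 ci *; set h := H n in IH Hn *.
  move: (d n) (d n.+1) (e n) en IH => x y en hen IH hy.
  have zy : y - eps / 2 <= (1 - c * i) * (x - eps / 2).
    apply: le_trans (_ : (1 - c * i) * x + c * (eps / 2) * i - eps / 2 <= _).
      by rewrite lerB // (le_trans hy) // lerD2l ler_wpM2r // ltW.
    by rewrite le_eqVlt; apply/orP; left; apply/eqP; ring.
  have ch : 0 <= c * h by rewrite mulr_ge0 // ltW.
  have ci0 : 0 <= c * i by rewrite mulr_ge0 // ltW.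
  have pos : 0 <= 1 + c * (h + i) by rewrite mulrDr !addr_ge0.
  apply: (le_trans (ler_wpM2r pos zy)).
  have [x0|x0] := leP (x - eps / 2) 0.
    apply: le_trans Z0.
    rewrite mulr_le0_ge0 // mulr_ge0_le0 // subr_ge0 //.
  apply: le_trans IH; rewrite mulrAC mulrC ler_wpM2l ?(ltW x0) //.
  rewrite -subr_ge0.
  have -> : 1 + c * h - (1 - c * i) * (1 + c * (h + i))
     = (c * i) * (c * h) + (c * i) * (c * i) by ring.
  by rewrite addr_ge0 // mulr_ge0.
have [K hK] := harmonic_series_unbounded (series (@harmonic R) M + Z / (c * (eps / 2))).
exists (M + K)%N => // n /= hn.
rewrite sub0r normrN ger0_norm //.
have [k nk] : exists k, n = (M + k)%N.
  by exists (n - M)%N; rewrite subnKC // (leq_trans (leq_addr K M)).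
have := key k; rewrite -nk => kn.
have Hn : Z / (c * (eps / 2)) <= H n.
  rewrite /H lerBrDr addrC (le_trans (ltW hK)) //.
  have /nondecreasing_seqP : forall n, series (@harmonic R) n <= series (@harmonic R) n.+1.
    by move=> j; rewrite /series /= big_nat_recr //= lerDl harmonic_ge0.
  by apply; rewrite (leq_trans (leq_addl M K)).
rewrite leNgt; apply/negP => dn.
have h1 : Z <= H n * (c * (eps / 2)) by rewrite -ler_pdivrMr.
have Hn0 : 0 <= H n by rewrite nk H0.
have : eps / 2 * (1 + c * H n) <= Z.
  apply: le_trans kn; rewrite ler_wpM2r //.
    by rewrite addr_ge0 // mulr_ge0 // ltW.
  by lra.
rewrite mulrDr mulr1 => h2.
have : eps / 2 + eps / 2 * (c * H n) <= eps / 2 * (c * H n).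
  apply: le_trans h2 _; apply: le_trans h1 _.
  by rewrite le_eqVlt; apply/orP; left; apply/eqP; ring.
by rewrite gerDr leNgt divr_gt0.
Qed.

(** As a < 1, the function K n is a supersolution of the recursion for K large. *)
Lemma linear_bound_of_recursion (R : realType) (x : R^nat) (a b : R) (N : nat) :
  0 <= a < 1 -> 0 <= b -> (0 < N)%N ->
  (forall n, (N <= n)%N -> x n.+1 <= (1 + a / n%:R) * x n + b) ->
  exists K, 0 <= K /\ forall n, (N <= n)%N -> x n <= K * n%:R.
Proof.
move=> /andP[a0 a1] b0 N0 hx.
pose K := Num.max (b / (1 - a)) (Num.max 0 (x N / N%:R)).
have K0 : 0 <= K by rewrite !le_max lexx !orbT.
exists K; split=> // n /subnKC <-; elim: (n - N)%N => [|k IH].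
  by rewrite addn0 -ler_pdivrMr ?ltr0n // !le_max lexx !orbT.
rewrite addnS; set j := (N + k)%N in IH *.
have j0 : 0 < j%:R :> R by rewrite ltr0n (leq_trans N0) // leq_addr.
apply: (le_trans (hx j (leq_addr _ _))).
have h : (1 + a / j%:R) * x j <= (1 + a / j%:R) * (K * j%:R).
  by rewrite ler_wpM2l // addr_ge0 // divr_ge0 // ltW.
have hb : b <= K * (1 - a) by rewrite -ler_pdivrMr ?subr_gt0 // le_max lexx.
apply: (le_trans (lerD h hb)); rewrite -natr1 le_eqVlt; apply/orP; left.
by apply/eqP; field; rewrite gt_eqF.
Qed.

(** The crude mean value constant C (and not C / (k+1)) suffices for all the
    expansions below. *)
Lemma norm_le_pow_of_deriv (R : realType) (f df : R -> R) (k : nat) (C : R) :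
  (forall x : R, is_derive x 1 f (df x)) -> f 0 = 0 ->
  (forall x, `|df x| <= C * `|x| ^+ k) ->
  forall x, `|f x| <= C * `|x| ^+ k.+1.
Proof.
move=> fdf f0 hdf x.
have cf a b : {within `[a, b], continuous f}.
  apply: continuous_subspaceT => y; apply: differentiable_continuous.
  by apply/derivable1_diffP; apply: ex_derive.
have C0 : 0 <= C.
  by have := hdf 1; rewrite normr1 expr1n mulr1; apply: le_trans.
have [x0|x0] := leP 0 x.
  have [c] := MVT_segment x0 (fun y _ => fdf y) (cf _ _).
  rewrite f0 !subr0 in_itv /= => /andP[c0 cx] ->.
  rewrite normrM exprSr mulrA ler_wpM2r // (le_trans (hdf c)) //.
  by rewrite ler_wpM2l // lerXn2r ?nnegrE // !ger0_norm.
have [c] := MVT_segment (ltW x0) (fun y _ => fdf y) (cf _ _).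
rewrite f0 !sub0r in_itv /= => /andP[cx c0] /eqP.
rewrite eqr_oppLR => /eqP ->.
rewrite normrN normrM normrN exprSr mulrA ler_wpM2r // (le_trans (hdf c)) //.
by rewrite ler_wpM2l // lerXn2r ?nnegrE // !ler0_norm ?lerN2 // ltW.
Qed.

Section CosineExpansion.
Variable R : realType.
Implicit Types a h x : R.

Lemma norm_sin_le x : `|sin x| <= `|x|.
Proof.
rewrite -[leRHS]mul1r -[X in _ * X]expr1.
apply: (@norm_le_pow_of_deriv R sin cos 0) => [|y]; first exact: sin0.
by rewrite expr0 mulr1 ler_norml cos_geN1 cos_le1.
Qed.

Lemma norm_sinB_le x : `|sin x - x| <= `|x| ^+ 3.
Proof.
rewrite -[leRHS]mul1r.
apply: (@norm_le_pow_of_deriv R (fun y => sin y - y) (fun y => cos y - 1) 2).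
- by rewrite sin0 subr0.
move=> y; rewrite mul1r -[leRHS]mul1r.
apply: (@norm_le_pow_of_deriv R (fun y => cos y - 1) (fun y => - sin y) 1) => [z||z].
- by rewrite -[- sin z]subr0; apply: is_deriveB.
- by rewrite cos0 subrr.
- by rewrite normrN mul1r expr1 norm_sin_le.
Qed.

Lemma norm_cosB1_le x : `|cos x - 1| <= `|x|.
Proof.
rewrite -[leRHS]mul1r -[X in _ * X]expr1.
apply: (@norm_le_pow_of_deriv R (fun y => cos y - 1) (fun y => - sin y) 0) => [z||z].
- by rewrite -[- sin z]subr0; apply: is_deriveB.
- by rewrite cos0 subrr.
- by rewrite expr0 mulr1 normrN ler_norml sin_geN1 sin_le1.
Qed.

Lemma norm_cosB1D_le x : `|cos x - 1 + x ^+ 2 / 2| <= `|x| ^+ 3.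
Proof.
rewrite -[leRHS]mul1r.
apply: (@norm_le_pow_of_deriv R (fun y => cos y - 1 + y ^+ 2 / 2)
  (fun y => y - sin y) 2) => [y||y].
- rewrite addrC; apply: is_deriveD.
    by rewrite -[- sin y]subr0; apply: is_deriveB.
  have -> : (fun z : R => z ^+ 2 / 2) = (fun z : R => 2^-1 * z ^+ 2).
    by apply/funext => z; rewrite mulrC.
  apply: is_derive_eq.
  by rewrite /GRing.scale /= !mulr1; field.
- by rewrite cos0 subrr expr0n /= mul0r addr0.
rewrite mul1r -[leRHS]mul1r.
apply: (@norm_le_pow_of_deriv R (fun y => y - sin y) (fun y => 1 - cos y) 1) => [|z].
- by rewrite sin0 subr0.
- by rewrite mul1r expr1 distrC norm_cosB1_le.
Qed.

Lemma cos_lip a h : `|cos (a + h) - cos a| <= 2 * `|h|.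
Proof.
have -> : cos (a + h) - cos a = cos a * (cos h - 1) - sin a * sin h.
  by rewrite cosD; ring.
rewrite mulrDl mul1r (le_trans (ler_normB _ _)) // !normrM lerD //.
  rewrite (le_trans _ (norm_cosB1_le h)) // ler_piMl //.
  by rewrite ler_norml cos_geN1 cos_le1.
rewrite (le_trans _ (norm_sin_le h)) // ler_piMl //.
by rewrite ler_norml sin_geN1 sin_le1.
Qed.

Lemma cos_taylor2 a h :
  `|cos (a + h) - (cos a - h * sin a - h ^+ 2 / 2 * cos a)| <= 2 * `|h| ^+ 3.
Proof.
have -> : cos (a + h) - (cos a - h * sin a - h ^+ 2 / 2 * cos a) =
  cos a * (cos h - 1 + h ^+ 2 / 2) - sin a * (sin h - h).
  by rewrite cosD; ring.
rewrite mulrDl mul1r (le_trans (ler_normB _ _)) // !normrM lerD //.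
  rewrite (le_trans _ (norm_cosB1D_le h)) // ler_piMl //.
  by rewrite ler_norml cos_geN1 cos_le1.
rewrite (le_trans _ (norm_sinB_le h)) // ler_piMl //.
by rewrite ler_norml sin_geN1 sin_le1.
Qed.

Lemma cos_taylor1 a h : `|cos (a + h) - (cos a - h * sin a)| <= 2 * h ^+ 2.
Proof.
have -> : cos (a + h) - (cos a - h * sin a) =
  cos a * (cos h - 1) - sin a * (sin h - h) by rewrite cosD; ring.
rewrite mulrDl mul1r (le_trans (ler_normB _ _)) // !normrM lerD //.
  rewrite (@le_trans _ _ `|cos h - 1|) ?ler_piMl //.
    by rewrite ler_norml cos_geN1 cos_le1.
  rewrite -real_normK ?num_real // -[leRHS]mul1r.
  apply: (@norm_le_pow_of_deriv R (fun y => cos y - 1) (fun y => - sin y) 1) => [z||z].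
  - by rewrite -[- sin z]subr0; apply: is_deriveB.
  - by rewrite cos0 subrr.
  - by rewrite normrN mul1r expr1 norm_sin_le.
rewrite (@le_trans _ _ `|sin h - h|) ?ler_piMl //.
  by rewrite ler_norml sin_geN1 sin_le1.
rewrite -real_normK ?num_real // -[leRHS]mul1r.
apply: (@norm_le_pow_of_deriv R (fun y => sin y - y) (fun y => cos y - 1) 1).
- by rewrite sin0 subr0.
- by move=> y; rewrite mul1r expr1 norm_cosB1_le.
Qed.

Lemma expRN_taylor1 x : 0 <= x -> `|expR (- x) - (1 - x)| <= x ^+ 2.
Proof.
move=> x0; have h1 := expR_ge1Dx (- x).
have h2 := expR_ge1Dx x.
have h3 : expR x * expR (- x) = 1 by rewrite expRxMexpNx_1.
have h4 := expR_gt0 (- x).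
rewrite ger0_norm; last by rewrite subr_ge0.
set y := expR (- x) in h1 h3 h4 *.
have h5 : (1 + x) * y <= 1 by rewrite -[leRHS]h3 ler_wpM2r // ltW.
have h6 : (1 + x) * y <= (1 + x) * (1 - x + x ^+ 2).
  rewrite (le_trans h5) //.
  have -> : (1 + x) * (1 - x + x ^+ 2) = 1 + x ^+ 3 by ring.
  by rewrite lerDl exprn_ge0.
rewrite ler_pM2l in h6; first by lra.
by rewrite ltr_pwDl.
Qed.

End CosineExpansion.

(** One step of the recursion for characteristic functions: X is the mean of
    cos (a + tau Y) for a small tau Y with moments m1 and m2, and m1 and m2 are
    replaced by their leading terms al and v, the first being absorbed into the
    argument of the cosine. *)
Lemma cos_second_order (R : realType) (X a tau m1 m2 al v r : R) :
  0 <= v ->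
  `|X - (cos a - tau * m1 * sin a - tau ^+ 2 / 2 * m2 * cos a)| <= r ->
  `|X - (1 - tau ^+ 2 * v / 2) * cos (a + tau * al)| <=
  r + `|tau| * `|m1 - al| + tau ^+ 2 * `|m2 - v| + 2 * (tau * al) ^+ 2
    + tau ^+ 2 * v * (`|tau| * `|al|).
Proof.
move=> v0 hX; set y := tau ^+ 2 * v / 2.
have y0 : 0 <= y by rewrite divr_ge0 // mulr_ge0 // sqr_ge0.
have -> : X - (1 - y) * cos (a + tau * al) =
  (X - (cos a - tau * m1 * sin a - tau ^+ 2 / 2 * m2 * cos a))
  - tau * (m1 - al) * sin a - tau ^+ 2 * (m2 - v) / 2 * cos a
  - (cos (a + tau * al) - (cos a - tau * al * sin a))
  + y * (cos (a + tau * al) - cos a) by rewrite /y; ring.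
apply: (le_trans (ler_normD _ _)); apply: lerD.
  apply: (le_trans (ler_normB _ _)); apply: lerD; last exact: cos_taylor1.
  apply: (le_trans (ler_normB _ _)); apply: lerD.
    apply: (le_trans (ler_normB _ _)); apply: lerD => //.
    rewrite !normrM ler_piMr ?mulr_ge0 //.
    by rewrite ler_norml sin_geN1 sin_le1.
  rewrite normrM (normrM (tau ^+ 2 * (m2 - v))) (normrM (tau ^+ 2)).
  rewrite (ger0_norm (sqr_ge0 tau)) normfV normr_nat -mulrA.
  apply: ler_piMr; first by rewrite mulr_ge0 ?sqr_ge0.
  apply: mulr_ile1 => //.
    by rewrite invf_le1 // ler1n.
  by rewrite ler_norml cos_geN1 cos_le1.
rewrite normrM (ger0_norm y0).
apply: (le_trans (ler_wpM2l y0 (cos_lip _ _))).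
by rewrite normrM le_eqVlt; apply/orP; left; apply/eqP; rewrite /y; field.
Qed.

Lemma cvg0_of_sqr_le (R : realType) (u v : R^nat) :
  (forall n, 0 <= u n) -> (forall n, (0 < n)%N -> u n ^+ 2 <= v n) ->
  v n @[n --> \oo] --> 0 -> u n @[n --> \oo] --> 0.
Proof.
move=> u0 uv /cvgrPdist_le v0; apply/cvgrPdist_le => eps eps0.
have e2 : 0 < eps ^+ 2 by rewrite exprn_gt0.
have [N _ hN] := v0 _ e2; exists N.+1 => // n /= hn.
have n0 : (0 < n)%N by exact: leq_trans hn.
rewrite sub0r normrN (ger0_norm (u0 n)) -ler_sqr ?nnegrE ?(ltW eps0) //.
apply: le_trans (uv n n0) _; have := hN n (ltnW hn).
by rewrite /= sub0r normrN; apply: le_trans; exact: ler_norm.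
Qed.

Lemma cvg0_cst_div (R : realType) (K : R) : K / n%:R @[n --> \oo] --> 0.
Proof.
have : K * harmonic n @[n --> \oo] --> K * 0.
  by apply: cvgMr; exact: cvg_harmonic.
by rewrite mulr0 => h; rewrite -(cvg_shiftS (fun n => K / n%:R)).
Qed.

(** Measuring the distance of psi_n to g by the best constant D_n in
    |psi_n(t) - g(t)| <= D_n |t| on [-1, 1], the substitution t -> lam_n t
    contracts D_n by lam_n, which leaves the recursion of
    [cvg0_of_contraction]. *)
Lemma cvg1_of_scaling_contraction (R : realType) (psi : nat -> R -> R)
  (g : R -> R) (lam e : R^nat) (c K0 : R) (N : nat) :
  0 < c -> 0 <= K0 -> (forall n, 0 <= e n) -> e n @[n --> \oo] --> 0 ->
  (forall n, (N <= n)%N -> 0 <= lam n <= 1 - c / n.+1%:R) ->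
  (forall n t, (N <= n)%N -> `|t| <= 1 ->
    `|psi n.+1 t - g t| <=
    `|psi n (lam n * t) - g (lam n * t)| + e n / n.+1%:R * `|t|) ->
  (forall t, `|t| <= 1 -> `|psi N t - g t| <= K0 * `|t|) ->
  psi n 1 @[n --> \oo] --> g 1.
Proof.
move=> c0 K00 e0 ecvg hlam hstep hN.
pose D := fix D k := if k is k'.+1 then
  (1 - c / (N + k').+1%:R) * D k' + e (N + k')%N / (N + k').+1%:R else K0.
have lam1 k : 0 <= 1 - c / (N + k).+1%:R.
  by have /andP[] := hlam _ (leq_addr k N); exact: le_trans.
have D0 k : 0 <= D k.
  by elim: k => //= k IH; rewrite addr_ge0 ?mulr_ge0 // ?invr_ge0.
have hD k t : `|t| <= 1 -> `|psi (N + k)%N t - g t| <= D k * `|t|.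
  elim: k t => [|k IH] t t1; first by rewrite addn0 hN.
  rewrite addnS; apply: (le_trans (hstep _ _ (leq_addr _ _) t1)).
  have /andP[l0 l1] := hlam _ (leq_addr k N).
  rewrite /= mulrDl lerD2r.
  have lt1 : `|lam (N + k)%N * t| <= 1.
    rewrite normrM mulr_ile1 // ger0_norm // (le_trans l1) //.
    by rewrite gerBl divr_ge0 // ltW.
  apply: (le_trans (IH _ lt1)); rewrite normrM (ger0_norm l0) mulrCA mulrA.
  by rewrite ler_wpM2r // ler_wpM2r.
have Dcvg : D (n - N)%N @[n --> \oo] --> 0.
  apply: (@cvg0_of_contraction _ _ e c N) => // n Nn.
  by rewrite subSn //= subnKC.
apply/cvgrPdist_le => eps eps0; move/cvgrPdist_le : Dcvg => /(_ _ eps0)[M _ hM].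
exists (maxn M N) => // n /=; rewrite geq_max => /andP[Mn Nn].
rewrite distrC -(subnKC Nn); apply: (le_trans (hD _ 1 _)); rewrite ?normr1 //.
rewrite mulr1; have := hM n Mn; rewrite /= sub0r normrN.
by apply: le_trans; exact: ler_norm.
Qed.

Lemma cvg0D (R : realType) (u v : R^nat) :
  u n @[n --> \oo] --> 0 -> v n @[n --> \oo] --> 0 ->
  u n + v n @[n --> \oo] --> 0.
Proof.
move=> u0 v0; have : u n + v n @[n --> \oo] --> (0 + 0 : R) by exact: cvgD.
by rewrite addr0.
Qed.

Lemma cvg0Z (R : realType) (a : R) (u : R^nat) :
  u n @[n --> \oo] --> 0 -> a * u n @[n --> \oo] --> 0.
Proof.
move=> u0; have : a * u n @[n --> \oo] --> a * 0 by exact: cvgMr.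
by rewrite mulr0.
Qed.

Lemma sqrD_le (R : realType) (x y : R) : (x + y) ^+ 2 <= 2 * x ^+ 2 + 2 * y ^+ 2.
Proof.
rewrite -subr_ge0.
have -> : 2 * x ^+ 2 + 2 * y ^+ 2 - (x + y) ^+ 2 = (x - y) ^+ 2 by ring.
exact: sqr_ge0.
Qed.

(** * Finite path averages *)

Section Averages.
Variables (R : realType) (T : Type).

(** The finite expectations used below: positive normalized linear functionals
    that see only the points of S. *)
Record is_average (S : T -> Prop) (E : (T -> R) -> R) : Prop := {
  average_lin : forall a f g, E (fun x => a * f x + g x) = a * E f + E g;
  average_le : forall f g, (forall x, S x -> f x <= g x) -> E f <= E g;
  average_cst : forall c, E (fun=> c) = c }.

Variables (S : T -> Prop) (E : (T -> R) -> R).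
Hypothesis hE : is_average S E.
Implicit Types f g : T -> R.

Lemma averageD f g : E (fun x => f x + g x) = E f + E g.
Proof.
rewrite -[in RHS](mul1r (E f)) -(average_lin hE).
by congr E; apply/funext => x; rewrite mul1r.
Qed.

Lemma averageZ a f : E (fun x => a * f x) = a * E f.
Proof.
rewrite -[RHS]addr0 -(average_cst hE 0) -(average_lin hE).
by congr E; apply/funext => x; rewrite addr0.
Qed.

Lemma averageN f : E (fun x => - f x) = - E f.
Proof.
rewrite -mulN1r -averageZ; congr E; apply/funext => x.
by rewrite mulN1r.
Qed.

Lemma averageB f g : E (fun x => f x - g x) = E f - E g.
Proof. by rewrite averageD averageN. Qed.

Lemma eq_average f g : (forall x, S x -> f x = g x) -> E f = E g.
Proof.
move=> fg; apply/eqP; rewrite eq_le.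
by apply/andP; split; apply: (average_le hE) => x /fg ->.
Qed.

Lemma average_ge0 f : (forall x, S x -> 0 <= f x) -> 0 <= E f.
Proof. by move=> f0; rewrite -(average_cst hE 0); exact: (average_le hE). Qed.

Lemma average_norm f : `|E f| <= E (fun x => `|f x|).
Proof.
rewrite ler_norml -averageN.
by apply/andP; split; apply: (average_le hE) => x _; rewrite ?ler_norm // lerNl -normrN ler_norm.
Qed.

Lemma average_dist f g h : (forall x, S x -> `|f x - g x| <= h x) ->
  `|E f - E g| <= E h.
Proof.
by move=> fg; rewrite -averageB (le_trans (average_norm _)) //; exact: (average_le hE).
Qed.

Lemma average_norm_le f B : (forall x, S x -> `|f x| <= B) -> `|E f| <= B.
Proof.
move=> fB; rewrite (le_trans (average_norm _)) // -(average_cst hE B).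
exact: (average_le hE).
Qed.

Lemma average_sum (I : Type) (r : seq I) (P : pred I) (f : I -> T -> R) :
  E (fun x => \sum_(i <- r | P i) f i x) = \sum_(i <- r | P i) E (f i).
Proof.
elim: r => [|i r IH].
  rewrite [RHS]big_nil -[RHS](average_cst hE 0); congr E; apply/funext => x.
  by rewrite big_nil.
rewrite big_cons -IH; case: (boolP (P i)) => Pi.
  by rewrite -averageD; congr E; apply/funext => x; rewrite big_cons Pi.
by congr E; apply/funext => x; rewrite big_cons (negbTE Pi).
Qed.

Lemma average_sqr_norm f : (E (fun x => `|f x|)) ^+ 2 <= E (fun x => f x ^+ 2).
Proof.
set c := E (fun x => `|f x|).
have : 0 <= E (fun x => (- 2 * c) * `|f x| + (f x ^+ 2 + c ^+ 2)).
  apply: average_ge0 => x _.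
  have -> : - 2 * c * `|f x| + (f x ^+ 2 + c ^+ 2) = (`|f x| - c) ^+ 2.
    by rewrite -[f x ^+ 2]real_normK ?num_real //; ring.
  exact: sqr_ge0.
rewrite (average_lin hE) averageD (average_cst hE) -/c; lra.
Qed.

End Averages.

Section PathMean.
Variables (R : realType) (d : nat) (Ve Vo : {fset 'rV[R]_d}) (p q : R).
Local Notation V := 'rV[R]_d.
Local Notation m := #|` Vo|.
Local Notation steps := (steps_at Ve Vo).

Definition jump_law (k : nat) (v w : V) : R :=
  if v \in steps k then (if w == v then p else (1 - p) / (m%:R - 1))
  else (if w == - v then q else (1 - q) / (m%:R - 1)).

(** The law of step n+1 given the path s of the first n steps: the remembered
    step v is uniform in s. *)
Definition step_law (n : nat) (s : seq V) (w : V) : R :=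
  if n is 0%N then m%:R^-1
  else n%:R^-1 * \sum_(v <- s) jump_law n.+1 v w.

Definition step_mean (n : nat) (s : seq V) (h : V -> R) : R :=
  \sum_(w <- steps n.+1) step_law n s w * h w.

(** The expectation of h over the first n steps, by conditioning on all but the
    last one.  Taking this recursion as the definition keeps the limit theorem
    free of measure theory; [path_law] makes the link. *)
Fixpoint path_mean (n : nat) (h : seq V -> R) : R :=
  if n is n'.+1 then
    path_mean n' (fun s => step_mean n' s (fun w => h (rcons s w)))
  else h [::].

Definition is_path (n : nat) (s : seq V) : Prop :=
  size s = n /\ forall i, (i < n)%N -> nth 0 s i \in steps i.+1.

Lemma is_path_rcons n s w :
  is_path n s -> w \in steps n.+1 -> is_path n.+1 (rcons s w).
Proof.
move=> [sn hs] hw; split; first by rewrite size_rcons sn.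
move=> i; rewrite ltnS leq_eqVlt nth_rcons sn => /predU1P[->|ltin].
  by rewrite ltnn eqxx.
by rewrite ltin hs.
Qed.

(** The parity sign by which even and odd extensions of a function on Vo differ
    on the steps available at time k. *)
Definition sgn_at (k : nat) : R := if odd k then 1 else - 1.

Lemma sgn_atS k : sgn_at k.+1 = - sgn_at k.
Proof. by rewrite /sgn_at /=; case: odd; rewrite ?opprK. Qed.

Lemma sgn_atK k : sgn_at k * sgn_at k = 1.
Proof. by rewrite /sgn_at; case: odd; rewrite ?mulN1r ?opprK ?mulr1. Qed.

Lemma norm_sgn_at k : `|sgn_at k| = 1.
Proof. by rewrite /sgn_at; case: odd; rewrite ?normrN normr1. Qed.

Hypotheses (hopp : Vo = [fset - v | v in Ve]%fset)
  (hdisj : (Vo `&` Ve)%fset = fset0) (hm2 : (2 <= m)%N)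
  (hp : 0 <= p <= 1) (hq : 0 <= q <= 1).

Let mN0 : m%:R != 0 :> R.
Proof. by rewrite pnatr_eq0 -lt0n (leq_trans _ hm2). Qed.

Let m1_gt0 : 0 < m%:R - 1 :> R.
Proof. by rewrite subr_gt0 ltr1n. Qed.

Lemma mem_oppVo v : (- v \in Vo) = (v \in Ve).
Proof.
rewrite hopp; apply/imfsetP/idP => [[u /= ue /oppr_inj ->//]|ve].
by exists v.
Qed.

Lemma mem_oppVe v : (- v \in Ve) = (v \in Vo).
Proof. by rewrite -mem_oppVo opprK. Qed.

Lemma VeF_of_Vo v : v \in Vo -> v \in Ve = false.
Proof.
move=> vo; apply/negP => ve.
have : v \in (Vo `&` Ve)%fset by rewrite in_fsetI vo ve.
by rewrite hdisj in_fset0.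
Qed.

Lemma perm_Vo_oppVe : perm_eq Vo (map -%R Ve).
Proof.
apply: uniq_perm; first exact: fset_uniq.
  by rewrite (map_inj_uniq oppr_inj) fset_uniq.
move=> v; rewrite -[v]opprK (mem_map oppr_inj) opprK.
by rewrite -[RHS]mem_oppVo opprK.
Qed.

Lemma cardVe : #|` Ve| = m.
Proof. by have /perm_size := perm_Vo_oppVe; rewrite size_map => ->. Qed.

Lemma card_steps k : #|` steps k| = m.
Proof. by rewrite /steps_at; case: odd => //; exact: cardVe. Qed.

Lemma mem_all_steps v k :
  (v \in all_steps Ve Vo) = (v \in steps k) || (- v \in steps k).
Proof.
rewrite /all_steps /steps_at inE; case: odd; first by rewrite mem_oppVo.
by rewrite mem_oppVe orbC.
Qed.

Lemma mem_steps_all v k : v \in steps k -> v \in all_steps Ve Vo.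
Proof. by rewrite (mem_all_steps v k) => ->. Qed.

Lemma is_path_mem n s v : is_path n s -> v \in s -> v \in all_steps Ve Vo.
Proof.
by move=> [sn hs] /(nthP 0)[i]; rewrite sn => /hs + <-; exact: mem_steps_all.
Qed.

Lemma sum_jump_law (W : {fset V}) (v : V) (a b : R) (h : V -> R) : v \in W ->
  \sum_(w <- W) (if w == v then a else b) * h w =
  (a - b) * h v + b * \sum_(w <- W) h w.
Proof.
move=> vW; rewrite (bigD1_seq v) ?fset_uniq //= eqxx.
rewrite [in RHS](bigD1_seq v) ?fset_uniq //= mulrDr addrA -mulrDl subrK.
by congr (_ + _); rewrite mulr_sumr; apply: eq_bigr => w /negbTE ->.
Qed.

Let memory_coefE (x : R) : x - (1 - x) / (m%:R - 1) = memory_coef m x.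
Proof. by rewrite /memory_coef; field; rewrite gt_eqF. Qed.

(** The law of the next step is a signed mixture of a point mass at v or - v, of
    weight the memory coefficient, and of a uniform part. *)
Lemma jump_law_mean k v h : v \in all_steps Ve Vo ->
  \sum_(w <- steps k) jump_law k v w * h w =
  if v \in steps k then memory_coef m p * h v +
    (1 - p) / (m%:R - 1) * \sum_(w <- steps k) h w
  else memory_coef m q * h (- v) +
    (1 - q) / (m%:R - 1) * \sum_(w <- steps k) h w.
Proof.
rewrite (mem_all_steps _ k) /jump_law; case: ifP => [vk _|vk /= vk'].
  by rewrite sum_jump_law // memory_coefE.
by rewrite sum_jump_law // memory_coefE.
Qed.

Lemma jump_law_total k v : v \in all_steps Ve Vo ->
  \sum_(w <- steps k) jump_law k v w = 1.
Proof.
move=> vV; under eq_bigr do rewrite -[jump_law _ _ _]mulr1.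
rewrite (jump_law_mean _ (fun=> 1)) // big_const_seq count_predT.
have -> : size (steps k) = m by exact: card_steps.
rewrite iter_addr_0 /memory_coef.
by case: ifP => _; field; rewrite gt_eqF.
Qed.

Lemma jump_law_ge0 k v w : 0 <= jump_law k v w.
Proof.
case/andP: hp => p0 p1; case/andP: hq => q0 q1; rewrite /jump_law.
by do 2 case: ifP => _ //; rewrite divr_ge0 ?subr_ge0 // ler1n ltnW.
Qed.

Lemma step_law_ge0 n s w : 0 <= step_law n s w.
Proof.
case: n => [|n] /=; first by rewrite invr_ge0 ler0n.
rewrite mulr_ge0 ?invr_ge0 ?ler0n // sumr_ge0 // => v _.
exact: jump_law_ge0.
Qed.

Lemma step_meanS n s h : (0 < n)%N ->
  step_mean n s h =
  n%:R^-1 * \sum_(v <- s) \sum_(w <- steps n.+1) jump_law n.+1 v w * h w.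
Proof.
case: n => // n _; rewrite /step_mean /= exchange_big /= mulr_sumr.
by apply: eq_bigr => w _; rewrite -mulr_suml mulrA.
Qed.

Lemma step_mean_average n s : is_path n s ->
  is_average (fun w => w \in steps n.+1) (step_mean n s).
Proof.
move=> sn; split=> [a f g|f g fg|c].
- rewrite /step_mean mulr_sumr -big_split; apply: eq_bigr => w _.
  by rewrite /=; ring.
- rewrite /step_mean big_seq [leRHS]big_seq; apply: ler_sum => w wk.
  by rewrite ler_wpM2l ?step_law_ge0 ?fg.
rewrite /step_mean -mulr_suml; case: n sn => [|n] sn /=.
  rewrite big_const_seq count_predT iter_addr_0.
  have -> : size (steps 1) = m by exact: card_steps.
  by rewrite -[_ *+ m]mulr_natr mulVf // mul1r.
rewrite -mulr_sumr exchange_big /= big_seq.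
rewrite (eq_bigr (fun=> 1)); last first.
  by move=> v vs; exact/jump_law_total/(is_path_mem sn).
rewrite -big_seq big_const_seq count_predT iter_addr_0 (proj1 sn).
by rewrite mulVf ?pnatr_eq0 // mul1r.
Qed.

Lemma path_mean_average n : is_average (is_path n) (path_mean n).
Proof.
elim: n => [|n IH].
  by split=> //= f g; apply; split.
split=> [a f g|f g fg|c] /=.
- rewrite -(average_lin IH); apply: (eq_average IH) => s sn.
  exact: (average_lin (step_mean_average sn)).
- apply: (average_le IH) => s sn.
  apply: (average_le (step_mean_average sn)) => w wk.
  exact/fg/is_path_rcons.
rewrite -[RHS](average_cst IH c); apply: (eq_average IH) => s sn.
exact: (average_cst (step_mean_average sn)).
Qed.

(** A remembered step v contributes, to the conditional mean of an extension at the
    next step, gamma times the even extension at v and delta times the odd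
    extension at v, up to parity signs. *)
Definition even_ext (f : V -> R) (v : V) : R := if v \in Vo then f v else f (- v).
Definition odd_ext (f : V -> R) (v : V) : R := if v \in Vo then f v else - f (- v).

Lemma odd_extE f k v : v \in steps k -> odd_ext f v = sgn_at k * even_ext f v.
Proof.
rewrite /steps_at /sgn_at /odd_ext /even_ext; case: odd => vk.
  by rewrite vk mul1r.
case: ifP => [vo|_]; first by rewrite (VeF_of_Vo vo) in vk.
by rewrite mulN1r.
Qed.

Lemma even_extN f v : v \in all_steps Ve Vo -> even_ext f (- v) = even_ext f v.
Proof.
rewrite inE /even_ext mem_oppVo => /orP[vo|ve].
  by rewrite (VeF_of_Vo vo) vo opprK.
rewrite ve; case: ifP => // vo.
by rewrite (VeF_of_Vo vo) in ve.
Qed.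

Lemma odd_extN f v : v \in all_steps Ve Vo -> odd_ext f (- v) = - odd_ext f v.
Proof.
rewrite inE /odd_ext mem_oppVo => /orP[vo|ve].
  by rewrite (VeF_of_Vo vo) vo opprK.
rewrite ve; case: ifP => [vo|]; last by rewrite opprK.
by rewrite (VeF_of_Vo vo) in ve.
Qed.

Lemma sum_even_ext f k :
  \sum_(w <- steps k) even_ext f w = \sum_(v <- Vo) f v.
Proof.
rewrite /steps_at; case: odd.
  by apply: eq_big_seq => v vo; rewrite /even_ext vo.
rewrite (perm_big _ perm_Vo_oppVe) big_map; apply: eq_big_seq => v ve.
rewrite /even_ext; case: ifP => // vo.
by rewrite (VeF_of_Vo vo) in ve.
Qed.

Definition Csum f (s : seq V) : R := \sum_(v <- s) even_ext f v.
Definition Dsum f (s : seq V) : R := \sum_(v <- s) odd_ext f v.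

Lemma Csum_rcons f s w : Csum f (rcons s w) = Csum f s + even_ext f w.
Proof. by rewrite /Csum -cats1 big_cat big_seq1. Qed.

Lemma Dsum_rcons f s w : Dsum f (rcons s w) = Dsum f s + odd_ext f w.
Proof. by rewrite /Dsum -cats1 big_cat big_seq1. Qed.

Variables gam del : R.
Hypotheses (hgam : gam = gamma_coef m p q) (hdel : del = delta_coef m p q).

Let memory_coef_p : memory_coef m p = gam + del.
Proof. by rewrite hgam hdel /gamma_coef /delta_coef; field. Qed.

Let memory_coef_q : memory_coef m q = gam - del.
Proof. by rewrite hgam hdel /gamma_coef /delta_coef; field. Qed.

(** A remembered step that is available at time n+1 contributes alpha times its
    even extension, any other beta times it; writing alpha = gamma + delta and
    beta = gamma - delta, the sum splits into the even and the odd extension.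
    The uniform part vanishes as f is centered. *)
Lemma step_mean_even_ext n s f : is_path n s -> (0 < n)%N ->
  \sum_(v <- Vo) f v = 0 ->
  step_mean n s (even_ext f) =
  (gam * Csum f s + sgn_at n.+1 * del * Dsum f s) / n%:R.
Proof.
move=> sn n0 f0; rewrite step_meanS // mulrC; congr (_ / _).
rewrite /Csum /Dsum !mulr_sumr -big_split; apply: eq_big_seq => v vs /=.
have vV := is_path_mem sn vs.
rewrite jump_law_mean // sum_even_ext f0 !mulr0 !addr0 even_extN //.
have := vV; rewrite (mem_all_steps _ n.+1).
case: ifP => [vk _|_ /= vk].
  rewrite (odd_extE _ vk) -[_ * del * _]mulrA [del * _]mulrC !mulrA.
  by rewrite sgn_atK mul1r [_ * del]mulrC -mulrDl -memory_coef_p.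
have := odd_extE f vk; rewrite odd_extN // even_extN // => /eqP.
rewrite eqr_oppLR => /eqP ->.
rewrite mulrN -[_ * del * _]mulrA [del * _]mulrC !mulrA sgn_atK mul1r.
by rewrite memory_coef_q mulrBl [_ * del]mulrC.
Qed.


Lemma step_mean_even_ext_gen n s f : is_path n s -> (0 < n)%N ->
  let mu := m%:R^-1 * \sum_(v <- Vo) f v in
  let f0 := fun v => f v - mu in
  step_mean n s (even_ext f) =
  mu + (gam * Csum f0 s + sgn_at n.+1 * del * Dsum f0 s) / n%:R.
Proof.
move=> sn n0 mu f0; rewrite -step_mean_even_ext //.
  rewrite -[mu in RHS](average_cst (step_mean_average sn)).
  rewrite -(averageD (step_mean_average sn)).
  congr step_mean; apply/funext => v; rewrite /even_ext /f0.
  by case: ifP => _; rewrite addrC subrK.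
rewrite /f0 sumrB big_const_seq count_predT iter_addr_0 /mu.
by rewrite -[_ *+ _]mulr_natr mulrAC mulVf // mul1r subrr.
Qed.

(** * The compensated sum and its increments *)

Definition fbound (f : V -> R) : R := \sum_(v <- Vo) `|f v|.

Lemma fbound_ge0 f : 0 <= fbound f.
Proof. by apply: sumr_ge0. Qed.

Lemma le_fbound f v : v \in Vo -> `|f v| <= fbound f.
Proof.
move=> vo; rewrite /fbound (bigD1_seq v) ?fset_uniq //= lerDl.
exact: sumr_ge0.
Qed.

Lemma norm_even_ext f v : v \in all_steps Ve Vo -> `|even_ext f v| <= fbound f.
Proof.
rewrite inE /even_ext -mem_oppVo; case: ifP => [vo _|_ /= vo]; exact: le_fbound.
Qed.

Lemma norm_odd_ext f v : v \in all_steps Ve Vo -> `|odd_ext f v| <= fbound f.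
Proof.
rewrite inE /odd_ext -mem_oppVo; case: ifP => [vo _|_ /= vo]; rewrite ?normrN;
  exact: le_fbound.
Qed.

Lemma norm_sum_le (s : seq V) (h : V -> R) (b : R) :
  (forall v, v \in s -> `|h v| <= b) ->
  `|\sum_(v <- s) h v| <= (size s)%:R * b.
Proof.
move=> hb; rewrite (le_trans (ler_norm_sum _ _ _)) // mulr_natl.
rewrite -iter_addr_0 -(count_predT s) -big_const_seq big_seq [leRHS]big_seq.
exact: ler_sum.
Qed.

Lemma norm_Csum n s f : is_path n s -> `|Csum f s| <= n%:R * fbound f.
Proof.
move=> sn; rewrite -(proj1 sn); apply: norm_sum_le => v vs.
exact/norm_even_ext/(is_path_mem sn).
Qed.

Lemma norm_Dsum n s f : is_path n s -> `|Dsum f s| <= n%:R * fbound f.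
Proof.
move=> sn; rewrite -(proj1 sn); apply: norm_sum_le => v vs.
exact/norm_odd_ext/(is_path_mem sn).
Qed.

(** The compensated sum.  Given the path, the drift of [Dsum] contains the term
    eps gamma C / n of alternating sign; summing it by parts produces the
    correction eps gamma C / (2 n), which is bounded and leaves only drift
    terms of order 1/n. *)
Definition Asum f n (s : seq V) : R :=
  Dsum f s + sgn_at n.+1 * (gam / (2 * n%:R)) * Csum f s.

Local Notation cstG := (1 + `|gam| + `|del|).

Let G1 : 1 <= cstG. Proof. by rewrite -addrA lerDl addr_ge0. Qed.
Let G0 : 0 <= cstG. Proof. by rewrite (le_trans _ G1). Qed.
Let Gg : `|gam| <= cstG.
Proof. by rewrite addrAC lerDr addr_ge0. Qed.
Let Gd : `|del| <= cstG.
Proof. by rewrite lerDr addr_ge0. Qed.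

Lemma norm_Asum n s f : is_path n s -> (0 < n)%N ->
  `|Asum f n s| <= `|Dsum f s| + cstG * (`|Csum f s| / n%:R).
Proof.
move=> sn n0; have N0 : 0 < n%:R :> R by rewrite ltr0n.
rewrite /Asum (le_trans (ler_normD _ _)) // lerD2l !normrM norm_sgn_at mul1r.
rewrite normfV normrM !normr_nat.
have -> : `|gam| / (2 * n%:R) * `|Csum f s| =
   (`|gam| / 2) * (`|Csum f s| / n%:R) by field; rewrite gt_eqF.
rewrite ler_wpM2r ?divr_ge0 //; have := Gg; have := normr_ge0 gam; lra.
Qed.

Lemma Csum_div n s f : is_path n s -> (0 < n)%N ->
  `|Csum f s| / n%:R <= fbound f.
Proof. by move=> sn n0; rewrite ler_pdivrMr ?ltr0n // mulrC norm_Csum. Qed.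

Lemma Dsum_div n s f : is_path n s -> (0 < n)%N ->
  `|Dsum f s| / n%:R <= fbound f.
Proof. by move=> sn n0; rewrite ler_pdivrMr ?ltr0n // mulrC norm_Dsum. Qed.

Lemma norm_AsumB n s f : is_path n s -> (0 < n)%N ->
  `|Dsum f s - Asum f n s| <= cstG * fbound f.
Proof.
move=> sn n0; have N0 : 0 < n%:R :> R by rewrite ltr0n.
rewrite /Asum opprD addNKr normrN !normrM norm_sgn_at mul1r.
rewrite normfV normrM !normr_nat.
have -> : `|gam| / (2 * n%:R) * `|Csum f s| =
   (`|gam| / 2) * (`|Csum f s| / n%:R) by field; rewrite gt_eqF.
apply: ler_pM; rewrite ?divr_ge0 // ?Csum_div //.
have := Gg; have := normr_ge0 gam; lra.
Qed.

(** The coefficients of the increment of the compensated sum: incr_u tends to 1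
    and incr_k to gamma. *)
Definition incr_u n : R := 1 - gam / (2 * n.+1%:R).
Definition incr_k n : R := gam * (1 - (2 * n.+1%:R)^-1).

Definition Aincr f n (s : seq V) (w : V) : R :=
  sgn_at n.+1 * (incr_u n * even_ext f w - incr_k n * (Csum f s / n%:R)).

Lemma Asum_rcons n s w f : (0 < n)%N -> w \in steps n.+1 ->
  Asum f n.+1 (rcons s w) = Asum f n s + Aincr f n s w.
Proof.
move=> n0 wk; rewrite /Asum /Aincr Csum_rcons Dsum_rcons (odd_extE f wk).
rewrite (sgn_atS n.+1) /incr_u /incr_k -natr1; field.
by rewrite addrC natr1 !pnatr_eq0 -lt0n n0.
Qed.

Let norm_half n : `|(2 * n.+1%:R)^-1 : R| <= n.+1%:R^-1.
Proof.
rewrite normfV normrM !normr_nat lef_pV2 ?posrE ?ltr0n //.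
by rewrite ler_peMl // ler1n.
Qed.

Let invS_le1 n : n.+1%:R^-1 <= 1 :> R.
Proof. by rewrite invf_le1 ?ltr0n // ler1n. Qed.

Lemma norm_incr_u1 n : `|incr_u n - 1| <= cstG / n.+1%:R.
Proof.
by rewrite /incr_u addrAC subrr sub0r normrN normrM ler_pM // norm_half.
Qed.

Lemma norm_incr_u n : `|incr_u n| <= 2 * cstG.
Proof.
rewrite -[incr_u n](subrK 1) (le_trans (ler_normD _ _)) // normr1.
have h : cstG / n.+1%:R <= cstG by rewrite -[leRHS]mulr1 ler_wpM2l.
rewrite mulr_natl mulr2n lerD // (le_trans (norm_incr_u1 n)) //.
Qed.

Lemma norm_incr_k n : `|incr_k n| <= cstG.
Proof.
rewrite /incr_k normrM -[leRHS]mulr1 ler_pM //.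
have := le_trans (norm_half n) (invS_le1 n).
have h : 0 <= (2 * n.+1%:R)^-1 :> R by rewrite invr_ge0 mulr_ge0.
by rewrite (ger0_norm h) => h1; rewrite ger0_norm ?subr_ge0 // lerBlDr lerDl.
Qed.

Lemma norm_Aincr n s w f : is_path n s -> (0 < n)%N -> w \in steps n.+1 ->
  `|Aincr f n s w| <= 3 * cstG * fbound f.
Proof.
move=> sn n0 wk; rewrite /Aincr normrM norm_sgn_at mul1r.
rewrite (le_trans (ler_normB _ _)) // (normrM (incr_u n)) (normrM (incr_k n)).
rewrite (normrM (Csum f s)) normfV normr_nat.
have h1 : `|incr_u n| * `|even_ext f w| <= 2 * cstG * fbound f.
  by rewrite ler_pM // ?norm_incr_u // norm_even_ext // (mem_steps_all wk).
have h2 : `|incr_k n| * (`|Csum f s| / n%:R) <= cstG * fbound f.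
  by rewrite ler_pM // ?divr_ge0 // ?norm_incr_k // Csum_div.
lra.
Qed.

Definition Aincr_mean_cst f : R := 4 * cstG ^+ 2 * fbound f.

(** The parts of order one, those in C / n, cancel by the choice of the correction;
    what remains carries a further factor 1/n. *)
Lemma Aincr_mean n s f : is_path n s -> (0 < n)%N -> \sum_(v <- Vo) f v = 0 ->
  `|step_mean n s (Aincr f n s) - del * (Asum f n s / n%:R)|
     <= Aincr_mean_cst f / n%:R.
Proof.
move=> sn n0 f0; have N0 : 0 < n%:R :> R by rewrite ltr0n.
have N1 : n.+1%:R != 0 :> R by rewrite pnatr_eq0.
have hav := step_mean_average sn.
rewrite (averageZ hav) (averageB hav) (averageZ hav) (average_cst hav).
rewrite step_mean_even_ext // /Asum.
set C := Csum f s; set D := Dsum f s; set e := sgn_at n.+1.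
have e2 : e * e = 1 by exact: sgn_atK.
have -> : e * (incr_u n * ((gam * C + e * del * D) / n%:R) - incr_k n * (C / n%:R)) -
  del * ((D + e * (gam / (2 * n%:R)) * C) / n%:R) =
  - (gam * del * (2 * n.+1%:R)^-1 * (D / n%:R)) +
  (e * gam * (1 - gam) * (2 * n.+1%:R)^-1 * (C / n%:R)
   - e * gam * del * (2 * n%:R)^-1 * (C / n%:R)).
  have -> : e * (incr_u n * ((gam * C + e * del * D) / n%:R) - incr_k n * (C / n%:R))
   = incr_u n * (e * e) * del * (D / n%:R) +
     e * (incr_u n * gam - incr_k n) * (C / n%:R) by ring.
  by rewrite e2 /incr_u /incr_k; field; rewrite !gt_eqF // ltr0n.
have ne : `|e| = 1 by exact: norm_sgn_at.
have hB := fbound_ge0 f.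
have hi : (2 * n.+1%:R)^-1 <= n%:R^-1 :> R.
  rewrite lef_pV2 ?posrE ?mulr_gt0 ?ltr0n // -natrM ler_nat.
  by rewrite mul2n -addnn addSn leqW // leq_addr.
have hi' : (2 * n%:R)^-1 <= n%:R^-1 :> R.
  by rewrite lef_pV2 ?posrE ?mulr_gt0 ?ltr0n // ler_peMl ?(ltW N0) // ler1n.
have hC : `|C| / n%:R <= fbound f by exact: Csum_div.
have hD : `|D| / n%:R <= fbound f by exact: Dsum_div.
have nn x : 0 <= x -> `|x| = x :> R by move=> ?; rewrite ger0_norm.
have t1 : `|gam * del * (2 * n.+1%:R)^-1 * (D / n%:R)| <=
   cstG * cstG * n%:R^-1 * fbound f.
  rewrite 3!normrM (normrM D) !normfV (nn n%:R) ?(ltW N0) // (nn (2 * _)) ?mulr_ge0 //.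
  by rewrite !ler_pM ?mulr_ge0 ?invr_ge0 ?mulr_ge0 ?divr_ge0.
have t2 : `|e * gam * (1 - gam) * (2 * n.+1%:R)^-1 * (C / n%:R)| <=
   cstG * cstG * n%:R^-1 * fbound f.
  rewrite 4!normrM (normrM C) !normfV (nn n%:R) ?(ltW N0) // (nn (2 * _)) ?mulr_ge0 // ne mul1r.
  rewrite !ler_pM ?mulr_ge0 ?invr_ge0 ?mulr_ge0 ?divr_ge0 //.
  rewrite (le_trans (ler_normB _ _)) // normr1.
  by rewrite -[leLHS]addr0 lerD.
have t3 : `|e * gam * del * (2 * n%:R)^-1 * (C / n%:R)| <=
   cstG * cstG * n%:R^-1 * fbound f.
  rewrite 4!normrM (normrM C) !normfV (nn n%:R) ?(ltW N0) // (nn (2 * _)) ?mulr_ge0 // ne mul1r.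
  by rewrite !ler_pM ?mulr_ge0 ?invr_ge0 ?mulr_ge0 ?divr_ge0.
apply: (le_trans (ler_normD _ _)); rewrite normrN.
apply: (le_trans (lerD (lexx _) (ler_normB _ _))).
apply: (le_trans (lerD t1 (lerD t2 t3))).
have -> : Aincr_mean_cst f / n%:R = 4 * (cstG * cstG * n%:R^-1 * fbound f).
  by rewrite /Aincr_mean_cst; ring.
have : 0 <= cstG * cstG * n%:R^-1 * fbound f.
  by rewrite !mulr_ge0 ?invr_ge0 // ltW.
lra.
Qed.

(** The variance of f under the uniform law on Vo, for centered f. *)
Definition fvar (f : V -> R) : R := m%:R^-1 * \sum_(v <- Vo) f v ^+ 2.
Definition fsq (f : V -> R) (v : V) : R := f v ^+ 2 - fvar f.

Lemma fvar_ge0 f : 0 <= fvar f.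
Proof. by rewrite mulr_ge0 ?invr_ge0 // sumr_ge0 // => v _; rewrite sqr_ge0. Qed.

Lemma sum_fsq f : \sum_(v <- Vo) fsq f v = 0.
Proof.
rewrite /fsq sumrB big_const_seq count_predT iter_addr_0 /fvar.
by rewrite -[_ *+ _]mulr_natr mulrAC mulVf // mul1r subrr.
Qed.

(** The fluctuations which make the conditional variance of a step differ from
    its limit: those of f^2 about its mean and those of f. *)
Definition fluct f n (s : seq V) : R :=
  (1 + `|Csum (fsq f) s| + `|Dsum (fsq f) s| + `|Csum f s| + `|Dsum f s|) / n%:R.

Definition Aincr_sqr_cst f : R :=
  3 * cstG ^+ 2 * fvar f + 4 * cstG ^+ 3 + 5 * cstG ^+ 3 * fbound f.

(** The square of the even extension of f is the even extension of f^2, whose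
    conditional mean is given by [step_mean_even_ext_gen]. *)
Lemma Aincr_sqr_mean n s f : is_path n s -> (0 < n)%N ->
  \sum_(v <- Vo) f v = 0 ->
  `|step_mean n s (fun w => Aincr f n s w ^+ 2) - fvar f|
     <= Aincr_sqr_cst f * fluct f n s.
Proof.
move=> sn n0 f0; have N0 : 0 < n%:R :> R by rewrite ltr0n.
have hav := step_mean_average sn.
set C := Csum f s; set D := Dsum f s; set e := sgn_at n.+1.
set C2 := Csum (fsq f) s; set D2 := Dsum (fsq f) s.
have e2 : e ^+ 2 = 1 by rewrite expr2; exact: sgn_atK.
have -> : (fun w => Aincr f n s w ^+ 2) = (fun w =>
   incr_u n ^+ 2 * even_ext (fun v => f v ^+ 2) w +
   ((- 2 * incr_u n * incr_k n * (C / n%:R)) * even_ext f w +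
   (incr_k n * (C / n%:R)) ^+ 2)).
  apply/funext => w; rewrite /Aincr exprMn -/e e2 mul1r.
  have -> : even_ext (fun v => f v ^+ 2) w = even_ext f w ^+ 2.
    by rewrite /even_ext; case: ifP.
  by rewrite -/C; ring.
rewrite !(average_lin hav) (average_cst hav) (step_mean_even_ext sn n0 f0).
rewrite step_mean_even_ext_gen // -/(fvar f) -/(fsq f) -/C2 -/D2 -/C -/D -/e.
set u := incr_u n; set k := incr_k n.
have nu : `|u| <= 2 * cstG by exact: norm_incr_u.
have nk : `|k| <= cstG by exact: norm_incr_k.
have nu1 : `|u - 1| <= cstG / n%:R.
  apply: le_trans (norm_incr_u1 n) _; rewrite ler_wpM2l // lef_pV2 ?posrE ?ltr0n //.
  by rewrite ler_nat.
have -> : u ^+ 2 * (fvar f + (gam * C2 + e * del * D2) / n%:R) +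
   (- 2 * u * k * (C / n%:R) * ((gam * C + e * del * D) / n%:R) +
    (k * (C / n%:R)) ^+ 2) - fvar f =
  (u - 1) * (u + 1) * fvar f + u * u * ((gam * C2 + e * del * D2) / n%:R) -
   2 * u * k * (C / n%:R) * ((gam * C + e * del * D) / n%:R) +
   k * (C / n%:R) * k * (C / n%:R) by ring.
have ne : `|e| = 1 by exact: norm_sgn_at.
have hB := fbound_ge0 f.
have hC : `|C / n%:R| <= fbound f.
  by rewrite normrM normfV (ger0_norm (ltW N0)); exact: Csum_div.
have hlin x y : `|(gam * x + e * del * y) / n%:R| <= cstG * ((`|x| + `|y|) / n%:R).
  rewrite normrM normfV (ger0_norm (ltW N0)) mulrA ler_wpM2r ?invr_ge0 ?(ltW N0) //.
  rewrite (le_trans (ler_normD _ _)) // !normrM ne mul1r mulrDr.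
  by rewrite lerD // ler_wpM2r.
have t1 : `|(u - 1) * (u + 1) * fvar f| <= cstG / n%:R * (3 * cstG) * fvar f.
  rewrite 2!normrM (ger0_norm (fvar_ge0 f)) ler_wpM2r ?fvar_ge0 // ler_pM //.
  by rewrite (le_trans (ler_normD _ _)) // normr1; move: G1 nu; lra.
have t2 : `|u * u * ((gam * C2 + e * del * D2) / n%:R)| <=
    (2 * cstG) * (2 * cstG) * (cstG * ((`|C2| + `|D2|) / n%:R)).
  by rewrite normrM (normrM u); apply: ler_pM; rewrite ?mulr_ge0 // ler_pM.
have t3 : `|2 * u * k * (C / n%:R) * ((gam * C + e * del * D) / n%:R)| <=
    2 * (2 * cstG) * cstG * fbound f * (cstG * ((`|C| + `|D|) / n%:R)).
  rewrite normrM (normrM (2 * u * k)) (normrM (2 * u)) (normrM 2) normr_nat.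
  by apply: ler_pM; rewrite ?mulr_ge0 // ler_pM ?mulr_ge0 // ler_pM ?mulr_ge0 // ler_pM.
have t4 : `|k * (C / n%:R) * k * (C / n%:R)| <=
    cstG * fbound f * cstG * (`|C| / n%:R).
  have Cn : `|C| / n%:R = `|C / n%:R| by rewrite normrM normfV normr_nat.
  rewrite normrM (normrM (k * (C / n%:R))) (normrM k) Cn.
  by rewrite ler_wpM2r // ler_pM ?mulr_ge0 // ler_pM.
apply: (le_trans (ler_normD _ _)).
apply: (le_trans (lerD (ler_normB _ _) (lexx _))).
apply: (le_trans (lerD (lerD (ler_normD _ _) (lexx _)) (lexx _))).
apply: (le_trans (lerD (lerD (lerD t1 t2) t3) t4)).
rewrite /fluct -/C -/D -/C2 -/D2 /Aincr_sqr_cst.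
have g1 := G1; set g := cstG in g1 *; set b := fbound f in hB *; set F := fvar f.
have F0 : 0 <= F by exact: fvar_ge0.
set i := n%:R^-1; have i0 : 0 <= i by rewrite invr_ge0 ltW.
set x := `|C|; set y := `|D|; set z := `|C2|; set t := `|D2|.
have x0 : 0 <= x by exact: normr_ge0. have y0 : 0 <= y by exact: normr_ge0.
have z0 : 0 <= z by exact: normr_ge0. have t0 : 0 <= t by exact: normr_ge0.
have g0 : 0 <= g by exact: G0.
rewrite -subr_ge0.
have -> : (3 * g ^+ 2 * F + 4 * g ^+ 3 + 5 * g ^+ 3 * b) *
 ((1 + z + t + x + y) * i) -
 (g * i * (3 * g) * F + 2 * g * (2 * g) * (g * ((z + t) * i)) +
  2 * (2 * g) * g * b * (g * ((x + y) * i)) + g * b * g * (x * i)) =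
 i * (3 * g ^+ 2 * F * (z + t + x + y) + 4 * g ^+ 3 * (1 + x + y) +
   5 * g ^+ 3 * b * (1 + z + t) + g ^+ 3 * b * y + (g - 1) * (g ^+ 2 * b * x)).
  by ring.
have g1' : 0 <= g - 1 by rewrite subr_ge0.
by do 30! first [done | apply: addr_ge0 | apply: mulr_ge0 | apply: exprn_ge0].
Qed.


Lemma norm_Asum_div n s f : is_path n s -> (0 < n)%N ->
  `|Asum f n s| / n%:R <= 2 * cstG * fbound f.
Proof.
move=> sn n0; have N0 : 0 < n%:R :> R by rewrite ltr0n.
apply: le_trans (ler_wpM2r _ (norm_Asum f sn n0)) _; first by rewrite invr_ge0 ltW.
rewrite mulrDl -mulrA.
have hD := Dsum_div f sn n0; have hC := Csum_div f sn n0.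
have hB := fbound_ge0 f.
have h1 : `|Dsum f s| / n%:R <= cstG * fbound f.
  by apply: le_trans hD _; rewrite ler_peMl.
have h2 : `|Csum f s| / n%:R / n%:R <= fbound f.
  by rewrite (le_trans _ hC) // ler_piMr ?divr_ge0 // invf_le1 // ler1n.
have h3 : cstG * (`|Csum f s| / n%:R / n%:R) <= cstG * fbound f.
  by rewrite ler_wpM2l.
by rewrite -mulrA mulr_natl mulr2n lerD.
Qed.

Lemma norm_Asum_fluct n s f : is_path n s -> (0 < n)%N ->
  `|Asum f n s| / n%:R <= cstG * fluct f n s.
Proof.
move=> sn n0; have N0 : 0 < n%:R :> R by rewrite ltr0n.
apply: le_trans (ler_wpM2r _ (norm_Asum f sn n0)) _; first by rewrite invr_ge0 ltW.
rewrite /fluct [leRHS]mulrA ler_wpM2r ?invr_ge0 ?(ltW N0) //.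
have h : cstG * (`|Csum f s| / n%:R) <= cstG * `|Csum f s|.
  by rewrite ler_wpM2l // ler_piMr // invf_le1 // ler1n.
have h2 : `|Dsum f s| <= cstG * `|Dsum f s| by rewrite ler_peMl.
apply: le_trans (lerD h2 h) _.
rewrite -mulrDr ler_wpM2l // [leLHS]addrC -[leRHS]addrA lerDr.
by rewrite !addr_ge0.
Qed.

Definition char_step_cst f : R :=
  2 * (3 * cstG * fbound f) ^+ 3 + Aincr_mean_cst f + Aincr_sqr_cst f +
  4 * cstG ^+ 4 * fbound f + 2 * cstG ^+ 2 * fbound f * fvar f.

Lemma Aincr_mean_cst_ge0 f : 0 <= Aincr_mean_cst f.
Proof.
have hB := fbound_ge0 f; rewrite /Aincr_mean_cst.
by do 30! first [done | apply: addr_ge0 | apply: mulr_ge0 | apply: exprn_ge0].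
Qed.

Lemma Aincr_sqr_cst_ge0 f : 0 <= Aincr_sqr_cst f.
Proof.
have hB := fbound_ge0 f; have hV := fvar_ge0 f; rewrite /Aincr_sqr_cst.
by do 30! first [done | apply: addr_ge0 | apply: mulr_ge0 | apply: exprn_ge0].
Qed.

Lemma char_step_cst_ge0 f : 0 <= char_step_cst f.
Proof.
have hB := fbound_ge0 f; have hV := fvar_ge0 f.
have h1 := Aincr_mean_cst_ge0 f; have h2 := Aincr_sqr_cst_ge0 f.
rewrite /char_step_cst.
by do 30! first [done | apply: addr_ge0 | apply: mulr_ge0 | apply: exprn_ge0].
Qed.

Lemma fluct_ge0 f n s : 0 <= fluct f n s.
Proof. by rewrite /fluct divr_ge0 // !addr_ge0. Qed.

(** The scaled form of [cos_second_order]: the drift delta A / n is absorbed into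
    the factor 1 + delta / n, the third order term comes from the bounded
    increments. *)
Lemma char_step f c tau n s : is_path n s -> (0 < n)%N ->
  \sum_(v <- Vo) f v = 0 ->
  `|step_mean n s (fun w => cos (tau * Asum f n.+1 (rcons s w) + c)) -
    (1 - tau ^+ 2 * fvar f / 2) *
      cos (tau * (1 + del / n%:R) * Asum f n s + c)| <=
  char_step_cst f *
    (`|tau| ^+ 3 + `|tau| / n%:R + tau ^+ 2 * fluct f n s).
Proof.
move=> sn n0 f0; have hav := step_mean_average sn.
have N0 : 0 < n%:R :> R by rewrite ltr0n.
set A := Asum f n s.
set m1 := step_mean n s (Aincr f n s).
set m2 := step_mean n s (fun w => Aincr f n s w ^+ 2).
pose a := tau * A + c.
set X := step_mean _ _ _.
have B0 := fbound_ge0 f; have V0 := fvar_ge0 f.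
set B1 := 3 * cstG * fbound f.
have B10 : 0 <= B1 by rewrite !mulr_ge0.
have hX : `|X - (cos a - tau * m1 * sin a - tau ^+ 2 / 2 * m2 * cos a)| <=
    2 * (`|tau| * B1) ^+ 3.
  have -> : cos a - tau * m1 * sin a - tau ^+ 2 / 2 * m2 * cos a =
    step_mean n s (fun w => (- tau * sin a) * Aincr f n s w +
      ((- (tau ^+ 2 / 2) * cos a) * Aincr f n s w ^+ 2 + cos a)).
    by rewrite !(average_lin hav) (average_cst hav) -/m1 -/m2; ring.
  rewrite -[leRHS](average_cst hav); apply: (average_dist hav) => w wk.
  rewrite Asum_rcons // -/A.
  have -> : tau * (A + Aincr f n s w) + c = a + tau * Aincr f n s w.
    by rewrite /a; ring.
  have := cos_taylor2 a (tau * Aincr f n s w).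
  have -> : cos a - tau * Aincr f n s w * sin a -
     (tau * Aincr f n s w) ^+ 2 / 2 * cos a =
     - tau * sin a * Aincr f n s w +
     (- (tau ^+ 2 / 2) * cos a * Aincr f n s w ^+ 2 + cos a) by field.
  move/le_trans; apply; rewrite ler_wpM2l // lerXn2r ?nnegrE ?mulr_ge0 //.
  by rewrite normrM ler_wpM2l // norm_Aincr.
have -> : tau * (1 + del / n%:R) * A + c = a + tau * (del * (A / n%:R)).
  by rewrite /a; ring.
apply: (le_trans (cos_second_order (del * (A / n%:R)) V0 hX)).
have h1 : `|m1 - del * (A / n%:R)| <= Aincr_mean_cst f / n%:R by exact: Aincr_mean.
have h2 : `|m2 - fvar f| <= Aincr_sqr_cst f * fluct f n s by exact: Aincr_sqr_mean.
have nA : `|A / n%:R| = `|A| / n%:R by rewrite normrM normfV normr_nat.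
have h3 : `|del * (A / n%:R)| <= cstG * (2 * cstG * fbound f).
  by rewrite normrM nA ler_pM // ?divr_ge0 // norm_Asum_div.
have h4 : `|del * (A / n%:R)| <= cstG * (cstG * fluct f n s).
  by rewrite normrM nA ler_pM // ?divr_ge0 // norm_Asum_fluct.
have h34 : (tau * (del * (A / n%:R))) ^+ 2 <=
   tau ^+ 2 * (cstG * (2 * cstG * fbound f) * (cstG * (cstG * fluct f n s))).
  rewrite exprMn ler_wpM2l ?sqr_ge0 // -[leLHS]real_normK ?num_real // expr2.
  by rewrite ler_pM.
have e1 : `|tau| * `|m1 - del * (A / n%:R)| <= `|tau| * (Aincr_mean_cst f / n%:R).
  by rewrite ler_wpM2l.
have e2 : tau ^+ 2 * `|m2 - fvar f| <= tau ^+ 2 * (Aincr_sqr_cst f * fluct f n s).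
  by rewrite ler_wpM2l ?sqr_ge0.
have e3 : tau ^+ 2 * fvar f * (`|tau| * `|del * (A / n%:R)|) <=
   tau ^+ 2 * fvar f * (`|tau| * (cstG * (2 * cstG * fbound f))).
  by apply: ler_wpM2l; [nonneg|rewrite ler_wpM2l].
have e4 := ler_wpM2l (ler0n R 2) h34.
apply: (le_trans (lerD (lerD (lerD (lerD (lexx _) e1) e2) e4) e3)).
have c1 := Aincr_mean_cst_ge0 f; have c2 := Aincr_sqr_cst_ge0 f.
have c3 := fluct_ge0 f n s; have c4 := G0.
rewrite /char_step_cst -/B1 -[tau ^+ 2]real_normK ?num_real //.
move: (Aincr_mean_cst f) (Aincr_sqr_cst f) (fluct f n s) (fvar f) (fbound f)
  (`|tau|) (normr_ge0 tau) c1 c2 c3 V0 B0 c4 B10.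
move=> k1 k2 F v b x x0 c1 c2 c3 V0 B0.
move: B1 (cstG) {hX} => b1 g c4 B10.
have i0 : 0 <= n%:R^-1 :> R by rewrite invr_ge0 ltW.
set i := n%:R^-1 in i0 *.
rewrite -subr_ge0.
have -> : (2 * b1 ^+ 3 + k1 + k2 + 4 * g ^+ 4 * b + 2 * g ^+ 2 * b * v) *
  (x ^+ 3 + x * i + x ^+ 2 * F) -
  (2 * (x * b1) ^+ 3 + x * (k1 * i) + x ^+ 2 * (k2 * F) +
   2 * (x ^+ 2 * (g * (2 * g * b) * (g * (g * F)))) +
   x ^+ 2 * v * (x * (g * (2 * g * b)))) =
  2 * b1 ^+ 3 * (x * i + x ^+ 2 * F) + k1 * (x ^+ 3 + x ^+ 2 * F) +
  k2 * (x ^+ 3 + x * i) + 4 * g ^+ 4 * b * (x ^+ 3 + x * i) +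
  2 * g ^+ 2 * b * v * (x * i + x ^+ 2 * F) by ring.
by do 40! first [done | apply: addr_ge0 | apply: mulr_ge0 | apply: exprn_ge0].
Qed.

Hypothesis hdel_lt : del < 1 / 2.

(** * Moment bounds *)

(** Expanding the square of the next sum, the drift multiplies the second moment
    by 1 + 2 delta / n, with 2 delta < 1; the error of order 1/n in the drift costs
    a little of the gap between 2 delta and 1. *)
Lemma Asum_sqr_linear f : \sum_(v <- Vo) f v = 0 ->
  exists K, 0 <= K /\ forall n, (0 < n)%N ->
    path_mean n (fun s => Asum f n s ^+ 2) <= K * n%:R.
Proof.
have d2 : 2 * del < 1 by rewrite mulrC -ltr_pdivlMr.
(* the slope a lies strictly between max (2 delta) 0 and 1; th is the room left
   for the mixed term by the inequality 2 x y <= th x^2 + y^2 / th *)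
move=> f0; pose a : R := (1 + Num.max (2 * del) 0) / 2.
have a01 : 0 <= a < 1.
  rewrite /a; have : Num.max (2 * del) 0 < 1.
    by rewrite gt_max ltr01 d2.
  have : 0 <= Num.max (2 * del) 0 by rewrite le_max lexx orbT.
  by move=> *; apply/andP; split; lra.
pose th : R := a - 2 * del.
have th0 : 0 < th.
  rewrite /th /a; have : 2 * del <= Num.max (2 * del) 0 by rewrite le_max lexx.
  have : Num.max (2 * del) 0 < 1 by rewrite gt_max ltr01 d2.
  lra.
set K1 := Aincr_mean_cst f; have K10 : 0 <= K1 by exact: Aincr_mean_cst_ge0.
pose b := K1 ^+ 2 / th + (3 * cstG * fbound f) ^+ 2.
have b0 : 0 <= b by rewrite addr_ge0 ?sqr_ge0 // divr_ge0 ?sqr_ge0 // ltW.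
apply: (linear_bound_of_recursion a01 b0 (ltn0Sn 0)) => n n0.
have N0 : 0 < n%:R :> R by rewrite ltr0n.
rewrite -(averageZ (path_mean_average n)) -[b](average_cst (path_mean_average n)).
rewrite -(averageD (path_mean_average n)); apply: (average_le (path_mean_average n)) => s sn.
have hav := step_mean_average sn.
set A := Asum f n s; set m1 := step_mean n s (Aincr f n s).
rewrite (_ : step_mean n s _ = A ^+ 2 + 2 * A * m1 +
   step_mean n s (fun w => Aincr f n s w ^+ 2)); last first.
  transitivity (step_mean n s (fun w => 2 * A * Aincr f n s w +
     (Aincr f n s w ^+ 2 + A ^+ 2))).
    by apply: (eq_average hav) => w wk; rewrite Asum_rcons // -/A; ring.
  by rewrite (average_lin hav) (averageD hav) (average_cst hav) -/m1; ring.
have h1 : `|m1 - del * (A / n%:R)| <= K1 / n%:R by exact: Aincr_mean.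
have h2 : step_mean n s (fun w => Aincr f n s w ^+ 2) <= (3 * cstG * fbound f) ^+ 2.
  rewrite -[leRHS](average_cst hav); apply: (average_le hav) => w wk.
  rewrite -real_normK ?num_real // lerXn2r ?nnegrE ?mulr_ge0 ?fbound_ge0 //.
  exact: norm_Aincr.
have h3 : 2 * A * m1 <= 2 * del * (A ^+ 2 / n%:R) + 2 * `|A| * (K1 / n%:R).
  rewrite -lerBlDl.
  have -> : 2 * A * m1 - 2 * del * (A ^+ 2 / n%:R) =
     2 * A * (m1 - del * (A / n%:R)) by ring.
  rewrite (le_trans (ler_norm _)) // normrM normrM normr_nat ler_wpM2l //.
have h4 : 2 * `|A| * K1 <= th * A ^+ 2 + K1 ^+ 2 / th.
  rewrite -subr_ge0 -[A ^+ 2]real_normK ?num_real //.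
  have -> : th * `|A| ^+ 2 + K1 ^+ 2 / th - 2 * `|A| * K1 =
     th * (`|A| - K1 / th) ^+ 2 by field; rewrite gt_eqF.
  by rewrite mulr_ge0 ?sqr_ge0 // ltW.
have h5 : 2 * `|A| * (K1 / n%:R) <= th * (A ^+ 2 / n%:R) + K1 ^+ 2 / th.
  rewrite [leLHS]mulrA; apply: le_trans (ler_wpM2r _ h4) _; first by rewrite invr_ge0 ltW.
  rewrite mulrDl mulrA lerD2l ler_piMr //; first by rewrite divr_ge0 ?sqr_ge0 // ltW.
  by rewrite invf_le1 // ler1n.
have e : 2 * del * (A ^+ 2 / n%:R) + th * (A ^+ 2 / n%:R) = a / n%:R * A ^+ 2.
  by rewrite /th; ring.
have -> : (1 + a / n%:R) * A ^+ 2 =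
   A ^+ 2 + (2 * del * (A ^+ 2 / n%:R) + th * (A ^+ 2 / n%:R)) by rewrite e; ring.
rewrite /b; lra.
Qed.

(** The compensation is bounded. *)
Lemma Dsum_sqr_linear f : \sum_(v <- Vo) f v = 0 ->
  exists K, 0 <= K /\ forall n, (0 < n)%N ->
    path_mean n (fun s => Dsum f s ^+ 2) <= K * n%:R.
Proof.
move=> f0; have [K [K0 hK]] := Asum_sqr_linear f0.
pose b := cstG * fbound f.
have b0 : 0 <= b by rewrite mulr_ge0 ?fbound_ge0.
exists (2 * K + 2 * b ^+ 2); split; first by nonneg.
move=> n n0; have hav := path_mean_average n.
apply: (@le_trans _ _ (path_mean n (fun s => 2 * Asum f n s ^+ 2 + 2 * b ^+ 2))).
  apply: (average_le hav) => s sn; have h := norm_AsumB f sn n0.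
  rewrite -[Dsum f s](subrK (Asum f n s)) addrC.
  apply: le_trans (sqrD_le _ _) _; rewrite lerD2l ler_wpM2l //.
  by rewrite -real_normK ?num_real // lerXn2r ?nnegrE.
rewrite (average_lin hav) (average_cst hav) [leRHS]mulrDl lerD //.
  by rewrite -mulrA ler_wpM2l // hK.
by apply: ler_peMr; [nonneg|rewrite ler1n].
Qed.

Lemma mean_Dsum_cvg0 f : \sum_(v <- Vo) f v = 0 ->
  path_mean n (fun s => `|Dsum f s|) / n%:R @[n --> \oo] --> 0.
Proof.
move=> f0; have [K [K0 hK]] := Dsum_sqr_linear f0.
apply: (@cvg0_of_sqr_le _ _ (fun n => K / n%:R)); last exact: cvg0_cst_div.
  move=> n; rewrite divr_ge0 //.
  by apply: (average_ge0 (path_mean_average n)) => s _.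
move=> n n0; have N0 : 0 < n%:R :> R by rewrite ltr0n.
rewrite expr_div_n ler_pdivrMr ?exprn_gt0 //.
apply: (le_trans (average_sqr_norm (path_mean_average n) _)).
rewrite (le_trans (hK n n0)) // expr2 mulrA ler_pM2r // divfK // gt_eqF //.
Qed.

Hypothesis hgam_lt : gam < 1.

(** The second moment of C grows by the factor 1 + 2 gamma / n, so that divided
    by n^2 it contracts by 1 - (1 - gamma) / n up to a source which involves the
    mean of |D| / n. *)
Lemma mean_Csum_cvg0 f : \sum_(v <- Vo) f v = 0 ->
  path_mean n (fun s => `|Csum f s|) / n%:R @[n --> \oo] --> 0.
Proof.
move=> f0.
pose y n := path_mean n (fun s => Csum f s ^+ 2) / n%:R ^+ 2.
have y0 n : 0 <= y n.
  rewrite divr_ge0 ?exprn_ge0 //.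
  by apply: (average_ge0 (path_mean_average n)) => s _; rewrite sqr_ge0.
set B := fbound f; have B0 : 0 <= B by exact: fbound_ge0.
pose e n := 2 * (2 * `|del| * B * (path_mean n (fun s => `|Dsum f s|) / n%:R)
  + B ^+ 2 / n%:R).
have e0 n : 0 <= path_mean n (fun s => `|Dsum f s|).
  by apply: (average_ge0 (path_mean_average n)) => s _.
have ecvg : e n @[n --> \oo] --> 0.
  apply: cvg0Z; apply: cvg0D; last exact: cvg0_cst_div.
  exact/cvg0Z/mean_Dsum_cvg0.
apply: (@cvg0_of_sqr_le _ _ y).
- move=> n; rewrite divr_ge0 //.
  by apply: (average_ge0 (path_mean_average n)) => s _.
- move=> n n0; rewrite expr_div_n ler_wpM2r ?invr_ge0 ?exprn_ge0 //.
  exact: (average_sqr_norm (path_mean_average n)).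
apply: (@cvg0_of_contraction _ _ e (1 - gam) 1) => //; first by rewrite subr_gt0.
move=> n n0; have N0 : 0 < n%:R :> R by rewrite ltr0n.
have N1 : 0 < n.+1%:R :> R by rewrite ltr0n.
have hav := path_mean_average n.
have hM : path_mean n.+1 (fun s => Csum f s ^+ 2) <=
   (1 + 2 * gam / n%:R) * path_mean n (fun s => Csum f s ^+ 2) +
   (2 * `|del| * B * path_mean n (fun s => `|Dsum f s|) + B ^+ 2).
  rewrite -(averageZ hav) -[B ^+ 2](average_cst hav) -(average_lin hav).
  rewrite -(averageD hav); apply: (average_le hav) => s sn.
  have hs := step_mean_average sn.
  rewrite (_ : step_mean n s _ = Csum f s ^+ 2 + 2 * Csum f s *
     step_mean n s (even_ext f) + step_mean n s (fun w => even_ext f w ^+ 2)); last first.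
    transitivity (step_mean n s (fun w => 2 * Csum f s * even_ext f w +
       (even_ext f w ^+ 2 + Csum f s ^+ 2))).
      by apply: (eq_average hs) => w wk; rewrite Csum_rcons; ring.
    by rewrite (average_lin hs) (averageD hs) (average_cst hs); ring.
  have h2 : step_mean n s (fun w => even_ext f w ^+ 2) <= B ^+ 2.
    rewrite -[leRHS](average_cst hs); apply: (average_le hs) => w wk.
    rewrite -real_normK ?num_real // lerXn2r ?nnegrE //.
    exact/norm_even_ext/(mem_steps_all wk).
  rewrite step_mean_even_ext //.
  have -> : 2 * Csum f s * ((gam * Csum f s + sgn_at n.+1 * del * Dsum f s) / n%:R) =
    2 * gam / n%:R * Csum f s ^+ 2 +
    2 * (sgn_at n.+1 * del * (Csum f s / n%:R) * Dsum f s) by ring.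
  have h3 : sgn_at n.+1 * del * (Csum f s / n%:R) * Dsum f s <=
     `|del| * B * `|Dsum f s|.
    rewrite (le_trans (ler_norm _)) // 3!normrM norm_sgn_at mul1r ler_wpM2r //.
    by rewrite ler_wpM2l // normrM normfV normr_nat Csum_div.
  rewrite mulrDl mul1r; lra.
set Y := path_mean n (fun s => Csum f s ^+ 2) in hM.
set Z := path_mean n (fun s => `|Dsum f s|) in hM *.
have Y0 : 0 <= Y.
  by apply: (average_ge0 hav) => s _; rewrite sqr_ge0.
rewrite {1}/y ler_pdivrMr ?exprn_gt0 //; apply: (le_trans hM).
rewrite [leRHS]mulrDl; apply: lerD.
  have -> : (1 - (1 - gam) / n.+1%:R) * y n * n.+1%:R ^+ 2 =
     (n.+1%:R ^+ 2 - (1 - gam) * n.+1%:R) / n%:R ^+ 2 * Y.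
    by rewrite /y -/Y; field; rewrite !gt_eqF.
  rewrite ler_wpM2r // ler_pdivlMr ?exprn_gt0 //.
  have -> : (1 + 2 * gam / n%:R) * n%:R ^+ 2 = n%:R ^+ 2 + 2 * gam * n%:R.
    by field; rewrite gt_eqF.
  rewrite -[n.+1%:R]natr1 -subr_ge0.
  have -> : (n%:R + 1) ^+ 2 - (1 - gam) * (n%:R + 1) - (n%:R ^+ 2 + 2 * gam * n%:R)
     = (1 - gam) * (n%:R - 1) + 1 by ring.
  by rewrite addr_ge0 // mulr_ge0 ?subr_ge0 ?ler1n // ltW.
have -> : e n / n.+1%:R * n.+1%:R ^+ 2 =
   (2 * `|del| * B * Z + B ^+ 2) * (2 * n.+1%:R / n%:R).
  by rewrite /e -/Z; field; rewrite !gt_eqF.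
have Z0 : 0 <= Z by exact: e0.
apply: ler_peMr; first by nonneg.
by rewrite ler_pdivlMr // mul1r -natrM ler_nat mulnS mul2n -addnn addnA leq_addl.
Qed.

Lemma mean_fluct_cvg0 f : \sum_(v <- Vo) f v = 0 ->
  path_mean n (fluct f n) @[n --> \oo] --> 0.
Proof.
move=> f0; have f20 := sum_fsq f.
have h := cvg0D (cvg0D (cvg0D (cvg0D (cvg0_cst_div 1) (mean_Csum_cvg0 f20))
  (mean_Dsum_cvg0 f20)) (mean_Csum_cvg0 f0)) (mean_Dsum_cvg0 f0).
rewrite (_ : (fun n => _) = (fun n => path_mean n (fluct f n))) in h; first by [].
apply/funext => n; have hav := path_mean_average n.
rewrite -!mulrDl (_ : fluct f n = (fun s =>
  n%:R^-1 * (1 + `|Csum (fsq f) s| + `|Dsum (fsq f) s| + `|Csum f s| + `|Dsum f s|))).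
  by rewrite (averageZ hav) !(averageD hav) (average_cst hav) mulrC.
by apply/funext => s; rewrite mulrC.
Qed.


(** * The central limit theorem for projections *)

Definition psi f c n (t : R) : R :=
  path_mean n (fun s => cos (t / Num.sqrt n%:R * Asum f n s + c)).

Definition limit_var f : R := fvar f / (1 - 2 * del).

Definition limit_char f c (t : R) : R :=
  cos c * expR (- (limit_var f / 2 * t ^+ 2)).

Definition scale_fac (n : nat) : R :=
  (1 + del / n%:R) * (Num.sqrt n%:R / Num.sqrt n.+1%:R).

Let d1 : 0 < 1 - 2 * del.
Proof. by rewrite subr_gt0 mulrC -ltr_pdivlMr. Qed.

Lemma limit_var_ge0 f : 0 <= limit_var f.
Proof. by rewrite divr_ge0 ?fvar_ge0 // ltW. Qed.

(** For delta < 1/2 the scaling factor is thus eventually at most 1 - k / (n + 1)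
    with a fixed k > 0. *)
Lemma scale_fac_sqr n : (0 < n)%N ->
  scale_fac n ^+ 2 = 1 - (1 - 2 * del - del ^+ 2 / n%:R) / n.+1%:R.
Proof.
move=> n0; rewrite /scale_fac exprMn expr_div_n !sqr_sqrtr //.
have N0 : n%:R != 0 :> R by rewrite pnatr_eq0 -lt0n.
by rewrite -natr1; field; rewrite natr1 pnatr_eq0 N0.
Qed.

(** The Gaussian limit satisfies the one step relation of psi up to O(1/n^2):
    with L the limiting variance, L (1 - scale_fac^2) is nearly
    L (1 - 2 delta) / (n + 1) = fvar / (n + 1). *)
Lemma limit_char_step f c n t : (0 < n)%N -> del ^+ 2 / n%:R <= 1 - 2 * del ->
  `|t| <= 1 ->
  `|limit_char f c t - (1 - (t / Num.sqrt n.+1%:R) ^+ 2 * fvar f / 2) *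
     limit_char f c (scale_fac n * t)| <=
  (fvar f ^+ 2 + 2 * fvar f * (del ^+ 2 / (1 - 2 * del))) / n.+1%:R
     / n.+1%:R * `|t|.
Proof.
move=> n0 hn t1; have N0 : 0 < n%:R :> R by rewrite ltr0n.
have N1 : 0 < n.+1%:R :> R by rewrite ltr0n.
set L := limit_var f; set F := fvar f; have F0 : 0 <= F by exact: fvar_ge0.
set y := _ * F / 2.
have yE : y = t ^+ 2 * F / (2 * n.+1%:R).
  by rewrite /y expr_div_n sqr_sqrtr // -[in RHS]mulrA; field; rewrite gt_eqF.
pose r := del ^+ 2 / n%:R / (1 - 2 * del).
have r0 : 0 <= r by rewrite divr_ge0 ?(ltW d1) // divr_ge0 ?sqr_ge0.
have r1 : r <= 1 by rewrite /r ler_pdivrMr // mul1r.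
pose x := y * (1 - r).
have y0 : 0 <= y by rewrite yE; nonneg.
have x0 : 0 <= x by rewrite mulr_ge0 // subr_ge0.
have xy : x <= y by rewrite ler_piMr // gerBl.
have xE : L / 2 * t ^+ 2 = L / 2 * (scale_fac n * t) ^+ 2 + x.
  rewrite exprMn scale_fac_sqr // /x yE /r /L /limit_var -/F.
  by field; rewrite !gt_eqF // mulr_gt0.
rewrite /limit_char -/L xE opprD expRD.
set E := expR (- (_ * _)).
have E1 : `|cos c * E| <= 1.
  rewrite normrM mulr_ile1 //; first by rewrite ler_norml cos_geN1 cos_le1.
  rewrite ger0_norm ?expR_ge0 // -[leRHS]expR0 ler_expR oppr_le0.
  by rewrite mulr_ge0 ?sqr_ge0 // divr_ge0 // limit_var_ge0.
have -> : cos c * (E * expR (- x)) - (1 - y) * (cos c * E) =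
  (cos c * E) * ((expR (- x) - (1 - x)) + (y - x)) by ring.
rewrite normrM.
have h1 : `|expR (- x) - (1 - x) + (y - x)| <= y ^+ 2 + y * r.
  rewrite (le_trans (ler_normD _ _)) // lerD //.
    by rewrite (le_trans (expRN_taylor1 x0)) // lerXn2r ?nnegrE.
  have -> : y - x = y * r by rewrite /x; ring.
  by rewrite ger0_norm // mulr_ge0.
apply: (@le_trans _ _ (1 * (y ^+ 2 + y * r))); first by rewrite ler_pM.
rewrite mul1r.
have t2 : t ^+ 2 <= `|t|.
  by rewrite -real_normK ?num_real // expr2 ler_piMr.
have yt : y <= `|t| * (F / n.+1%:R).
  rewrite yE -mulrA ler_pM ?sqr_ge0 ?divr_ge0 // ?mulr_ge0 //.
  rewrite ler_wpM2l // lef_pV2 ?posrE ?mulr_gt0 //.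
  by rewrite ler_peMl ?ler1n // ltW.
have yF : y <= F / n.+1%:R.
  rewrite (le_trans yt) // ler_piMl // divr_ge0 //.
have h2 : y ^+ 2 <= `|t| * (F / n.+1%:R) * (F / n.+1%:R).
  by rewrite expr2 ler_pM.
have rr : r <= 2 * (del ^+ 2 / (1 - 2 * del)) / n.+1%:R.
  rewrite /r mulrAC [leRHS]mulrAC [leRHS]mulrC ler_wpM2l //.
    by rewrite divr_ge0 ?sqr_ge0 // ltW.
  rewrite ler_pdivlMr // mulrC ler_pdivrMr // -natrM ler_nat.
  by rewrite mulSn mul1n -addn1 leq_add2l.
have h3 : y * r <= `|t| * (F / n.+1%:R) * (2 * (del ^+ 2 / (1 - 2 * del)) / n.+1%:R).
  by rewrite ler_pM.
rewrite (le_trans (lerD h2 h3)) // le_eqVlt; apply/orP; left; apply/eqP.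
by ring.
Qed.

Lemma psi_cvg f c : \sum_(v <- Vo) f v = 0 ->
  psi f c n 1 @[n --> \oo] --> limit_char f c 1.
Proof.
move=> f0; set F := fvar f; have F0 : 0 <= F by exact: fvar_ge0.
set Kc := char_step_cst f; have Kc0 : 0 <= Kc by exact: char_step_cst_ge0.
have d2 : 2 * del < 1 by rewrite mulrC -ltr_pdivlMr.
pose c0 : R := (1 - 2 * del) / 4.
have c00 : 0 < c0 by rewrite divr_gt0.
pose Kg := F ^+ 2 + 2 * F * (del ^+ 2 / (1 - 2 * del)).
have Kg0 : 0 <= Kg.
  by rewrite /Kg; nonneg.
pose e n := Kc * (3 / Num.sqrt n.+1%:R + path_mean n (fluct f n)) + Kg / n.+1%:R.
have fl0 n : 0 <= path_mean n (fluct f n).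
  by apply: (average_ge0 (path_mean_average n)) => s _; exact: fluct_ge0.
have e0 n : 0 <= e n.
  by rewrite addr_ge0 ?divr_ge0 // mulr_ge0 // addr_ge0 // divr_ge0 // sqrtr_ge0.
have ecvg : e n @[n --> \oo] --> 0.
  apply: cvg0D; last first.
    by rewrite (cvg_shiftS (fun n => Kg / n%:R)); exact: cvg0_cst_div.
  apply: cvg0Z; apply: cvg0D; last exact: mean_fluct_cvg0.
  rewrite (cvg_shiftS (fun n => 3 / Num.sqrt n%:R)).
  apply: (@cvg0_of_sqr_le _ _ (fun n => 9 / n%:R)); last exact: cvg0_cst_div.
    by move=> n; rewrite divr_ge0 // sqrtr_ge0.
  by move=> n n0; rewrite expr_div_n sqr_sqrtr //; rewrite -natrX.
(* beyond N the scaling factor and the factor 1 - y below lie in [0, 1] *)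
have [N hN] : exists N : nat, [/\ (0 < N)%N, `|del| <= N%:R, F <= N%:R
    & del ^+ 2 <= c0 * 2 * N%:R].
  pose M := `|del| + F + del ^+ 2 / (c0 * 2) + 1.
  have q0 : 0 <= del ^+ 2 / (c0 * 2) by rewrite divr_ge0 ?sqr_ge0 // mulr_ge0 // ltW.
  have n0 : 0 <= `|del| by [].
  have M0 : 0 <= M by rewrite /M; lra.
  exists (Num.bound M); have hM := archi_boundP M0; split.
  - by rewrite -(ltr0n R); apply: le_lt_trans hM.
  - by rewrite (le_trans _ (ltW hM)) // /M; lra.
  - by rewrite (le_trans _ (ltW hM)) // /M; lra.
  - rewrite mulrC -ler_pdivrMr ?mulr_gt0 //.
    by rewrite (le_trans _ (ltW hM)) // /M; lra.
case: hN => N0 hNd hNF hNc.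
have dn n : (N <= n)%N -> del ^+ 2 / n%:R <= c0 * 2.
  move=> Nn; rewrite ler_pdivrMr ?ltr0n ?(leq_trans N0) //.
  by rewrite (le_trans hNc) // ler_wpM2l ?ler_nat // mulr_ge0 // ltW.
have c02 : c0 * 2 <= 1 - 2 * del by rewrite /c0; lra.
pose B := 2 * cstG * fbound f.
have B0 : 0 <= B by rewrite !mulr_ge0 ?fbound_ge0.
have L0 := limit_var_ge0 f.
apply: (@cvg1_of_scaling_contraction _ (psi f c) (limit_char f c) scale_fac e c0
  (2 * (B * Num.sqrt N%:R) + limit_var f / 2) N) => //.
- by nonneg.
- move=> n Nn; have n0 : (0 < n)%N by exact: leq_trans Nn.
  have s0 : 0 <= scale_fac n.
    rewrite mulr_ge0 ?divr_ge0 ?sqrtr_ge0 //.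
    rewrite -lerBlDl sub0r ler_pdivlMr ?ltr0n // mulN1r lerNl.
    rewrite (le_trans (ler_norm _)) // normrN (le_trans hNd) // ler_nat //.
  rewrite s0 /=.
  have h : scale_fac n <= (1 + scale_fac n ^+ 2) / 2.
    have : 0 <= (scale_fac n - 1) ^+ 2 by exact: sqr_ge0.
    by rewrite sqrrB; lra.
  rewrite (le_trans h) // scale_fac_sqr //.
  have i0 : 0 < n.+1%:R^-1 :> R by rewrite invr_gt0 ltr0n.
  have := dn n Nn; set i := n.+1%:R^-1 in i0 *; set z := del ^+ 2 / n%:R => hz.
  have : (c0 * 2) * i <= (1 - 2 * del - z) * i.
    by rewrite ler_wpM2r ?(ltW i0) //; rewrite /c0 in hz *; lra.
  rewrite -[c0 / n.+1%:R]/(c0 * i); lra.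
- move=> n t Nn t1; have n0 : (0 < n)%N by exact: leq_trans Nn.
  have NN0 : 0 < n%:R :> R by rewrite ltr0n.
  have NN1 : 0 < n.+1%:R :> R by rewrite ltr0n.
  have sq0 : 0 < Num.sqrt n.+1%:R :> R by rewrite sqrtr_gt0.
  have sqn0 : 0 < Num.sqrt n%:R :> R by rewrite sqrtr_gt0.
  have hav := path_mean_average n.
  pose tau := t / Num.sqrt n.+1%:R; pose y := tau ^+ 2 * F / 2.
  have tau2 : tau ^+ 2 = t ^+ 2 / n.+1%:R by rewrite expr_div_n sqr_sqrtr.
  have tt : t ^+ 2 <= `|t| by rewrite -real_normK ?num_real // expr2 ler_piMr.
  have t21 : t ^+ 2 <= 1 by rewrite (le_trans tt).
  have y01 : 0 <= 1 - y <= 1.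
    have y0 : 0 <= y by rewrite divr_ge0 // mulr_ge0 // sqr_ge0.
    have : F / n.+1%:R <= 1.
      rewrite ler_pdivrMr // mul1r (le_trans hNF) // ler_nat.
      exact: leq_trans Nn (leqnSn _).
    have : y <= F / n.+1%:R.
      have -> : y = t ^+ 2 / 2 * (F / n.+1%:R) by rewrite /y tau2; ring.
      by apply: ler_piMl; [nonneg|lra].
    by move=> h1 h2; rewrite subr_ge0 (le_trans h1 h2) gerBl.
  case/andP: y01 => y1 y2.
  have hpsi : `|psi f c n.+1 t - (1 - y) * psi f c n (scale_fac n * t)| <=
     Kc * (`|tau| ^+ 3 + `|tau| / n%:R + tau ^+ 2 * path_mean n (fluct f n)).
    have -> : Kc * (`|tau| ^+ 3 + `|tau| / n%:R + tau ^+ 2 * path_mean n (fluct f n)) =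
      path_mean n (fun s => Kc * (`|tau| ^+ 3 + `|tau| / n%:R + tau ^+ 2 * fluct f n s)).
      by rewrite (averageZ hav) (averageD hav) (average_cst hav) (averageZ hav).
    rewrite /psi -[X in _ - X](averageZ hav).
    apply: (average_dist hav) => s sn.
    have -> : scale_fac n * t / Num.sqrt n%:R * Asum f n s =
       tau * (1 + del / n%:R) * Asum f n s.
      by rewrite /scale_fac /tau; field; rewrite !gt_eqF.
    exact: char_step.
  have hlim := limit_char_step f c n0 (le_trans (dn n Nn) c02) t1.
  rewrite -/tau -/F -/y -/Kg in hlim.
  have -> : psi f c n.+1 t - limit_char f c t =
    (psi f c n.+1 t - (1 - y) * psi f c n (scale_fac n * t)) +
    (1 - y) * (psi f c n (scale_fac n * t) - limit_char f c (scale_fac n * t)) -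
    (limit_char f c t - (1 - y) * limit_char f c (scale_fac n * t)) by ring.
  rewrite (le_trans (ler_normB _ _)) //.
  rewrite (le_trans (lerD (ler_normD _ _) (lexx _))) //.
  have h2 : `|(1 - y) * (psi f c n (scale_fac n * t) - limit_char f c (scale_fac n * t))|
     <= `|psi f c n (scale_fac n * t) - limit_char f c (scale_fac n * t)|.
    by rewrite normrM (ger0_norm y1) ler_piMl.
  rewrite (le_trans (lerD (lerD hpsi h2) hlim)) //.
  rewrite [leLHS]addrAC addrC lerD2l /e.
  have ntau : `|tau| = `|t| / Num.sqrt n.+1%:R.
    by rewrite normrM normfV (ger0_norm (ltW sq0)).
  have h3 : `|tau| ^+ 3 <= (Num.sqrt n.+1%:R)^-1 / n.+1%:R * `|t|.
    have -> : `|tau| ^+ 3 = `|t| ^+ 3 * ((Num.sqrt n.+1%:R)^-1 / n.+1%:R).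
      by rewrite ntau expr_div_n [(Num.sqrt _) ^+ 3]exprS sqr_sqrtr // invfM.
    rewrite [leRHS]mulrC; apply: ler_wpM2r; first by rewrite divr_ge0 // invr_ge0 ltW.
    by rewrite exprS; apply: ler_piMr => //; apply: exprn_ile1.
  have h4 : `|tau| / n%:R <= 2 * (Num.sqrt n.+1%:R)^-1 / n.+1%:R * `|t|.
    have -> : 2 * (Num.sqrt n.+1%:R)^-1 / n.+1%:R * `|t| =
      `|t| / Num.sqrt n.+1%:R * (2 / n.+1%:R) by ring.
    rewrite ntau; apply: ler_wpM2l; first by rewrite divr_ge0 // ltW.
    rewrite ler_pdivlMr // mulrC ler_pdivrMr // -natrM ler_nat.
    by rewrite mulSn mul1n -addn1 leq_add2l.
  have h5 : tau ^+ 2 * path_mean n (fluct f n) <= path_mean n (fluct f n) / n.+1%:R * `|t|.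
    rewrite [leRHS]mulrC; have -> : tau ^+ 2 * path_mean n (fluct f n) =
      t ^+ 2 * (path_mean n (fluct f n) / n.+1%:R) by rewrite tau2; ring.
    by rewrite ler_wpM2r // divr_ge0.
  have h6 : Kc * (`|tau| ^+ 3 + `|tau| / n%:R + tau ^+ 2 * path_mean n (fluct f n)) <=
    Kc * (3 / Num.sqrt n.+1%:R + path_mean n (fluct f n)) / n.+1%:R * `|t|.
    rewrite -[Kc * _ / _]mulrA -[Kc * _ * `|t|]mulrA; apply: ler_wpM2l => //.
    rewrite (le_trans (lerD (lerD h3 h4) h5)) // le_eqVlt; apply/orP; left; apply/eqP.
    by ring.
  by rewrite [X in _ <= X * _]mulrDl [leRHS]mulrDl lerD.
move=> t t1; have NN0 : 0 < N%:R :> R by rewrite ltr0n.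
have hav := path_mean_average N.
have h1 : `|psi f c N t - cos c| <= 2 * (B * Num.sqrt N%:R) * `|t|.
  rewrite -[cos c](average_cst hav) -[leRHS](average_cst hav).
  apply: (average_dist hav) => s sn.
  rewrite [_ * _ + c]addrC (le_trans (cos_lip _ _)) // -[leRHS]mulrA ler_wpM2l //.
  rewrite normrM normrM normfV (ger0_norm (sqrtr_ge0 _)).
  rewrite mulrC mulrCA mulrC ler_wpM2r //.
  have := norm_Asum_div f sn N0; rewrite -/B ler_pdivrMr // => hA.
  rewrite ler_pdivrMr ?sqrtr_gt0 // -mulrA -expr2 sqr_sqrtr //.
have h2 : `|cos c - limit_char f c t| <= limit_var f / 2 * `|t|.
  rewrite /limit_char; set x := limit_var f / 2 * t ^+ 2.
  have x0 : 0 <= x by rewrite mulr_ge0 ?sqr_ge0 // divr_ge0.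
  have -> : cos c - cos c * expR (- x) = cos c * (1 - expR (- x)) by ring.
  have xt : x <= limit_var f / 2 * `|t|.
    apply: ler_wpM2l; first by nonneg.
    by rewrite -real_normK ?num_real // expr2 ler_piMr.
  rewrite normrM (le_trans _ xt) // (@le_trans _ _ `|1 - expR (- x)|) //.
    by rewrite ler_piMl // ler_norml cos_geN1 cos_le1.
  rewrite ger0_norm; first by have := expR_ge1Dx (- x); lra.
  by rewrite subr_ge0 -[leRHS]expR0 ler_expR oppr_le0.
have -> : psi f c N t - limit_char f c t =
  (psi f c N t - cos c) + (cos c - limit_char f c t) by ring.
by rewrite (le_trans (ler_normD _ _)) // mulrDl lerD.
Qed.

Lemma is_path_inv n s : is_path n.+1 s ->
  exists s' w, [/\ s = rcons s' w, is_path n s' & w \in steps n.+1].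
Proof.
case/lastP: s => [[]//|s w [+ hs]]; rewrite size_rcons => -[sn].
exists s, w; split=> //.
- split=> // i ltin; have := hs i (ltnW ltin); rewrite nth_rcons sn ltin.
  exact.
- by have := hs n (leqnn _); rewrite nth_rcons sn ltnn eqxx.
Qed.

(** At odd times the steps lie in Vo and at even times in Ve = - Vo, hence the
    means mu of an odd function alternate in sign and cancel in pairs. *)
Lemma sum_path_odd (l : V -> R) (mu : R) n s : (forall v, l (- v) = - l v) ->
  is_path n s ->
  \sum_(v <- s) l v = Dsum (fun v => l v - mu) s + (odd n)%:R * mu.
Proof.
move=> lN; elim: n s => [|n IH] s.
  by move=> [/size0nil -> _]; rewrite /Dsum !big_nil mul0r addr0.
move=> /is_path_inv[s' [w [-> s'n wk]]].
rewrite Dsum_rcons -cats1 big_cat big_seq1 (IH _ s'n) /=.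
have -> : odd_ext (fun v => l v - mu) w = l w - sgn_at n.+1 * mu.
  move: wk; rewrite /odd_ext /steps_at /sgn_at /=; case: odd => /= wk.
    case: ifP => [vo|_]; first by rewrite (VeF_of_Vo vo) in wk.
    by rewrite lN mulN1r opprB opprK addrC opprK.
  by rewrite wk mul1r.
by rewrite /sgn_at /=; case: odd => /=; ring.
Qed.

Definition center (l : V -> R) (v : V) : R :=
  l v - m%:R^-1 * \sum_(u <- Vo) l u.

Lemma sum_center l : \sum_(v <- Vo) center l v = 0.
Proof.
rewrite /center sumrB big_const_seq count_predT iter_addr_0.
by rewrite -[_ *+ _]mulr_natr mulrAC mulVf // mul1r subrr.
Qed.

(** The projection of the walk differs from the compensated sum of the centered
    function by a bounded amount, negligible at the scale sqrt n. *)
Lemma path_char_cvg (l : V -> R) (c : R) : (forall v, l (- v) = - l v) ->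
  path_mean n (fun s => cos ((Num.sqrt n%:R)^-1 * (\sum_(v <- s) l v) + c))
    @[n --> \oo] --> cos c * expR (- (fvar (center l) / (1 - 2 * del) / 2)).
Proof.
move=> lN; set f := center l; have f0 := sum_center l.
set mu := m%:R^-1 * \sum_(u <- Vo) l u.
have -> : cos c * expR (- (fvar f / (1 - 2 * del) / 2)) = limit_char f c 1.
  by rewrite /limit_char expr1n mulr1.
have hpsi := psi_cvg (c := c) f0.
pose K := 2 * (cstG * fbound f + `|mu|).
have K0 : 0 <= K by have := fbound_ge0 f; rewrite /K => ?; nonneg.
have dist n : (0 < n)%N ->
  `|path_mean n (fun s => cos ((Num.sqrt n%:R)^-1 * (\sum_(v <- s) l v) + c)) -
    psi f c n 1| <= K / Num.sqrt n%:R.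
  move=> n0; have hav := path_mean_average n.
  rewrite /psi -[leRHS](average_cst hav); apply: (average_dist hav) => s sn.
  rewrite (sum_path_odd mu lN sn) -/(center l) -/f div1r.
  have -> : (Num.sqrt n%:R)^-1 * (Dsum f s + (odd n)%:R * mu) + c =
    ((Num.sqrt n%:R)^-1 * Asum f n s + c) +
    (Num.sqrt n%:R)^-1 * ((Dsum f s - Asum f n s) + (odd n)%:R * mu) by ring.
  rewrite (le_trans (cos_lip _ _)) // /K -mulrA ler_wpM2l // normrM.
  rewrite ger0_norm ?invr_ge0 ?sqrtr_ge0 // mulrC.
  rewrite ler_wpM2r ?invr_ge0 ?sqrtr_ge0 // (le_trans (ler_normD _ _)) // lerD //.
    exact: norm_AsumB.
  by rewrite normrM normr_nat ler_piMl //; case: odd.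
apply/cvgrPdist_le => eps eps0.
have e2 : 0 < eps / 2 by rewrite divr_gt0.
have hK : K / Num.sqrt n%:R @[n --> \oo] --> 0.
  apply: (@cvg0_of_sqr_le _ _ (fun n => K ^+ 2 / n%:R)); last exact: cvg0_cst_div.
    by move=> n; nonneg.
  by move=> n n0; rewrite expr_div_n sqr_sqrtr.
move/cvgrPdist_le : hpsi => /(_ _ e2)[N1 _ hN1].
move/cvgrPdist_le : hK => /(_ _ e2)[N2 _ hN2].
exists (maxn 1 (maxn N1 N2)) => // n /=; rewrite !geq_max => /and3P[n0 n1 n2].
have h1 := hN1 n n1; have h2 := hN2 n n2; rewrite /= sub0r normrN in h2.
rewrite -(subrKA (psi f c n 1)) (le_trans (ler_normD _ _)) //.
rewrite [leRHS](splitr eps) lerD // distrC (le_trans (dist n n0)) //.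
by rewrite (le_trans _ h2) // ler_norm.
Qed.

Lemma path_second_moment (l : V -> R) : (forall v, l (- v) = - l v) ->
  exists K, 0 <= K /\ forall n, (0 < n)%N ->
    path_mean n (fun s => (\sum_(v <- s) l v) ^+ 2) <= K * n%:R.
Proof.
move=> lN; have [K [K0 hK]] := Dsum_sqr_linear (sum_center l).
set mu := m%:R^-1 * \sum_(u <- Vo) l u.
exists (2 * K + 2 * mu ^+ 2); split; first by nonneg.
move=> n n0; have hav := path_mean_average n.
apply: (@le_trans _ _ (path_mean n (fun s => 2 * Dsum (center l) s ^+ 2 + 2 * mu ^+ 2))).
  apply: (average_le hav) => s sn; rewrite (sum_path_odd mu lN sn) -/(center l).
  apply: le_trans (sqrD_le _ _) _; rewrite lerD2l ler_wpM2l // exprMn.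
  by rewrite ler_piMl ?sqr_ge0 //; case: odd; rewrite ?expr1n ?expr0n.
rewrite (average_lin hav) (average_cst hav) [leRHS]mulrDl lerD //.
  by rewrite -mulrA ler_wpM2l // hK.
by apply: ler_peMr; [nonneg|rewrite ler1n].
Qed.

End PathMean.

(** * Trigonometric approximation *)

Definition dot (R : realType) (d : nat) (t x : 'rV[R]_d) : R :=
  (x *m t^T) ord0 ord0.

Section BernoulliTrials.
Variables (R : realType) (I : eqType) (s : I -> R).
Hypothesis s01 : forall i, 0 <= s i <= 1.

Definition hit (j : I) (k : I -> nat) (i : I) : nat := (k i + (i == j))%N.

(** The expectation of h (k + numbers of successes) when a trial of success
    probability s(j) is made for each entry j of js: the multivariate Bernstein
    operator, kept as a recursion so that it visibly preserves trigonometric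
    polynomials in the probabilities. *)
Fixpoint trials (js : seq I) (h : (I -> nat) -> R) (k : I -> nat) : R :=
  if js is j :: js' then
    s j * trials js' h (hit j k) + (1 - s j) * trials js' h k
  else h k.

Lemma trials_average js k :
  is_average (fun k' : I -> nat => forall i, (k' i <= k i + count_mem i js)%N)
    (fun h => trials js h k).
Proof.
elim: js k => [|j js IH] k.
  by split=> // f g; apply=> i; rewrite addn0.
have /andP[s0 s1] := s01 j.
split=> [a f g|f g fg|c] /=.
- by rewrite !(average_lin (IH _)); ring.
- apply: lerD; apply: ler_wpM2l; rewrite ?subr_ge0 //;
    apply: (average_le (IH _)) => k' hk'; apply: fg => i;
    rewrite (leq_trans (hk' i)) //= ?leq_add2l ?leq_addl //.
  by rewrite /hit -addnA eq_sym.
- by rewrite !(average_cst (IH _)); ring.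
Qed.

Lemma trials_variance js i c k :
  trials js (fun k => ((k i)%:R + c) ^+ 2) k =
  ((k i)%:R + (count_mem i js)%:R * s i + c) ^+ 2
  + (count_mem i js)%:R * (s i * (1 - s i)).
Proof.
elim: js k => [|j js IH] k /=; first by ring.
rewrite !IH /hit eq_sym; case: eqP => [->|_] /=; rewrite !natrD /=; ring.
Qed.

End BernoulliTrials.

Section BoundedContinuous.
Variables (R : realType) (d : nat).
Local Notation V := 'rV[R]_d.
Implicit Types (f g : V -> R) (t x y : V).

Lemma dotE t x : dot t x = \sum_j x ord0 j * t ord0 j.
Proof. by rewrite /dot mxE; apply: eq_bigr => j _; rewrite mxE. Qed.

Lemma dotDr t x y : dot t (x + y) = dot t x + dot t y.
Proof. by rewrite /dot mulmxDl mxE. Qed.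

Lemma dotZr t a x : dot t (a *: x) = a * dot t x.
Proof. by rewrite /dot -scalemxAl mxE. Qed.

Lemma dotNr t x : dot t (- x) = - dot t x.
Proof. by rewrite /dot mulNmx mxE. Qed.

Lemma dot0l x : dot 0 x = 0.
Proof. by rewrite /dot trmx0 mulmx0 mxE. Qed.

Lemma dotDl t y x : dot (t + y) x = dot t x + dot y x.
Proof. by rewrite /dot linearD mulmxDr mxE. Qed.

Lemma dotNl t x : dot (- t) x = - dot t x.
Proof. by rewrite /dot linearN mulmxN mxE. Qed.

Lemma dot_sum t (I : Type) (r : seq I) (F : I -> V) :
  dot t (\sum_(i <- r) F i) = \sum_(i <- r) dot t (F i).
Proof. by rewrite /dot mulmx_suml summxE. Qed.

Lemma dot_delta a j x : dot (a *: delta_mx ord0 j) x = a * x ord0 j.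
Proof.
rewrite dotE (bigD1 j) //= big1 ?addr0 => [|i ij]; rewrite !mxE !eqxx /=.
  by rewrite mulr1 mulrC.
by rewrite (negbTE ij) !mulr0.
Qed.

Lemma continuous_dot t : continuous (dot t).
Proof.
have -> : dot t = (fun x => \sum_j x ord0 j * t ord0 j).
  by apply/funext => y; rewrite dotE.
apply: continuous_big => [|j _]; first exact: add_continuous.
move=> x; apply: continuousM; first exact: coord_continuous.
exact: cst_continuous.
Qed.

Definition bounded_continuous f := continuous f /\ exists M, forall x, `|f x| <= M.

Lemma bounded_continuous_cst c : bounded_continuous (fun=> c).
Proof. by split; [exact: cst_continuous|exists `|c|]. Qed.

Lemma bounded_continuous_lin a f g : bounded_continuous f ->
  bounded_continuous g -> bounded_continuous (fun x => a * f x + g x).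
Proof.
move=> [cf [M hM]] [cg [N hN]]; split.
  move=> x; apply: continuousD (cg x).
  by apply: continuousM (cf x); exact: cst_continuous.
exists (`|a| * M + N) => x; rewrite (le_trans (ler_normD _ _)) // lerD //.
by rewrite normrM ler_wpM2l.
Qed.

Lemma bounded_continuous_cos t c :
  bounded_continuous (fun x => cos (dot t x + c)).
Proof.
split; last by exists 1 => x; rewrite ler_norml cos_geN1 cos_le1.
move=> x; apply: (continuous_comp (f := fun x => dot t x + c)); last exact: continuous_cos.
by apply: continuousD; [exact: continuous_dot|exact: cst_continuous].
Qed.

Lemma bounded_continuous_norm f : bounded_continuous f ->
  bounded_continuous (fun x => `|f x|).
Proof.
move=> [cf [M hM]]; split; last by exists M => x; rewrite normr_id.
by move=> x; apply: (continuous_comp (cf x)); exact: norm_continuous.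
Qed.

Lemma bounded_continuous_max0 f : bounded_continuous f ->
  bounded_continuous (fun x => Num.max (f x) 0).
Proof.
move=> [cf [M hM]]; split.
  by move=> x; apply: (continuous_max (cf x)); exact: cst_continuous.
exists M => x; have M0 : 0 <= M by rewrite (le_trans _ (hM x)).
have [h|h] := leP (f x) 0; first by rewrite normr0.
by rewrite -{1}[f x]ger0_norm // ?normr_id // ltW.
Qed.

(** The linear span of the functions cos (<t, x> + c); closure under products is
    [trig_mul], and every element is bounded on the whole space. *)
Inductive trig_poly : (V -> R) -> Prop :=
| trig_cos t c : trig_poly (fun x => cos (dot t x + c))
| trig_lin a f g : trig_poly f -> trig_poly g ->
    trig_poly (fun x => a * f x + g x).

Lemma trig_bounded_continuous f : trig_poly f -> bounded_continuous f.
Proof.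
elim=> [t c|a {}f g _ hf _ hg]; first exact: bounded_continuous_cos.
exact: bounded_continuous_lin.
Qed.

Lemma trig_cst c : trig_poly (fun=> c).
Proof.
have h1 : trig_poly (fun=> 1).
  have -> : (fun=> 1) = (fun x : V => cos (dot 0 x + 0) : R).
    by apply/funext => x; rewrite dot0l addr0 cos0.
  exact: trig_cos.
have -> : (fun=> c) = (fun x : V => (c - 1) * 1 + 1 : R).
  by apply/funext => x; ring.
exact: trig_lin.
Qed.

Lemma trig_mul f g : trig_poly f -> trig_poly g -> trig_poly (fun x => f x * g x).
Proof.
move=> hf hg; elim: hf => [t c|a f1 f2 _ h1 _ h2]; last first.
  have -> : (fun x => (a * f1 x + f2 x) * g x) =
    (fun x => a * (f1 x * g x) + f2 x * g x) by apply/funext => x; ring.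
  exact: trig_lin.
elim: hg => [t' c'|a f1 f2 _ h1 _ h2]; last first.
  have -> : (fun x => cos (dot t x + c) * (a * f1 x + f2 x)) =
    (fun x => a * (cos (dot t x + c) * f1 x) + cos (dot t x + c) * f2 x).
    by apply/funext => x; ring.
  exact: trig_lin.
have -> : (fun x => cos (dot t x + c) * cos (dot t' x + c')) =
  (fun x => 2^-1 * cos (dot (t + t') x + (c + c')) +
    (2^-1 * cos (dot (t - t') x + (c - c')) + 0)).
  apply/funext => x; rewrite !dotDl dotNl.
  have -> : dot t x + dot t' x + (c + c') = (dot t x + c) + (dot t' x + c') by ring.
  have -> : dot t x - dot t' x + (c - c') = (dot t x + c) - (dot t' x + c') by ring.
  by move: (dot t x + c) (dot t' x + c') => u v; rewrite cosD cosB; field.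
apply: trig_lin; first exact: trig_cos.
by apply: trig_lin; [exact: trig_cos|exact: trig_cst].
Qed.

Lemma trig_trials (s : V -> 'I_d -> R) js h k :
  (forall j, trig_poly (fun x => s x j)) ->
  trig_poly (fun x => trials (s x) js h k).
Proof.
move=> hs; elim: js k => [|j js IH] k /=; first exact: trig_cst.
have -> : (fun x => s x j * trials (s x) js h (hit j k) +
    (1 - s x j) * trials (s x) js h k) =
  (fun x => 1 * (s x j * trials (s x) js h (hit j k)) +
    ((- 1) * (s x j * trials (s x) js h k) + trials (s x) js h k)).
  by apply/funext => x; ring.
by do 2! [apply: trig_lin; first exact: trig_mul].
Qed.

(** The point y is not confined to the box, as the grid points of
    [trig_approximation] need not lie in it. *)
Lemma uniform_continuity_box f (L e : R) : continuous f -> 0 < e ->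
  exists eta, 0 < eta /\ forall x y, (forall j, `|x ord0 j| <= L) ->
    (forall j, `|x ord0 j - y ord0 j| < eta) -> `|f x - f y| < e.
Proof.
move=> cf e0.
have : compact [set x : V | forall j, [set` `[(- L), L]] (x ord0 j)].
  apply: (@rV_compact _ _ (fun=> [set` `[(- L), L]])) => j.
  exact: segment_compact.
move/compact_near_coveringP => /(_ _ (0^'+) (fun eta x => forall y : V,
   (forall j, `|x ord0 j - y ord0 j| < eta) -> `|f x - f y| < e)).
move=> /(_ _)[].
  move=> x _; have e2 : 0 < e / 2 by rewrite divr_gt0.
  have /cvgrPdist_lt/(_ _ e2)/nbhs_ballP[r /= r0 hr] := cf x.
  have r2 : 0 < r / 2 by rewrite divr_gt0.
  exists (ball x (r / 2), [set eta | eta < r / 2]).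
    by split => /=; [exact: nbhsx_ballx|exact: nbhs_right_lt].
  move=> [x' eta] /= [hx' heta] y hy.
  have near (z : V) : (forall j, `|x ord0 j - z ord0 j| < r) -> `|f x - f z| < e / 2.
    by move=> hz; apply: hr; split => // i j; rewrite ord1 /ball /=; exact: hz.
  have hx'j j : `|x ord0 j - x' ord0 j| < r / 2 by case: hx' => _ /(_ ord0 j).
  have h1 : `|f x - f x'| < e / 2.
    by apply: near => j; rewrite (lt_trans (hx'j j)) // ltr_pdivrMr // ltr_pMr // ltr1n.
  have h2 : `|f x - f y| < e / 2.
    apply: near => j; rewrite -(subrKA (x' ord0 j)) (le_lt_trans (ler_normD _ _)) //.
    by rewrite [ltRHS](splitr r) ltrD // (lt_trans (hy j)).
  rewrite -(subrKA (f x)) (le_lt_trans (ler_normD _ _)) // [ltRHS](splitr e).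
  by rewrite ltrD // distrC.
move=> r /= r0 hr; exists (r / 2); split; first by rewrite divr_gt0.
move=> x y hx; apply: (hr (r / 2)) => /=.
- by rewrite sub0r normrN ger0_norm ?divr_ge0 ?(ltW r0) // ltr_pdivrMr // ltr_pMr // ltr1n.
- by rewrite divr_gt0.
- by move=> j; rewrite in_itv /= -ler_norml.
Qed.

End BoundedContinuous.

Section SineSeparation.
Variable R : realType.

(** Midway between 1 and pi/2: bounds the half sum and the half difference of
    an argument in [-1, 1] and one in [-pi/2, pi/2]. *)
Let u0 : R := (1 + pi / 2) / 2.
Definition sine_cst : R := cos u0.

Let pihalf_gt1 : 1 < pi / 2 :> R.
Proof.
rewrite lt_neqAle; apply/andP; split.
  by apply/eqP => h; have := cos1_gt0 R; rewrite h cos_pihalf ltxx.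
by rewrite ler_pdivlMr // mul1r pi_ge2.
Qed.

Let u0_bound : 0 < u0 < pi / 2.
Proof. by have := pihalf_gt1; rewrite /u0 => ?; apply/andP; split; lra. Qed.

Lemma sine_cst_gt0 : 0 < sine_cst.
Proof.
case/andP: u0_bound => h0 h1; apply: cos_gt0_pihalf; apply/andP; split => //.
by rewrite (lt_trans _ h0) // oppr_lt0 (lt_trans h0).
Qed.

Let cos_ge u : `|u| <= u0 -> sine_cst <= cos u.
Proof.
move=> hu; case/andP: u0_bound => h0 h1.
have -> : cos u = cos `|u|.
  by have [h|h] := leP 0 u; [rewrite ger0_norm|rewrite ltr0_norm // cosN].
rewrite /sine_cst leNgt ltr_cos ?in_itv /= -?leNgt //; have := pi_gt0 R; have := normr_ge0 u;
  move: (pi) h1 => P h1 *; apply/andP; split; lra.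
Qed.

Let sin_ge v : `|v| <= u0 -> sine_cst * `|v| <= `|sin v|.
Proof.
wlog v0 : v / 0 <= v.
  move=> H; have [v0|v0] := leP 0 v; first exact: H.
  move=> hv; have := H (- v); rewrite sinN !normrN; apply => //.
  by rewrite oppr_ge0 ltW.
rewrite (ger0_norm v0) => hv.
have cf : {within `[0, v], continuous (@sin R)}.
  by apply: continuous_subspaceT => y; exact: continuous_sin.
have [c] := MVT_segment v0 (fun y _ => is_derive_sin y) cf.
rewrite in_itv /= sin0 !subr0 => /andP[c0 cv] ->.
rewrite normrM (ger0_norm v0) ler_wpM2r //.
rewrite (le_trans _ (ler_norm _)) // cos_ge //.
by rewrite ger0_norm // (le_trans cv).
Qed.

(** From sin a - sin b = 2 cos ((a+b)/2) sin ((a-b)/2), where both angles stay away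
    from pi/2. *)
Lemma sine_separation a b : `|a| <= 1 -> `|b| <= pi / 2 ->
  sine_cst ^+ 2 * `|a - b| <= `|sin a - sin b|.
Proof.
move=> ha hb.
set u := (a + b) / 2; set v := (a - b) / 2.
have hu : `|u| <= u0.
  rewrite /u /u0 normrM normfV normr_nat ler_wpM2r // (le_trans (ler_normD _ _)) //.
  exact: lerD.
have hv : `|v| <= u0.
  rewrite /v /u0 normrM normfV normr_nat ler_wpM2r // (le_trans (ler_normB _ _)) //.
  exact: lerD.
have -> : sin a - sin b = 2 * (cos u * sin v).
  have -> : a = u + v by rewrite /u /v; field.
  have -> : b = u - v by rewrite /u /v; field.
  by rewrite sinD sinB; ring.
have -> : `|a - b| = 2 * `|v|.
  by rewrite /v normrM normfV normr_nat; field.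
have k0 := sine_cst_gt0.
rewrite (normrM 2) (normrM (cos u)) normr_nat mulrCA ler_wpM2l // expr2 -mulrA.
rewrite ler_pM ?mulr_ge0 ?(ltW k0) //; first by rewrite (le_trans (cos_ge hu)) ?ler_norm.
exact: sin_ge.
Qed.

End SineSeparation.

Section TrigApproximation.
Variables (R : realType) (d : nat).
Local Notation V := 'rV[R]_d.

(** Bernstein approximation in the variables s_j(x) = (1 + sin (x_j / L)) / 2, which
    are trigonometric polynomials and separate the points of the box
    quantitatively.  Since p(x) is an average of values of f, it keeps the bound M
    outside the box, where f is not approximated.  Chebyshev's inequality
    controls the average of the far grid points. *)
Lemma trig_approximation (f : V -> R) (M L e : R) : continuous f ->
  (forall x, `|f x| <= M) -> 0 < L -> 0 < e ->
  exists p, [/\ trig_poly p, forall x, `|p x| <= M &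
    forall x : V, (forall j, `|x ord0 j| <= L) -> `|f x - p x| <= e].
Proof.
move=> cf fM L0 e0; have e2 : 0 < e / 2 by rewrite divr_gt0.
have [eta [eta0 hf]] := uniform_continuity_box L cf e2.
have M0 : 0 <= M by rewrite (le_trans _ (fM 0)).
pose k0 : R := sine_cst R; have k00 : 0 < k0 by exact: sine_cst_gt0.
pose K := 2 * M / eta ^+ 2 * (L ^+ 2 / k0 ^+ 4) * d%:R.
have K0 : 0 <= K by rewrite /K; nonneg.
have [N [N0 hN]] : exists N : nat, (0 < N)%N /\ K <= e / 2 * N%:R.
  have q0 : 0 <= K / (e / 2) + 1 by rewrite addr_ge0 // divr_ge0 // ltW.
  exists (Num.bound (K / (e / 2) + 1)); have h := archi_boundP q0; split.
    by rewrite -(ltr0n R) (le_lt_trans q0).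
  by rewrite mulrC -ler_pdivrMr // (le_trans _ (ltW h)) // lerDl.
have NN0 : 0 < N%:R :> R by rewrite ltr0n.
pose s (x : V) (j : 'I_d) : R := (1 + sin (x ord0 j / L)) / 2.
have s01 x j : 0 <= s x j <= 1.
  have := sin_geN1 (x ord0 j / L); have := sin_le1 (x ord0 j / L).
  by rewrite /s; move: (sin _) => y *; apply/andP; split; lra.
(* the grid point at which s_j takes the observed frequencies k_j / N *)
pose pt (k : 'I_d -> nat) : V := \row_j (L * asin (2 * (k j)%:R / N%:R - 1)).
pose js := iter N (cat (enum 'I_d)) [::].
have cjs i : count_mem i js = N.
  rewrite /js; elim: (N) => //= n IH.
  by rewrite count_cat IH count_uniq_mem ?enum_uniq // mem_enum add1n.
pose B x h := trials (s x) js h (fun=> 0%N).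
have hB x := trials_average (s01 x) js (fun=> 0%N).
exists (fun x => B x (fun k => f (pt k))); split.
- apply: trig_trials => j.
  have -> : (fun x => s x j) = (fun x : V =>
     2^-1 * cos (dot (L^-1 *: delta_mx ord0 j) x + - (pi / 2)) + 2^-1).
    apply/funext => x; rewrite dot_delta cosBpihalf /s [L^-1 * _]mulrC.
    by field.
  by apply: trig_lin; [exact: trig_cos|exact: trig_cst].
- by move=> x; apply: (average_norm_le (hB x)).
move=> x hx.
rewrite -[f x](average_cst (hB x)).
pose c1 := 2 * M / eta ^+ 2 * (4 * L ^+ 2 / k0 ^+ 4 / N%:R ^+ 2).
have c10 : 0 <= c1 by rewrite /c1; nonneg.
apply: (le_trans (average_dist (hB x) (h := fun k =>
  c1 * (\sum_j ((k j)%:R + - (N%:R * s x j)) ^+ 2) + e / 2) _)).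
  move=> k hk.
  have kN j : (k j)%:R / N%:R <= 1 :> R.
    by rewrite ler_pdivrMr // mul1r ler_nat (leq_trans (hk j)) // cjs.
  have k1 j : -1 <= (2 * (k j)%:R / N%:R - 1 : R) <= 1.
    have := kN j; have : 0 <= (k j)%:R / N%:R :> R by rewrite divr_ge0.
    by rewrite -mulrA; move: (_ / N%:R) => y *; apply/andP; split; lra.
  have dist j : (x ord0 j - pt k ord0 j) ^+ 2 <=
     (4 * L ^+ 2 / k0 ^+ 4 / N%:R ^+ 2) * ((k j)%:R + - (N%:R * s x j)) ^+ 2.
    set a := x ord0 j / L; pose b : R := asin (2 * (k j)%:R / N%:R - 1).
    have ha : `|a| <= 1.
      by rewrite /a normrM normfV (gtr0_norm L0) ler_pdivrMr // mul1r hx.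
    have hb : `|b| <= pi / 2 by rewrite ler_norml asin_geNpi2 ?asin_lepi2.
    have := sine_separation ha hb; rewrite -/k0.
    have -> : sin b = 2 * (k j)%:R / N%:R - 1.
      by rewrite /b asinK // in_itv /=; exact: k1.
    have -> : sin a - (2 * (k j)%:R / N%:R - 1) =
       - (2 / N%:R * ((k j)%:R + - (N%:R * s x j))).
      by rewrite /s -/a; field; rewrite gt_eqF.
    have -> : x ord0 j - pt k ord0 j = L * (a - b).
      by rewrite /pt mxE -/b /a; field; rewrite gt_eqF.
    move: ((k j)%:R + - (N%:R * s x j)) => z; rewrite normrN => h.
    have h2 : (k0 ^+ 2 * `|a - b|) ^+ 2 <= `|2 / N%:R * z| ^+ 2.
      by rewrite lerXn2r ?nnegrE ?mulr_ge0 ?exprn_ge0 ?(ltW k00).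
    rewrite exprMn real_normK ?num_real // real_normK ?num_real // in h2.
    have -> : 4 * L ^+ 2 / k0 ^+ 4 / N%:R ^+ 2 * z ^+ 2 =
       L ^+ 2 * ((2 / N%:R * z) ^+ 2 / k0 ^+ 4).
      by field; rewrite !gt_eqF.
    rewrite exprMn ler_wpM2l ?sqr_ge0 // ler_pdivlMr ?exprn_gt0 //.
    by rewrite mulrC (le_trans _ h2) // -exprM.
  have sum_le : 2 * M / eta ^+ 2 * (\sum_j (x ord0 j - pt k ord0 j) ^+ 2) <=
      c1 * (\sum_j ((k j)%:R + - (N%:R * s x j)) ^+ 2).
    rewrite /c1 -[leRHS]mulrA ler_wpM2l ?divr_ge0 ?mulr_ge0 ?exprn_ge0 ?(ltW eta0) //.
    by rewrite mulr_sumr ler_sum.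
  apply: (@le_trans _ _ (2 * M / eta ^+ 2 *
    (\sum_j (x ord0 j - pt k ord0 j) ^+ 2) + e / 2)); last first.
    by rewrite lerD2r.
  have S0 : 0 <= \sum_j (x ord0 j - pt k ord0 j) ^+ 2.
    by apply: sumr_ge0 => j _; exact: sqr_ge0.
  have [near|] := pselect (forall j, `|x ord0 j - pt k ord0 j| < eta).
    rewrite (le_trans (ltW (hf x (pt k) hx near))) // lerDr.
    by rewrite mulr_ge0 // divr_ge0 ?mulr_ge0 ?exprn_ge0 // ltW.
  move=> /existsNP[j /negP]; rewrite -leNgt => far.
  apply: (@le_trans _ _ (2 * M)).
    by rewrite (le_trans (ler_normB _ _)) // mulr_natl mulr2n lerD.
  rewrite (@le_trans _ _ (2 * M / eta ^+ 2 * (\sum_j (x ord0 j - pt k ord0 j) ^+ 2))) //;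
    last by rewrite lerDl ltW.
  rewrite -mulrA ler_peMr ?mulr_ge0 // mulrC ler_pdivlMr ?exprn_gt0 // mul1r.
  rewrite (bigD1 j) //= (@le_trans _ _ ((x ord0 j - pt k ord0 j) ^+ 2)) //.
    by rewrite -[leRHS]real_normK ?num_real // lerXn2r ?nnegrE ?(ltW eta0).
  by rewrite lerDl; apply: sumr_ge0 => i _; exact: sqr_ge0.
rewrite (average_lin (hB x)) (average_cst (hB x)) (average_sum (hB x)).
rewrite [leRHS](splitr e) lerD2r.
apply: (@le_trans _ _ (c1 * (N%:R / 4 * d%:R))); last first.
  have -> : c1 * (N%:R / 4 * d%:R) = K / N%:R.
    by rewrite /c1 /K; field; rewrite !gt_eqF.
  by rewrite ler_pdivrMr.
rewrite ler_wpM2l //.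
apply: (@le_trans _ _ (\sum_(j < d) (N%:R / 4))); last first.
  by rewrite sumr_const card_ord mulr_natr.
apply: ler_sum => j _; rewrite (trials_variance _ _ j (- (N%:R * s x j))) cjs.
rewrite add0r subrr expr0n /= add0r ler_wpM2l //.
have : 0 <= (s x j - 2^-1) ^+ 2 by exact: sqr_ge0.
by move: (s x j) => y; lra.
Qed.

End TrigApproximation.

(** * The continuity theorem *)

Section Continuity.
Variables (R : realType) (d : nat).
Local Notation V := 'rV[R]_d.

Record is_mean (E : (V -> R) -> R) : Prop := {
  mean_lin : forall a f g, bounded_continuous f -> bounded_continuous g ->
    E (fun x => a * f x + g x) = a * E f + E g;
  mean_le : forall f g, bounded_continuous f -> bounded_continuous g ->
    (forall x, f x <= g x) -> E f <= E g;
  mean_cst : forall c, E (fun=> c) = c }.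

(** Tightness is expressed through test functions, as E need not come from a
    measure. *)
Definition mean_tail_le (E : (V -> R) -> R) (L e : R) : Prop :=
  forall f : V -> R, bounded_continuous f -> (forall x, 0 <= f x <= 1) ->
    (forall x : V, (forall j, `|x ord0 j| <= L) -> f x = 0) -> E f <= e.

Lemma mean_tail_le_mono E (L L' e : R) : L <= L' ->
  mean_tail_le E L e -> mean_tail_le E L' e.
Proof.
move=> LL h f bf f01 f0; apply: h => // x hx; apply: f0 => j.
exact: le_trans (hx j) LL.
Qed.

(** The part of |f - g| which exceeds e, divided by 2 M, is a test function for the
    tail of E. *)
Lemma mean_dist_le E f g (M L e e' : R) : is_mean E -> 0 < M ->
  bounded_continuous f -> bounded_continuous g ->
  (forall x, `|f x| <= M) -> (forall x, `|g x| <= M) -> 0 <= e ->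
  (forall x : V, (forall j, `|x ord0 j| <= L) -> `|f x - g x| <= e) ->
  mean_tail_le E L e' -> `|E f - E g| <= e + 2 * M * e'.
Proof.
move=> hE M0 cf cg fM gM e0 hfg ht.
have cN (h : V -> R) : bounded_continuous h -> bounded_continuous (fun x => - h x).
  move=> ch; have -> : (fun x => - h x) = (fun x => -1 * h x + 0).
    by apply/funext => x; ring.
  exact: (bounded_continuous_lin _ ch (bounded_continuous_cst _ _)).
have EN (h : V -> R) : bounded_continuous h -> E (fun x => - h x) = - E h.
  move=> ch; have -> : (fun x => - h x) = (fun x => -1 * h x + 0).
    by apply/funext => x; ring.
  rewrite (mean_lin hE) ?(mean_cst hE) //; first by ring.
  exact: bounded_continuous_cst.
have EB (u v : V -> R) : bounded_continuous u -> bounded_continuous v ->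
    bounded_continuous (fun x => u x - v x) /\ E (fun x => u x - v x) = E u - E v.
  move=> cu cv; have -> : (fun x => u x - v x) = (fun x => 1 * u x + - v x).
    by apply/funext => x; ring.
  split; first by apply: bounded_continuous_lin => //; exact: cN.
  by rewrite (mean_lin hE) // ?mul1r ?EN //; exact: cN.
have [cr Er] := EB f g cf cg.
pose r x := `|f x - g x|.
have crn : bounded_continuous r by exact: bounded_continuous_norm.
pose q x := (2 * M)^-1 * Num.max (r x - e) 0 + 0.
have [cre _] := EB r (fun=> e) crn (bounded_continuous_cst _ e).
have cmax := bounded_continuous_max0 cre.
have cq : bounded_continuous q.
  by apply: bounded_continuous_lin => //; exact: bounded_continuous_cst.
have M2 : 0 < 2 * M by rewrite mulr_gt0.
have rM x : r x <= 2 * M.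
  by rewrite /r (le_trans (ler_normB _ _)) // mulr_natl mulr2n lerD.
have hq : E q <= e'.
  apply: ht => // x.
    rewrite /q addr0 mulrC; apply/andP; split.
      by rewrite divr_ge0 ?(ltW M2) // le_max lexx orbT.
    rewrite ler_pdivrMr // mul1r ge_max (ltW M2) andbT.
    by rewrite (le_trans _ (rM x)) // gerBl.
  move=> hx; rewrite /q addr0 (_ : Num.max _ _ = 0) ?mulr0 //.
  by apply/max_idPr; rewrite subr_le0; exact: hfg.
have hr x : r x <= 2 * M * q x + e.
  rewrite /q addr0 mulrA divff ?gt_eqF // mul1r -lerBlDr.
  by rewrite le_max lexx.
have cq2 : bounded_continuous (fun x => 2 * M * q x + e).
  by apply: bounded_continuous_lin => //; exact: bounded_continuous_cst.
have Ee : E (fun x => 2 * M * q x + e) <= e + 2 * M * e'.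
  rewrite (mean_lin hE) ?(mean_cst hE) //; last exact: bounded_continuous_cst.
  by rewrite addrC lerD2l ler_wpM2l // ltW.
rewrite ler_norml -Er; apply/andP; split; last first.
  apply: le_trans Ee; apply: (mean_le hE) => // x.
  by rewrite (le_trans _ (hr x)) // ler_norm.
rewrite lerNl -EN //; apply: le_trans Ee; apply: (mean_le hE) => //; first exact: cN.
by move=> x; rewrite (le_trans _ (hr x)) // /r -normrN ler_norm.
Qed.

(** Convergence is linear in the test function, hence holds for trigonometric
    polynomials, which approximate f on the box that carries almost all mass. *)
Theorem levy_continuity (En : nat -> (V -> R) -> R) (E : (V -> R) -> R) :
  (forall n, is_mean (En n)) -> is_mean E ->
  (forall e, 0 < e -> exists L, mean_tail_le E L e /\
     \forall n \near \oo, mean_tail_le (En n) L e) ->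
  (forall t c, En n (fun x => cos (dot t x + c)) @[n --> \oo] -->
     E (fun x => cos (dot t x + c))) ->
  forall f, bounded_continuous f -> En n f @[n --> \oo] --> E f.
Proof.
move=> hEn hE htight hcos f cf.
have htrig p : trig_poly p -> En n p @[n --> \oo] --> E p.
  elim=> [t c|a {}p q hp IHp hq IHq]; first exact: hcos.
  have -> : (fun n => En n (fun x => a * p x + q x)) = (fun n => a * En n p + En n q).
    by apply/funext => n; rewrite (mean_lin (hEn n)) //; exact: trig_bounded_continuous.
  rewrite (mean_lin hE); [|exact: trig_bounded_continuous..].
  by apply: cvgD => //; exact: cvgMr.
case: (cf) => cont [M0 hM0]; pose M := `|M0| + 1.
have M1 : 0 < M by rewrite ltr_wpDl.
have hM x : `|f x| <= M.
  by rewrite (le_trans (hM0 x)) // (le_trans (ler_norm _)) // lerDl.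
apply/cvgrPdist_le => e e0.
have e4 : 0 < e / 5 by rewrite divr_gt0.
have eM : 0 < e / 5 / (2 * M) by rewrite divr_gt0 // mulr_gt0.
have [L [tE tEn]] := htight _ eM.
pose L' := `|L| + 1.
have L0 : 0 < L' by rewrite ltr_wpDl.
have LL : L <= L' by rewrite (le_trans (ler_norm _)) // lerDl.
have [p [tp pM hp]] := trig_approximation cont hM L0 e4.
have hp' (x : V) : (forall j, `|x ord0 j| <= L) -> `|f x - p x| <= e / 5.
  by move=> hx; apply: hp => j; exact: le_trans (hx j) LL.
have cp := trig_bounded_continuous tp.
have eq5 : e / 5 + 2 * M * (e / 5 / (2 * M)) = 2 * (e / 5).
  by field; rewrite gt_eqF.
have dE := mean_dist_le hE M1 cf cp hM pM (ltW e4) hp' tE.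
rewrite eq5 in dE.
have /cvgrPdist_le/(_ _ e4) := htrig p tp.
apply: filterS2 tEn => n tn hn.
have dn := mean_dist_le (hEn n) M1 cf cp hM pM (ltW e4) hp' tn.
rewrite eq5 in dn.
have -> : E f - En n f = (E f - E p) + (E p - En n p) + (En n p - En n f) by ring.
rewrite (le_trans (ler_normD _ _)) // (le_trans (lerD (ler_normD _ _) (lexx _))) //.
rewrite distrC in dn.
have -> : e = 2 * (e / 5) + e / 5 + 2 * (e / 5) by field.
by rewrite !lerD.
Qed.

End Continuity.

(** * The cosine integrals of the normal law *)

(** The fundamental theorem of calculus on [-n, n], and dominated convergence. *)
Lemma integral_derivative_eq0 (R : realType) (H g : R -> R) :
  (forall x : R, is_derive x 1 H (g x)) -> continuous g ->
  (@lebesgue_measure R).-integrable setT (EFin \o g) ->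
  H n%:R @[n --> \oo] --> (0 : R) -> H (- n%:R) @[n --> \oo] --> (0 : R) ->
  \int[@lebesgue_measure R]_x g x = 0.
Proof.
move=> dH cg ig Hp Hm.
have HFTC n : (\int[@lebesgue_measure R]_(x in `[(- n.+1%:R)%R, n.+1%:R]) (g x)%:E =
    (H n.+1%:R - H (- n.+1%:R))%:E)%E.
  rewrite EFinB; apply: continuous_FTC2.
  - by rewrite (lt_trans (_ : _ < 0)) // oppr_lt0.
  - exact: continuous_subspaceT.
  - have cH : continuous H.
      by move=> x; apply/differentiable_continuous/derivable1_diffP; case: (dH x).
    split; first by move=> x _; case: (dH x).
    + exact/cvg_at_right_filter/cH.
    + exact/cvg_at_left_filter/cH.
  - by move=> x _; rewrite derive1E; case: (dH x).
have mg : measurable_fun setT g by exact: continuous_measurable_fun.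
pose A n : set R := `[(- n.+1%:R)%R, n.+1%:R]%classic.
have mA n : measurable (A n) by exact: measurable_itv.
have mf n : measurable_fun setT ((EFin \o g) \_ (A n)).
  apply/(measurable_restrictT _ (mA n)).
  by apply: measurable_funTS; exact/measurable_EFinP.
have mf_cv : {ae @lebesgue_measure R, forall x, setT x ->
    (fun n => ((EFin \o g) \_ (A n)) x) @ \oo --> (EFin \o g) x}.
  apply: aeW => x _; apply: cvg_near_cst.
  have [N _ HN] := nbhs_infty_ger `|x|.
  exists N => // n /= Nn; rewrite patchE mem_set // /A /= in_itv /= -ler_norml.
  by apply: le_trans (HN _ Nn) _; rewrite ler_nat.
have mf_le : {ae @lebesgue_measure R, forall x n, setT x ->
    (`|((EFin \o g) \_ (A n)) x| <= `|(EFin \o g) x|)%E}.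
  apply: aeW => x n _; rewrite patchE; case: ifP => // _.
  by rewrite (_ : point = 0%E) // abse0 abse_ge0.
have [_ _ hcv] := @dominated_convergence _ _ _ (@lebesgue_measure R) setT measurableT
  (fun n => (EFin \o g) \_ (A n)) (EFin \o g) (fun x => `|(EFin \o g) x|%E)
  mf (iffRL (measurable_EFinP _ _) mg) mf_cv (integrable_abse ig) mf_le.
have hcv' : (H n.+1%:R - H (- n.+1%:R))%:E @[n --> \oo] -->
    (\int[@lebesgue_measure R]_x (EFin \o g) x)%E.
  move: hcv; apply: cvg_trans; apply: near_eq_cvg; near=> n.
  by rewrite -HFTC [RHS]integral_mkcond.
have h0 : (H n.+1%:R - H (- n.+1%:R)) @[n --> \oo] --> (0 - 0 : R).
  apply: cvgB.
    by rewrite (cvg_shiftS (fun n => H n%:R)).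
  by rewrite (cvg_shiftS (fun n => H (- n%:R))).
rewrite /Rintegral -(cvg_lim _ hcv') //.
rewrite subr0 in h0.
have h1 : (H n.+1%:R - H (- n.+1%:R))%:E @[n --> \oo] --> (0 : R)%:E.
  by apply/fine_cvgP; split; [exact: nearW | exact: h0].
by rewrite (cvg_lim _ h1).
Unshelve. all: by end_near.
Qed.

Section GaussianCharacteristicFunction.
Variable R : realType.
Local Notation mu := (@lebesgue_measure R).
Variable sigma : R.
Hypothesis sigma0 : sigma != 0.
Local Notation w := (normal_pdf 0 sigma).

Let pdfE (s x : R) : s != 0 ->
  normal_pdf 0 s x = normal_peak s * expR (- (x ^+ 2 / (2 * s ^+ 2))).
Proof. by move=> s0; rewrite normal_pdfE // /normal_fun subr0 mulNr mulr_natl. Qed.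

Let wE x : w x = normal_peak sigma * expR (- (x ^+ 2 / (2 * sigma ^+ 2))).
Proof. exact: pdfE. Qed.

Let sig2_gt0 : 0 < sigma ^+ 2.
Proof. by rewrite exprn_even_gt0. Qed.

Lemma normal_prob_integral (f : R -> R) (M : R) : measurable_fun setT f ->
  (forall x, `|f x| <= M) ->
  \int[normal_prob 0 sigma]_x f x = \int[mu]_x (f x * w x).
Proof.
move=> mf fM; rewrite /Rintegral; congr fine.
have intf : (normal_prob 0 sigma).-integrable setT (EFin \o f).
  apply: (@le_integrable _ _ _ _ _ _ _ (cst M%:E)) => //.
  - exact/measurable_EFinP.
  - by move=> x _ /=; rewrite lee_fin (le_trans (fM x)) // ler_norm.
  - by apply: finite_measure_integrable_cst.
under [RHS]eq_integral do rewrite EFinM.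
rewrite -(Radon_Nikodym_change_of_variables (normal_prob_dominates 0 sigma)) //.
apply: ae_eq_integral => //.
- apply: emeasurable_funM => //; first exact/measurable_EFinP.
  apply: (measurable_int mu).
  by apply: Radon_Nikodym_integrable; exact: normal_prob_dominates.
- apply: emeasurable_funM => //; first exact/measurable_EFinP.
  by apply/measurable_EFinP; exact: measurable_normal_pdf.
- apply: ae_eqe_mul2l => /=.
  rewrite Radon_NikodymE //=; first exact: normal_prob_dominates.
  move=> dom; case: cid => /= h [h1 h2 h3].
  apply: integral_ae_eq => //=.
  + by apply/measurable_EFinP; exact: measurable_normal_pdf.
  + by move=> E E01 mE; rewrite -h3.
Qed.

(** A multiple of the normal density of twice the variance dominates |x| w(x). *)
Let absx_le x : `|x| * expR (- (x ^+ 2 / (2 * sigma ^+ 2))) <=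
  2 * `|sigma| * expR (- (x ^+ 2 / (2 * (Num.sqrt 2 * sigma) ^+ 2))).
Proof.
rewrite exprMn sqr_sqrtr //.
set y := x / sigma.
have s0 : 0 < `|sigma| by rewrite normr_gt0.
have -> : x ^+ 2 / (2 * sigma ^+ 2) = y ^+ 2 / 4 + y ^+ 2 / 4.
  by rewrite /y; field.
have -> : x ^+ 2 / (2 * (2 * sigma ^+ 2)) = y ^+ 2 / 4 by rewrite /y; field.
rewrite opprD expRD mulrA ler_wpM2r ?expR_ge0 //.
have -> : `|x| = `|sigma| * `|y|.
  by rewrite /y normrM normfV mulrCA divff ?gt_eqF // mulr1.
rewrite [2 * _]mulrC -mulrA ler_wpM2l //.
have h : 1 + y ^+ 2 / 4 <= expR (y ^+ 2 / 4) by exact: expR_ge1Dx.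
rewrite expRN ler_pdivrMr ?expR_gt0 //.
apply: (@le_trans _ _ (2 * (1 + y ^+ 2 / 4))); last by rewrite ler_wpM2l.
rewrite -[y ^+ 2]real_normK ?num_real //.
have : 0 <= (`|y| - 1) ^+ 2 by exact: sqr_ge0.
rewrite sqrrB; lra.
Qed.

Let integrable_w : mu.-integrable setT (EFin \o w).
Proof. exact: integrable_normal_pdf. Qed.

Let measurable_w : measurable_fun setT w.
Proof. exact: measurable_normal_pdf. Qed.

Let w_ge0 x : 0 <= w x. Proof. exact: normal_pdf_ge0. Qed.

Let sqrt2_neq0 : Num.sqrt 2 * sigma != 0.
Proof. by rewrite mulf_neq0 // gt_eqF // sqrtr_gt0. Qed.

Let integrable_absx_w : mu.-integrable setT (EFin \o (fun x => `|x| * w x)).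
Proof.
pose c := 2 * `|sigma| * normal_peak sigma / normal_peak (Num.sqrt 2 * sigma).
have := integrableZl measurableT c (integrable_normal_pdf 0 (Num.sqrt 2 * sigma)).
apply: le_integrable => //.
- apply/measurable_EFinP; apply: measurable_funM => //.
- move=> x _ /=; rewrite lee_fin.
  have h0 : 0 <= `|x| * w x by exact: mulr_ge0.
  rewrite (ger0_norm h0) (ger0_norm (_ : 0 <= c * _)); last first.
    rewrite mulr_ge0 ?normal_pdf_ge0 // divr_ge0 ?normal_peak_ge0 //.
    by rewrite !mulr_ge0 ?normal_peak_ge0.
  rewrite wE (pdfE _ sqrt2_neq0) /c mulrCA.
  set E := expR (- (x ^+ 2 / (2 * (Num.sqrt 2 * sigma) ^+ 2))).
  have k0 : normal_peak (Num.sqrt 2 * sigma) != 0 :> R.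
    by rewrite gt_eqF // normal_peak_gt0.
  have -> : 2 * `|sigma| * normal_peak sigma / normal_peak (Num.sqrt 2 * sigma) *
     (normal_peak (Num.sqrt 2 * sigma) * E) =
     normal_peak sigma * (2 * `|sigma| * E).
    by field.
  apply: ler_wpM2l; [exact: normal_peak_ge0 | exact: absx_le].
Qed.

Let cosarg t c x : R := cos (t * x + c).
Let sinarg t c x : R := sin (t * x + c).

Let measurable_cosarg t c : measurable_fun setT (cosarg t c).
Proof.
apply: measurableT_comp; first exact: continuous_measurable_fun (@continuous_cos R).
by apply: measurable_funD => //; exact: measurable_funM.
Qed.

Let measurable_sinarg t c : measurable_fun setT (sinarg t c).
Proof.
apply: measurableT_comp; first exact: continuous_measurable_fun (@continuous_sin R).
by apply: measurable_funD => //; exact: measurable_funM.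
Qed.

Let integrable_bounded_w (h : R -> R) : measurable_fun setT h ->
  (forall x, `|h x| <= 1) -> mu.-integrable setT (EFin \o (fun x => h x * w x)).
Proof.
move=> mh h1; apply: le_integrable integrable_w => //.
- by apply/measurable_EFinP; exact: measurable_funM.
- move=> x _ /=; rewrite lee_fin normrM (ger0_norm (w_ge0 x)); apply: ler_piMl => //; exact: h1.
Qed.

Let integrable_bounded_xw (h : R -> R) : measurable_fun setT h ->
  (forall x, `|h x| <= 1) ->
  mu.-integrable setT (EFin \o (fun x => x * h x * w x)).
Proof.
move=> mh h1; apply: le_integrable integrable_absx_w => //.
- by apply/measurable_EFinP; do 2! apply: measurable_funM => //.
- move=> x _ /=; rewrite lee_fin !normrM normr_id ler_wpM2r // ler_piMr //.
Qed.

Let cos1 t c x : `|cosarg t c x| <= 1.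
Proof. by rewrite ler_norml cos_geN1 cos_le1. Qed.

Let sin1 t c x : `|sinarg t c x| <= 1.
Proof. by rewrite ler_norml sin_geN1 sin_le1. Qed.

Let dw (x : R) : is_derive x 1 w (- (x / sigma ^+ 2) * w x).
Proof.
have -> : w = (fun x => normal_peak sigma * expR (- (x ^+ 2 / (2 * sigma ^+ 2)))).
  by apply/funext => y; rewrite wE.
apply: is_derive_eq.
by rewrite /GRing.scale /=; field.
Qed.

(** Stein's identity: the integrand is the derivative of sin (t x + c) times the
    density. *)
Let stein t c :
  \int[mu]_x (t * cosarg t c x * w x - x / sigma ^+ 2 * sinarg t c x * w x) = 0.
Proof.
pose g x := t * cosarg t c x * w x - x / sigma ^+ 2 * sinarg t c x * w x.
pose H x := sinarg t c x * w x.
have dH (x : R) : is_derive x 1 H (g x).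
  have dsin : is_derive x 1 (sinarg t c) (t * cosarg t c x).
    apply: is_derive_eq.
    by rewrite /GRing.scale /= /cosarg; ring.
  have dwx := dw x.
  apply: is_derive_eq.
  by rewrite /GRing.scale /= /g; ring.
have cw : continuous w.
  by move=> x; apply/differentiable_continuous/derivable1_diffP; case: (dw x).
have cH : continuous H.
  by move=> x; apply/differentiable_continuous/derivable1_diffP; case: (dH x).
have cg : continuous g.
  move=> x; apply: cvgB.
    apply: cvgM; last exact: cw.
    apply: cvgM; first exact: cvg_cst.
    apply: continuous_comp; last exact: continuous_cos.
    by apply: cvgD; [apply: cvgM; [exact: cvg_cst|exact: cvg_id]|exact: cvg_cst].
  apply: cvgM; last exact: cw.
  apply: cvgM; first by apply: cvgM; [exact: cvg_id|exact: cvg_cst].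
  apply: continuous_comp; last exact: continuous_sin.
  by apply: cvgD; [apply: cvgM; [exact: cvg_cst|exact: cvg_id]|exact: cvg_cst].
pose C := 2 * `|sigma| * normal_peak sigma.
have Hle x : x != 0 -> `|H x| <= C / `|x|.
  move=> x0; rewrite ler_pdivlMr ?normr_gt0 // /H normrM (ger0_norm (w_ge0 x)).
  apply: (@le_trans _ _ (w x * `|x|)).
    by rewrite ler_wpM2r //; apply: ler_piMl.
  rewrite mulrC wE /C mulrCA [leRHS]mulrC.
  apply: ler_wpM2l; first exact: normal_peak_ge0.
  apply: le_trans (absx_le x) _; apply: ler_piMr; first exact: mulr_ge0.
  rewrite -[leRHS]expR0 ler_expR oppr_le0.
  by apply: divr_ge0; [exact: sqr_ge0 | apply: mulr_ge0 => //; exact: sqr_ge0].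
apply: (@integral_derivative_eq0 _ H g dH cg).
- have i1 := integrableZl measurableT t (integrable_bounded_w (measurable_cosarg t c) (@cos1 t c)).
  have i2 := integrableZl measurableT (sigma ^- 2)
    (integrable_bounded_xw (measurable_sinarg t c) (@sin1 t c)).
  have := integrableB measurableT i1 i2; apply: eq_integrable => // x _ /=.
  by rewrite -EFinM -EFinB; congr EFin; rewrite /g; ring.
- apply: (@squeeze_cvgr _ _ _ _ (fun n => - (C / n%:R)) (fun n => C / n%:R)).
  + exists 1%N => // n /= n0; rewrite -ler_norml.
    have n0' : n%:R != 0 :> R by rewrite pnatr_eq0 -lt0n.
    by rewrite (le_trans (Hle _ n0')) // normr_nat.
  + by rewrite -oppr0; apply: cvgN; exact: cvg0_cst_div.
  + exact: cvg0_cst_div.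
- apply: (@squeeze_cvgr _ _ _ _ (fun n => - (C / n%:R)) (fun n => C / n%:R)).
  + exists 1%N => // n /= n0; rewrite -ler_norml.
    have n0' : - n%:R != 0 :> R by rewrite oppr_eq0 pnatr_eq0 -lt0n.
    by rewrite (le_trans (Hle _ n0')) // normrN normr_nat.
  + by rewrite -oppr0; apply: cvgN; exact: cvg0_cst_div.
  + exact: cvg0_cst_div.
Qed.

Let F c t := \int[mu]_x (cosarg t c x * w x).

Let dF c (t : R) : is_derive t 1 (F c) (- (sigma ^+ 2 * t * F c t)).
Proof.
pose f (t x : R) := cosarg t c x * w x.
have df (t0 x : R) : is_derive t0 1 (f ^~ x) (- (x * sinarg t0 c x * w x)).
  apply: is_derive_eq.
  by rewrite /GRing.scale /= /sinarg; ring.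
pose G x := `|x| * w x.
have It : `]t - 1, t + 1[%classic t by rewrite /= in_itv /= ltrBlDr ltrDl ltr01.
have intf (z : R) : `]t - 1, t + 1[%classic z -> mu.-integrable setT (EFin \o f z).
  by move=> _; apply: integrable_bounded_w; [exact: measurable_cosarg | exact: cos1].
have derf (z y : R) : `]t - 1, t + 1[%classic z -> setT y -> derivable (f ^~ y) z 1.
  by move=> _ _; case: (df z y).
have Gub (z y : R) : `]t - 1, t + 1[%classic z -> setT y -> `|partial1of2 f z y| <= G y.
  move=> _ _; rewrite partial1of2E (@derive_val _ _ _ _ _ _ _ (df z y)).
  by rewrite normrN !normrM (ger0_norm (w_ge0 y)) ler_wpM2r // ler_piMr.
have G0 y : 0 <= G y by exact: mulr_ge0.
have hd := derivable_under_integral measurableT It intf derf G0 integrable_absx_w Gub.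
have hv := differentiation_under_integral measurableT It intf derf G0 integrable_absx_w Gub.
apply: DeriveDef; first exact: hd.
rewrite -derive1E hv.
have -> : \int[mu]_y partial1of2 f t y = \int[mu]_y (- (y * sinarg t c y * w y)).
  by apply: eq_Rintegral => y _; rewrite partial1of2E (@derive_val _ _ _ _ _ _ _ (df t y)).
have i1 := integrable_bounded_w (measurable_cosarg t c) (@cos1 t c).
have i2 := integrable_bounded_xw (measurable_sinarg t c) (@sin1 t c).
have st : t * F c t - sigma ^- 2 * (\int[mu]_x (x * sinarg t c x * w x)) = 0.
  rewrite -[RHS](stein t c) /F -!RintegralZl // -RintegralB //.
  - by apply: eq_Rintegral => x _; ring.
  - exact: (integrableZl measurableT t i1).
  - exact: (integrableZl measurableT (sigma ^- 2) i2).
have -> : \int[mu]_y (- (y * sinarg t c y * w y)) =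
    - (\int[mu]_x (x * sinarg t c x * w x)).
  under eq_Rintegral do rewrite -mulN1r.
  by rewrite RintegralZl // mulN1r.
move/eqP: st; rewrite subr_eq0 => /eqP st.
have -> : \int[mu]_x (x * sinarg t c x * w x) =
    sigma ^+ 2 * (sigma ^- 2 * (\int[mu]_x (x * sinarg t c x * w x))).
  by rewrite mulrA divff ?mul1r // gt_eqF.
by rewrite -st mulrA.
Qed.

Let F_at0 c : F c 0 = cos c.
Proof.
rewrite /F.
have -> : \int[mu]_x (cosarg 0 c x * w x) = \int[mu]_x (cos c * w x).
  by apply: eq_Rintegral => x _; rewrite /cosarg mul0r add0r.
by rewrite RintegralZl // /Rintegral integral_normal_pdf mulr1.
Qed.

(** By Stein's identity, the integral F solves F' = - sigma^2 t F with F(0) = cos c. *)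
Lemma normal_characteristic (t c : R) :
  \int[normal_prob 0 sigma]_x cos (t * x + c) =
  cos c * expR (- (sigma ^+ 2 * t ^+ 2 / 2)).
Proof.
rewrite (normal_prob_integral (measurable_cosarg t c) (@cos1 t c)).
pose E (u : R) := F c u * expR (sigma ^+ 2 * u ^+ 2 / 2).
have dE (u : R) : is_derive u 1 E 0.
  have := dF c u => dFu.
  apply: is_derive_eq.
  by rewrite /GRing.scale /=; field.
have := is_derive_0_is_cst t 0 dE.
rewrite /E F_at0 expr0n /= mulr0 mul0r expR0 mulr1 => <-.
by rewrite -[RHS]mulrA -expRD subrr expR0 mulr1.
Qed.

End GaussianCharacteristicFunction.

(** * Borel laws on row vectors *)

Lemma Rintegral_prob_cst (d0 : measure_display) (T : measurableType d0) (R : realType)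
  (P : probability T R) (c : R) : \int[P]_w c = c.
Proof. by have := expectation_cst P c; rewrite unlock /Rintegral => ->. Qed.

Lemma bounded_integrable (d0 : measure_display) (T : measurableType d0) (R : realType)
  (P : probability T R) (f : T -> R) (M : R) : measurable_fun setT f ->
  (forall x, `|f x| <= M) -> P.-integrable setT (EFin \o f).
Proof.
move=> mf hM; apply: (@le_integrable _ _ _ _ _ _ _ (cst M%:E)) => //.
- exact/measurable_EFinP.
- by move=> w _ /=; rewrite lee_fin (le_trans (hM _)) // ler_norm.
- exact: finite_measure_integrable_cst.
Qed.

Lemma Rintegral_distribution (d1 d2 : measure_display) (T1 : measurableType d1)
  (T2 : measurableType d2) (R : realType) (P : probability T1 R)
  (X : {mfun T1 >-> T2}) (f : T2 -> R) (M : R) : measurable_fun setT f ->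
  (forall x, `|f x| <= M) ->
  \int[distribution P X]_x f x = \int[P]_w f (X w).
Proof.
move=> mf hM; congr fine; apply: integral_distribution.
  exact/measurable_EFinP.
apply: (@bounded_integrable _ _ _ _ (fun w => f (X w)) M) => //.
exact: measurableT_comp.
Qed.

Lemma dotZl (R : realType) (d : nat) (a : R) (t x : 'rV[R]_d) :
  dot (a *: t) x = a * dot t x.
Proof. by rewrite !dotE mulr_sumr; apply: eq_bigr => j _; rewrite mxE mulrCA. Qed.

Lemma quad_dot (R : realType) (d : nat) (t u : 'rV[R]_d) :
  (t *m (u^T *m u) *m t^T) ord0 ord0 = dot t u ^+ 2.
Proof.
rewrite mulmxA -mulmxA mxE big_ord1 expr2; congr (_ * _).
by rewrite dotE mxE; apply: eq_bigr => j _; rewrite mxE mulrC.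
Qed.

Section BorelMeasurability.
Variables (R : realType) (d : nat).
Local Notation V := 'rV[R]_d.

Let box (i : 'rV[rat]_d * rat) : set V :=
  [set x : V | forall j, `|x ord0 j - ratr (i.1 ord0 j)| < ratr i.2].

Let open_box_cover (O : set V) : open O ->
  O = \bigcup_(i in [set i | box i `<=` O]) box i.
Proof.
move=> oO; apply/seteqP; split; last by move=> x [i /= + ix]; apply.
move=> x Ox; have /nbhs_ballP [e /= e0 he] : nbhs x O by exact: open_nbhs_nbhs.
have [r] : exists r : rat, ratr r \in `]0, e / 2[.
  by apply: rat_in_itvoo; rewrite divr_gt0.
case/andP => r0 r1; rewrite !bnd_simp in r0 r1.
have /choice[c hc] (j : 'I_d) : exists c : rat, `|x ord0 j - ratr c| < ratr r.
  have [c] : exists c : rat, ratr c \in `](x ord0 j - ratr r), (x ord0 j + ratr r)[.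
    by apply: rat_in_itvoo; rewrite ltrBlDr -addrA ltrDl addr_gt0.
  rewrite in_itv /= => /andP[h1 h2]; exists c.
  by rewrite ltr_distl; apply/andP; split; lra.
exists (\row_j c j, r) => /=; last by move=> j /=; rewrite mxE.
move=> y hy; apply: he; split => // i j; rewrite ord1.
have := hc j; have := hy j; rewrite /= mxE => h1 h2.
rewrite /ball /= (_ : _ - _ = (x ord0 j - ratr (c j)) - (y ord0 j - ratr (c j))); last by ring.
rewrite (le_lt_trans (ler_normB _ _)) //; lra.
Qed.

(** The rational boxes form a countable base of the topology, so that the
    coordinates generate the Borel sets. *)
Lemma measurable_rV (d0 : measure_display) (T : measurableType d0) (Z : T -> V) :
  (forall j, measurable_fun setT (fun w => Z w ord0 j)) ->
  measurable_fun setT (Z : T -> borel_rV R d).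
Proof.
move=> mZ; apply: (@measurability _ _ _ (borel_rV R d) setT Z (@open V)) => //.
move=> _ [ O oO <-]; rewrite setTI (open_box_cover oO) preimage_bigcup.
rewrite bigcup_mkcond; apply: countable_bigcupT_measurable => [|i].
  exact: countableP.
case: ifP => // _.
rewrite (_ : _ @^-1` _ = \bigcap_(j in [set: 'I_d])
   ((fun w => Z w ord0 j) @^-1` (ball (ratr (i.1 ord0 j) : R) (ratr i.2)))).
  apply: fin_bigcap_measurable => // j _.
  rewrite -[X in measurable X]setTI; apply: mZ => //; exact: measurable_ball.
apply/seteqP; split => w /=.
  by move=> h j _; rewrite /ball /= distrC; exact: h.
by move=> h j; have := h j I; rewrite /ball /= distrC.
Qed.

Lemma continuous_measurable_rV (f : V -> R) : continuous f ->
  measurable_fun setT (f : borel_rV R d -> R).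
Proof.
move=> /continuousP cf.
apply: (measurability _ (RGenOpens.measurableE R)) => _ [_ [a [b ->]] <-].
rewrite setTI; apply: sub_sigma_algebra; apply: cf; exact: interval_open.
Qed.

Lemma measurable_coord (j : 'I_d) :
  measurable_fun setT (fun x : borel_rV R d => (x : V) ord0 j).
Proof. apply: continuous_measurable_rV; exact: coord_continuous. Qed.

Section ImageMean.
Variables (d0 : measure_display) (T : measurableType d0) (P : probability T R).
Variable Z : T -> V.
Hypothesis mZ : forall j, measurable_fun setT (fun w => Z w ord0 j).

Let E (f : V -> R) := \int[P]_w f (Z w).

Lemma measurable_comp_rV (f : V -> R) : continuous f ->
  measurable_fun setT (fun w => f (Z w)).
Proof.
move=> cf; have := measurableT_comp (continuous_measurable_rV cf) (measurable_rV mZ).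
by [].
Qed.

Lemma integrable_bounded_continuous f : bounded_continuous f ->
  P.-integrable setT (EFin \o (fun w => f (Z w))).
Proof.
move=> [cf [M hM]]; apply: (bounded_integrable _ _ (fun w => hM (Z w))).
exact: measurable_comp_rV.
Qed.

Lemma image_is_mean : is_mean E.
Proof.
split => [a f g bf bg|f g bf bg fg|c]; rewrite /E.
- have i1 := integrable_bounded_continuous bf.
  have i2 := integrable_bounded_continuous bg.
  rewrite -RintegralZl // -RintegralD //; exact: (integrableZl measurableT a i1).
- by apply: le_Rintegral => //; exact: integrable_bounded_continuous.
- exact: Rintegral_prob_cst.
Qed.

(** The boxes of side n exhaust the space, by continuity from below their
    probabilities tend to 1. *)
Lemma image_tail (e : R) : 0 < e -> exists L, mean_tail_le E L e.
Proof.
move=> e0.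
pose B n : set T := \bigcap_(j in [set: 'I_d]) [set w | `|Z w ord0 j| <= n%:R].
have mB n : measurable (B n).
  apply: fin_bigcap_measurable => // j _.
  rewrite -[X in measurable X]setTI.
  by apply: measurable_fun_le => //; apply: measurableT_comp.
have UB : \bigcup_n B n = setT.
  apply/seteqP; split => // w _.
  have [N _ hN] := nbhs_infty_ger (\sum_j `|Z w ord0 j|).
  exists N => // j _ /=; apply: le_trans (hN N (leqnn N)).
  by rewrite (bigD1 j) //= lerDl sumr_ge0.
have : P (B n) @[n --> \oo] --> P (\bigcup_n B n).
  apply: nondecreasing_cvg_mu => //.
    by rewrite UB; exact: measurableT.
  move=> m n mn; apply/subsetPset => w hw j _; apply: le_trans (hw j I) _.
  by rewrite ler_nat.
rewrite UB probability_setT => hc.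
have [N _ hN] : \forall n \near \oo, 1 - e <= fine (P (B n)).
  move/fine_cvgP : hc => [_ /cvgr_ge]; apply.
  by rewrite gtrBl.
exists N%:R => f bf f01 f0.
have hB := hN N (leqnn N).
have mN : measurable (~` B N) by exact: measurableC.
apply: (@le_trans _ _ (\int[P]_w \1_(~` B N) w)).
  apply: le_Rintegral => //.
  - exact: integrable_bounded_continuous.
  - exact: integrable_indic.
  - move=> w _; have [wB|wB] := pselect (B N w).
      by rewrite f0 // => j; exact: (wB j I).
    by rewrite indicE mem_set //; case/andP: (f01 (Z w)).
rewrite /Rintegral integral_indic //= setIT probability_setC //.
have fP : (P (B N) \is a fin_num)%E by exact: fin_num_measure.
by rewrite -(fineK fP) -EFinB /=; move: hB => /=; lra.
Qed.

End ImageMean.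
End BorelMeasurability.

(** * The Gaussian limit law *)

Section NormalLaws.
Variable R : realType.

(** By [levy_continuity] for a constant sequence, the two laws give the same
    integrals to all bounded continuous functions, hence the same measures to
    all rays. *)
Lemma law_eq_of_cos (m1 m2 : probability (measurableTypeR R) R) :
  (forall t c : R, \int[m1]_x cos (t * x + c) = \int[m2]_x cos (t * x + c)) ->
  forall A : set R, measurable A -> m1 A = m2 A.
Proof.
move=> h12.
pose Z (x : R) : 'rV[R]_1 := const_mx x.
have mZ (j : 'I_1) : measurable_fun setT (fun x : R => Z x ord0 j).
  rewrite (_ : (fun x => _) = id) //; by apply/funext => x; rewrite mxE.
pose E (m : probability (measurableTypeR R) R) (f : 'rV[R]_1 -> R) := \int[m]_x f (Z x).
have E12 f : bounded_continuous f -> E m1 f = E m2 f.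
  move=> bf.
  have : E m1 f @[_ --> \oo] --> E m2 f.
    apply: (@levy_continuity R 1 (fun _ => E m1) (E m2) _ _ _ _ f bf) => [_||e e0|t c].
    - exact: image_is_mean.
    - exact: image_is_mean.
    - have [L1 h1] := image_tail m1 mZ e0; have [L2 h2] := image_tail m2 mZ e0.
      exists (Num.max L1 L2); split.
        by apply: mean_tail_le_mono h2; rewrite le_max lexx orbT.
      by apply: nearW => _; apply: mean_tail_le_mono h1; rewrite le_max lexx.
    - have h (m : probability (measurableTypeR R) R) : E m (fun x => cos (dot t x + c)) =
          \int[m]_x cos (t ord0 ord0 * x + c).
        apply: eq_Rintegral => x _; rewrite dotE big_ord1 !mxE.
        by rewrite mulrC.
      by rewrite !h h12; exact: cvg_cst.
  by move/cvg_lim => <- //; rewrite lim_cst.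
(* continuous functions increasing to the indicator of the ray below a *)
pose g (a : R) k (x : R) : R := Num.min 1 (Num.max 0 (k%:R * (a - x))).
have cg a k : continuous (g a k).
  have h1 : continuous (fun x : R => k%:R * (a - x)).
    move=> x; apply: cvgM; first exact: cvg_cst.
    by apply: cvgB; [exact: cvg_cst | exact: cvg_id].
  move=> x; apply: (@continuous_min _ _ (fun=> 1) (fun x => Num.max 0 (k%:R * (a - x)))).
    exact: cst_continuous.
  apply: (@continuous_max _ _ (fun=> 0) (fun x => k%:R * (a - x))).
    exact: cst_continuous.
  exact: h1.
have g01 a k x : 0 <= g a k x <= 1.
  by rewrite /g le_min ler01 le_max lexx /= ge_min lexx.
have gE a k (m : probability (measurableTypeR R) R) :
    \int[m]_x g a k x = E m (fun y => g a k (y ord0 ord0)).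
  by apply: eq_Rintegral => x _; rewrite mxE.
have g12 a k : \int[m1]_x g a k x = \int[m2]_x g a k x.
  rewrite !gE; apply: E12; split.
    move=> y; apply: (continuous_comp (f := fun y : 'rV[R]_1 => y ord0 ord0)).
      exact: coord_continuous.
    exact: cg.
  by exists 1 => y; case/andP: (g01 a k (y ord0 ord0)) => h0 h1; rewrite ger0_norm.
have gcv a (m : probability (measurableTypeR R) R) :
    \int[m]_x g a k x @[k --> \oo] --> fine (m `]-oo, a[%classic).
  have mg k : measurable_fun setT (EFin \o g a k).
    by apply/measurable_EFinP; apply: continuous_measurable_fun; exact: cg.
  have mr : measurable (`]-oo, a[%classic : set (measurableTypeR R)) by exact: measurable_itv.
  have m1r : measurable_fun setT (EFin \o (\1_(`]-oo, a[%classic) : measurableTypeR R -> R)).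
    by apply/measurable_EFinP; exact: measurable_indic.
  have cvr : {ae m, forall x, setT x -> (fun k => (EFin \o g a k) x) @ \oo -->
      (EFin \o (\1_(`]-oo, a[%classic) : measurableTypeR R -> R)) x}.
    apply: aeW => x _; apply: cvg_near_cst.
    have [xa|xa] := ltP x a; last first.
      apply: nearW => k; rewrite /= indicE memNset /=; last by rewrite in_itv /= ltNge xa.
      rewrite /g max_l ?min_r // ?ler01 //; rewrite mulr_ge0_le0 // subr_le0 //.
    have ax : 0 < a - x by rewrite subr_gt0.
    have [N _ hN] := nbhs_infty_ger ((a - x)^-1).
    exists N => // k Nk /=; rewrite indicE mem_set /= ?in_itv //=.
    have h1 : 1 <= k%:R * (a - x).
      by rewrite -ler_pdivrMr // div1r; apply: le_trans (hN _ Nk).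
    by rewrite /g max_r ?min_l // (le_trans ler01).
  have bnd : {ae m, forall x k, setT x -> (`|(EFin \o g a k) x| <= (cst 1%:E) x)%E}.
    apply: aeW => x k _; rewrite /= lee_fin.
    by case/andP: (g01 a k x) => h0 h1; rewrite ger0_norm.
  have i1 : m.-integrable setT (cst 1%:E : measurableTypeR R -> \bar R).
    exact: finite_measure_integrable_cst.
  have [_ _] := @dominated_convergence _ _ _ m setT measurableT (fun k => EFin \o g a k)
    (EFin \o (\1_(`]-oo, a[%classic) : measurableTypeR R -> R)) (cst 1%:E)
    mg m1r cvr i1 bnd.
  rewrite integral_indic // setIT => hc.
  apply: fine_cvg; rewrite fineK //; exact: fin_num_measure.
have ray a : m1 `]-oo, a[%classic = m2 `]-oo, a[%classic.
  have h1 := gcv a m1; have h2 := gcv a m2.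
  have h : fine (m1 `]-oo, a[%classic) = fine (m2 `]-oo, a[%classic).
    have h1' : \int[m2]_x g a k x @[k --> \oo] --> fine (m1 `]-oo, a[%classic).
      by under eq_fun do rewrite -g12.
    by rewrite -(cvg_lim _ h1') // (cvg_lim _ h2).
  by rewrite -[LHS]fineK ?fin_num_measure // h fineK // fin_num_measure.
move=> A mA.
apply: (@measure_unique _ R (measurableTypeR R) (@RGenInftyO.G R)
  (fun n => `]-oo, n%:R[%classic) _ _ _ _ m1 m2 _ _ A mA).
- exact: RGenInftyO.measurableE.
- move=> _ _ [x ->] [y ->]; exists (Num.min x y).
  by apply/seteqP; split => z; rewrite /= !in_itv /= lt_min => /andP.
- by move=> n; exists n%:R.
- apply/seteqP; split => // x _.
  have [N _ hN] := nbhs_infty_gtr x.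
  by exists N => //=; rewrite in_itv /=; apply: hN => /=.
- by move=> _ [x ->]; exact: ray.
- by move=> k; rewrite -ge0_fin_numE // fin_num_measure.
Qed.

(** Independent standard normal coordinates, added one at a time, produce a
    vector whose characteristic function is that of the centered normal law with
    covariance the sum of the squares of the given vectors. *)
Lemma gaussian_combination (d : nat) (us : seq 'rV[R]_d) :
  exists (d1 : measure_display) (T1 : measurableType d1) (P1 : probability T1 R)
    (Y : T1 -> 'rV[R]_d),
    (forall j, measurable_fun setT (fun w => Y w ord0 j)) /\
    forall t c, \int[P1]_w cos (dot t (Y w) + c) =
      cos c * expR (- ((\sum_(u <- us) dot t u ^+ 2) / 2)).
Proof.
elim: us => [|u us [d1 [T1 [P1 [Y [mY hY]]]]]].
  exists _, (measurableTypeR R), (normal_prob 0 1), (fun=> 0); split => //.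
  move=> t c; rewrite big_nil mul0r oppr0 expR0 mulr1.
  rewrite Rintegral_prob_cst.
  by rewrite /dot mul0mx mxE add0r.
pose N01 : probability (measurableTypeR R) R := normal_prob 0 1.
exists _, (T1 * measurableTypeR R)%type, (P1 \x N01)%E.
exists (fun w => Y w.1 + w.2 *: u).
have mY' j : @measurable_fun _ _ (T1 * measurableTypeR R)%type _ setT
    (fun w => (Y w.1 + w.2 *: u) ord0 j).
  under eq_fun do rewrite !mxE.
  apply: measurable_funD; first exact: (measurableT_comp (mY j)).
  exact: measurable_funM.
split => // t c.
pose PP : probability (T1 * measurableTypeR R)%type R := (P1 \x N01)%E.
pose f (w : T1 * measurableTypeR R) := cos (dot t (Y w.1 + w.2 *: u) + c).
have intf : (P1 \x N01)%E.-integrable setT (EFin \o f).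
  have h := @integrable_bounded_continuous R d _ (T1 * measurableTypeR R)%type PP
     (fun w => Y w.1 + w.2 *: u) mY' _ (bounded_continuous_cos t c).
  exact: h.
rewrite /Rintegral -(integral12_prod_meas1 intf).
have hF (w : T1) : (\int[N01]_y (EFin \o f) (w, y))%E =
   (cos (dot t (Y w) + c) * expR (- (dot t u ^+ 2 / 2)))%:E.
  have h := normal_characteristic (oner_neq0 R) (dot t u) (dot t (Y w) + c).
  have iw : N01.-integrable setT (fun y => (EFin \o f) (w, y)).
    have mw j : @measurable_fun _ _ (measurableTypeR R) _ setT
        (fun y : R => (Y w + y *: u) ord0 j).
      under eq_fun do rewrite !mxE.
      by apply: measurable_funD => //; exact: measurable_funM.
    exact: (integrable_bounded_continuous N01 mw (bounded_continuous_cos t c)).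
  rewrite -[LHS]fineK ?integrable_fin_num //; congr EFin.
  move: h; rewrite expr1n mul1r => <-; congr fine.
  apply: eq_integral => y _; rewrite /= /f /= dotDr dotZr; congr (cos _)%:E; ring.
rewrite (_ : fubini_F _ _ = (fun w => (cos (dot t (Y w) + c) * expR (- (dot t u ^+ 2 / 2)))%:E)).
  rewrite -/(Rintegral P1 setT (fun w => cos (dot t (Y w) + c) * expR (- (dot t u ^+ 2 / 2)))).
  rewrite RintegralZr //; last first.
    exact: (integrable_bounded_continuous P1 mY (bounded_continuous_cos t c)).
  rewrite hY big_cons -mulrA -expRD; congr (_ * expR _).
  by rewrite mulrDl opprD addrC.
by apply/funext => w; rewrite -hF.
Qed.

(** The law of the vector of [gaussian_combination]; that its projections are
    normal follows from their cosine integrals by [law_eq_of_cos]. *)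
Lemma gaussian_exists (d : nat) (us : seq 'rV[R]_d) :
  let Sigma := \sum_(u <- us) u^T *m u in
  exists nu : probability (borel_rV R d) R,
    is_gaussian 0 Sigma nu /\
    forall t c, \int[nu]_x cos (dot t x + c) =
      cos c * expR (- ((t *m Sigma *m t^T) ord0 ord0 / 2)).
Proof.
move=> Sigma.
have SigmaE (t : 'rV[R]_d) :
    (t *m Sigma *m t^T) ord0 ord0 = \sum_(u <- us) dot t u ^+ 2.
  rewrite /Sigma mulmx_sumr mulmx_suml summxE; apply: eq_bigr => u _.
  exact: quad_dot.
have [d1 [T1 [P1 [Y [mY hY]]]]] := gaussian_combination us.
pose Yf : {mfun T1 >-> borel_rV R d} := mfun_Sub (mem_set (measurable_rV mY)).
have YE w : Yf w = Y w by [].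
exists (distribution P1 Yf); split.
- split.
    rewrite /Sigma linear_sum; apply: eq_bigr => u _ /=.
    by rewrite trmx_mul trmxK.
  move=> t; rewrite SigmaE; set s2 := \sum_(u <- us) _.
  have s20 : 0 <= s2 by apply: sumr_ge0 => u _; exact: sqr_ge0.
  split=> // A mA; rewrite mul0mx mxE.
  have mL : @measurable_fun _ _ T1 (measurableTypeR R) setT (fun w => dot t (Y w)).
    have h := measurable_comp_rV mY (@continuous_dot R d t).
    exact: h.
  pose L : {mfun T1 >-> measurableTypeR R} :=
    @mfun_Sub _ _ T1 (measurableTypeR R) _ (mem_set mL).
  have mcos (a c : R) : @measurable_fun _ _ (measurableTypeR R) R setT (fun x => cos (a * x + c)).
    apply: measurableT_comp; first exact: continuous_measurable_fun (@continuous_cos R).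
    by apply: measurable_funD => //; exact: measurable_funM.
  have cos1 (a c x : R) : `|cos (a * x + c)| <= 1 by rewrite ler_norml cos_geN1 cos_le1.
  have cosL a c : \int[distribution P1 L]_x cos (a * x + c) =
      cos c * expR (- (s2 * a ^+ 2 / 2)).
    rewrite (_ : s2 * a ^+ 2 = \sum_(u <- us) dot (a *: t) u ^+ 2); last first.
      rewrite /s2 mulr_suml; apply: eq_bigr => u _.
      by rewrite dotZl exprMn mulrC.
    rewrite -hY (Rintegral_distribution _ _ (mcos a c) (cos1 a c)).
    by apply: eq_Rintegral => w _; rewrite /L /= dotZl.
  change (distribution P1 L A = normal_law 0 s2 A).
  rewrite /normal_law; case: eqP => [s0|/eqP s0].
    apply: (@law_eq_of_cos (distribution P1 L) (\d_(0 : measurableTypeR R))) => // a c.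
    rewrite cosL s0 mul0r mul0r oppr0 expR0 mulr1 /Rintegral integral_dirac //.
      by rewrite diracT mul1e /= mulr0 add0r.
    by apply/measurable_EFinP; exact: mcos.
  apply: (@law_eq_of_cos (distribution P1 L) (normal_prob 0 (Num.sqrt s2))) => // a c.
  rewrite cosL normal_characteristic ?sqr_sqrtr //.
  by rewrite sqrtr_eq0 -ltNge lt_neqAle eq_sym s0.
- move=> t c.
  have mc : @measurable_fun _ _ (borel_rV R d) R setT (fun x : 'rV[R]_d => cos (dot t x + c)).
    by apply: continuous_measurable_rV; case: (bounded_continuous_cos t c).
  have c1 (x : 'rV[R]_d) : `|cos (dot t x + c)| <= 1 by rewrite ler_norml cos_geN1 cos_le1.
  by rewrite (Rintegral_distribution _ _ mc c1) SigmaE -hY.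
Qed.

End NormalLaws.

(** * The law of the path *)

Section PathLaw.
Variables (R : realType) (d : nat) (Se So : set 'rV[R]_d) (Ve Vo : {fset 'rV[R]_d}).
Hypothesis hV : step_system Se So Ve Vo.
Hypothesis hm2 : (2 <= #|` Vo|)%N.
Variables (p q : R).
Hypotheses (hp : 0 <= p <= 1) (hq : 0 <= q <= 1).
Variables (d0 : measure_display) (T : measurableType d0) (P : probability T R).
Variables (G : nat -> 'rV[R]_d -> {RV P >-> borel_rV R d}) (U : nat -> {RV P >-> nat}).
Variables (X1 : {RV P >-> borel_rV R d}) (X S : nat -> T -> 'rV[R]_d).
Hypothesis hW : elephant_walk Ve Vo p q G U X1 X S.
Local Notation V := 'rV[R]_d.
Local Notation steps := (steps_at Ve Vo).

Let F (n : nat) : set (set T) :=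
  if n is 0%N then sigma_of X1
  else sigma_join (sigma_of (U n))
         (sigma_of_family [set` all_steps Ve Vo] (G n.+1)).

Definition path_of (n : nat) (w : T) : seq V := mkseq (fun i => X i.+1 w) n.

Let size_path_of n w : size (path_of n w) = n.
Proof. exact: size_mkseq. Qed.

Let path_ofS n w : path_of n.+1 w = rcons (path_of n w) (X n.+1 w).
Proof. by rewrite /path_of mkseqS. Qed.

Let X_succ n w : (0 < n)%N ->
  X n.+1 w = G n.+1 (nth 0 (path_of n w) (U n w).-1) w.
Proof.
move=> n0; rewrite (X_next hW) //.
have /andP[u0 un] := U_values hW w n0.
by rewrite nth_mkseq prednK.
Qed.

Lemma path_of_is_path n w : is_path Ve Vo n (path_of n w).
Proof.
elim: n => [|n IH]; first by split.
rewrite path_ofS; apply: is_path_rcons => //.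
case: n IH => [_|n IH].
  by rewrite (X_first hW) /steps_at /=; exact: (X1_values hW).
rewrite X_succ //; apply: (G_values hW) => //.
have /andP[u0 un] := U_values hW w (ltn0Sn n).
apply: (is_path_mem (steps_opp hV) IH); apply: mem_nth.
by rewrite size_path_of prednK.
Qed.

Lemma measurable_singleton_rV (v : V) : measurable ([set v] : set (borel_rV R d)).
Proof.
rewrite -[X in measurable X]setCK; apply: measurableC.
apply: sub_sigma_algebra; apply: closed_openC.
apply: accessible_closed_set1; exact: hausdorff_accessible.
Qed.

Let sigma_of_preimage (d1 : measure_display) (T' : measurableType d1) (Y : T -> T')
    (A : set T') : measurable A -> sigma_of Y (Y @^-1` A).
Proof. by move=> mA; exists A => //; rewrite setTI. Qed.

Let law_G n v w : (0 < n)%N -> v \in all_steps Ve Vo -> w \in steps n.+1 ->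
  P (G n.+1 v @^-1` [set w]) = (jump_law Ve Vo p q n.+1 v w)%:E.
Proof.
move=> n0 hv hw; rewrite /jump_law; case: ifPn => vs.
- exact: (G_law_same hW).
- exact: (G_law_opp hW).
Qed.

(** Given that the path is s, the next step is w on an event of the next block,
    because the memory only reads U and G through the entries of s. *)
Let step_event n s w : is_path Ve Vo n s -> w \in steps n.+1 ->
  exists B, [/\ F n B, measurable B,
    [set x | path_of n.+1 x = rcons s w] = [set x | path_of n x = s] `&` B &
    P B = (step_law Ve Vo p q n s w)%:E].
Proof.
move=> hs hw; case: n hs hw => [|n] hs hw.
  exists (X1 @^-1` [set w]); split.
  - apply: sigma_of_preimage; exact: measurable_singleton_rV.
  - rewrite -[X in measurable X]setTI; apply: (@measurable_funPT _ _ _ _ X1) => //.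
    exact: measurable_singleton_rV.
  - have [/size0nil -> _] := hs; apply/seteqP; split => x.
      move=> h; split => //=; have := congr1 (last 0) h.
      by rewrite path_ofS !last_rcons (X_first hW).
    by move=> [_ /= <-]; rewrite path_ofS (X_first hW).
  - exact: (X1_law hW).
pose N := n.+1.
pose C (i : nat) := (U N @^-1` [set i.+1]) `&` (G N.+1 (nth 0 s i) @^-1` [set w]).
pose B := \big[setU/set0]_(i < N) C i.
have sn : size s = N by case: hs.
have hv (i : 'I_N) : nth 0 s i \in all_steps Ve Vo.
  by apply: (is_path_mem (steps_opp hV) hs); rewrite mem_nth // sn.
have FU (i : 'I_N) : sigma_of (U N) (U N @^-1` [set i.+1]) by exact: sigma_of_preimage.
have FG (i : 'I_N) : sigma_of_family [set` all_steps Ve Vo] (G N.+1)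
    (G N.+1 (nth 0 s i) @^-1` [set w]).
  apply: sub_sigma_algebra; exists (nth 0 s i); first exact: hv.
  apply: sigma_of_preimage; exact: measurable_singleton_rV.
have mU (i : nat) : measurable (U N @^-1` [set i]).
  by rewrite -[X in measurable X]setTI; apply: (@measurable_funPT _ _ _ _ (U N)).
have mG v : measurable (G N.+1 v @^-1` [set w]).
  rewrite -[X in measurable X]setTI; apply: (@measurable_funPT _ _ _ _ (G N.+1 v)) => //.
  exact: measurable_singleton_rV.
have mC (i : 'I_N) : measurable (C i) by exact: measurableI.
have tC : trivIset setT (fun i : 'I_N => C i).
  apply/trivIsetP => i j _ _ ij; rewrite -subset0 => x [[/= xi _] [/= xj _]].
  by move/negP: ij; apply; rewrite -val_eqE /= -eqSS -xi xj.
have BE x : B x <-> exists i : 'I_N, C i x.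
  rewrite /B -bigcup_mkord; split=> [[i /= iN h]|[i h]]; last by exists i => //=.
  by exists (Ordinal iN).
exists B; split.
- have h : (@measurable _ (g_sigma_algebraType (sigma_of (U N) `|`
      sigma_of_family [set` all_steps Ve Vo] (G N.+1)))) B.
    apply: bigsetU_measurable => i _; apply: measurableI.
      by apply: sub_sigma_algebra; left; exact: FU.
    by apply: sub_sigma_algebra; right; exact: FG.
  exact: h.
- by apply: bigsetU_measurable => i _; exact: mC.
- apply/seteqP; split => x.
    rewrite /= path_ofS => /rcons_inj [hx]; rewrite X_succ // hx => hg.
    split => //; apply/BE.
    have /andP[u0 un] := U_values hW x (ltn0Sn n).
    have h : ((U N x).-1 < N)%N by rewrite prednK.
    by exists (Ordinal h); split => //=; rewrite prednK.
  move=> [/= hx /BE [i [/= hu hg]]].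
  by rewrite path_ofS X_succ // hx hu /= hg.
- rewrite /B measure_bigsetU_ord // /step_law.
  rewrite [X in (_ * X)%:E](big_nth 0) sn big_mkord mulr_sumr -sumEFin; apply: eq_bigr => i _.
  apply: (etrans (U_G_independent hW (ltn0Sn n) (FU i) (FG i))).
  rewrite law_G // EFinM; congr (_ * _)%E.
  apply: (U_law hW) => //; exact: ltn_ord.
Qed.

(** The probability of the path s under [path_mean]. *)
Let weight n s := path_mean Ve Vo p q n (fun s' => (s' == s)%:R).

Let weight0 : weight 0 [::] = 1.
Proof. by []. Qed.

Let weightS n s w : w \in steps n.+1 ->
  weight n.+1 (rcons s w) = step_law Ve Vo p q n s w * weight n s.
Proof.
move=> hw; pose hE := path_mean_average (steps_opp hV) hm2 hp hq n.
rewrite /weight -(averageZ hE) /=; congr path_mean; apply/funext => s'.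
rewrite /step_mean; have [->|ns] := eqVneq s' s; last first.
  rewrite mulr0 big1 // => w' _.
  by rewrite eqseq_rcons (negbTE ns) mulr0.
rewrite (big_fsetD1 w) //= eqxx mulr1 big1_fset ?addr0 // => w'.
by rewrite in_fsetD1 eqseq_rcons eqxx /= => /andP[/negbTE -> _] _; rewrite mulr0.
Qed.

(** The future events A_j, one for each block j >= n, are carried along so that
    the induction can consume them: the event of the next step belongs to block n
    and joins them. *)
Let path_event n s (J : {fset nat}) (A : nat -> set T) : is_path Ve Vo n s ->
  (forall j, j \in J -> (n <= j)%N) -> (forall j, j \in J -> F j (A j)) ->
  measurable [set x | path_of n x = s] /\
  P ([set x | path_of n x = s] `&` \bigcap_(j in [set` J]) A j) =
    ((weight n s)%:E * \prod_(j <- J) P (A j))%E.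
Proof.
elim: n s J A => [|n IH] s J A hs hJ hA.
  have [/size0nil -> _] := hs.
  have -> : [set x | path_of 0 x = [::]] = setT by apply/seteqP; split.
  split=> //; rewrite setTI weight0 mul1e; exact: (blocks_independent hW).
have [s' [w [-> hs' hw]]] := is_path_inv hs.
have [B [FB mB eB PB]] := step_event hs' hw.
have nJ : n \notin J by apply/negP => /hJ; rewrite ltnn.
pose A' j := if j == n then B else A j.
have hA' j : j \in (n |` J)%fset -> F j (A' j).
  rewrite in_fset1U /A'; case: eqP => [-> //|_ /=]; exact: hA.
have hJ' j : j \in (n |` J)%fset -> (n <= j)%N.
  by rewrite in_fset1U => /predU1P[-> //|/hJ /ltnW].
have AE j : j \in J -> A' j = A j.
  by rewrite /A'; case: eqP => // -> ; rewrite (negbTE nJ).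
have [m' h] := IH _ _ _ hs' hJ' hA'.
rewrite eB; split; first exact: measurableI.
rewrite -setIA.
have -> : B `&` \bigcap_(j in [set` J]) A j = \bigcap_(j in [set` (n |` J)%fset]) A' j.
  rewrite set_fsetU1 bigcap_setU1 {1}/A' eqxx; congr (_ `&` _).
  by apply: eq_bigcapr => j /= jJ; rewrite AE.
rewrite h big_fsetU1 //= {1}/A' eqxx PB weightS // EFinM -muleA.
rewrite muleCA; congr (_ * (_ * _))%E.
by rewrite big_seq [RHS]big_seq; apply: eq_bigr => j jJ; rewrite AE.
Qed.

Fixpoint all_paths (n : nat) : seq (seq V) :=
  if n is n'.+1 then [seq rcons s w | s <- all_paths n', w <- steps n]
  else [:: [::]].

Let mem_all_paths n s : reflect (is_path Ve Vo n s) (s \in all_paths n).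
Proof.
apply: (iffP idP).
  elim: n s => [|n IH] s /=; first by rewrite inE => /eqP ->.
  by move=> /allpairsP[[s' w] /= [/IH hs' hw ->]]; exact: is_path_rcons.
elim: n s => [|n IH] s; first by move=> [/size0nil -> _]; rewrite inE.
move=> /is_path_inv[s' [w [-> /IH hs' hw]]].
by apply/allpairsP; exists (s', w).
Qed.

Let decompose n (h : seq V -> R) s : is_path Ve Vo n s ->
  h s = \sum_(s' <- undup (all_paths n)) h s' * (s == s')%:R.
Proof.
move=> /mem_all_paths hs; rewrite (bigD1_seq s) ?mem_undup ?undup_uniq //=.
rewrite eqxx mulr1 big1 ?addr0 // => s' ns.
by rewrite eq_sym (negbTE ns) mulr0.
Qed.

Let measurable_path_event n s : measurable [set x | path_of n x = s].
Proof.
have [hs|hs] := pselect (is_path Ve Vo n s).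
  by have [] := @path_event n s fset0 (fun=> set0) hs.
rewrite (_ : [set x | _] = set0) //; apply/seteqP; split => // x /= hx.
by apply: hs; rewrite -hx; exact: path_of_is_path.
Qed.

Let prob_path n s : is_path Ve Vo n s ->
  P [set x | path_of n x = s] = (weight n s)%:E.
Proof.
move=> hs; have [//|//|_] := @path_event n s fset0 (fun=> set0) hs.
by rewrite big_seq_fset0 mule1 (_ : \bigcap_(j in _) _ = setT) ?setIT // -subTset => x _ j.
Qed.

Let path_decompose n (h : seq V -> R) x :
  h (path_of n x) = \sum_(s <- undup (all_paths n)) h s * \1_[set x | path_of n x = s] x.
Proof.
rewrite (decompose h (path_of_is_path n x)); apply: eq_bigr => s _.
congr (_ * _); rewrite indicE; congr (nat_of_bool _)%:R.
by apply/eqP/idP => [h'|]; [rewrite mem_set | move/set_mem].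
Qed.

Lemma measurable_path n (h : seq V -> R) : measurable_fun setT (fun x => h (path_of n x)).
Proof.
rewrite (_ : (fun x => _) = (fun x => \sum_(s <- undup (all_paths n))
   h s * \1_[set x | path_of n x = s] x)); last first.
  by apply/funext => x; exact: path_decompose.
by apply: measurable_sum => s; apply: measurable_funM.
Qed.

(** A function of the path is a combination of the indicators of the finitely many
    possible paths. *)
Theorem path_law n (h : seq V -> R) :
  \int[P]_x h (path_of n x) = path_mean Ve Vo p q n h.
Proof.
pose hE := path_mean_average (steps_opp hV) hm2 hp hq n.
rewrite (eq_average hE (fun s hs => decompose h hs)) (average_sum hE).
under eq_Rintegral do rewrite path_decompose.
have i1 s : P.-integrable setT (EFin \o (fun x => h s * \1_[set y | path_of n y = s] x)).
  have := integrableZl measurableT (h s) (integrable_indic P (measurable_path_event n s)).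
  by apply: eq_integrable => // x _; rewrite /= EFinM.
rewrite /Rintegral; under eq_integral do rewrite -sumEFin.
rewrite integral_sum //= -[RHS]/(fine _%:E) -sumEFin; congr fine.
rewrite big_seq [RHS]big_seq; apply: eq_bigr => s; rewrite mem_undup => /mem_all_paths hs.
rewrite (averageZ hE) -/(weight n s) EFinM -prob_path //.
under eq_integral do rewrite EFinM.
rewrite integralZl //; last exact: integrable_indic.
by rewrite integral_indic // setIT.
Qed.

Lemma position_sum n x : S n x = \sum_(v <- path_of n x) v.
Proof.
elim: n => [|n IH]; first by rewrite (S_zero hW) big_nil.
by rewrite (S_next hW) IH path_ofS -cats1 big_cat /= big_seq1.
Qed.

End PathLaw.

(** * Tightness and the theorem *)

Section Limit.
Variables (R : realType) (d : nat) (Ve Vo : {fset 'rV[R]_d}).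
Hypothesis hm2 : (2 <= #|` Vo|)%N.
Variables (p q : R).
Local Notation V := 'rV[R]_d.
Local Notation m := #|` Vo|.
Local Notation del := (delta_coef m p q).
Hypothesis hdel : del < 1 / 2.

(** Vectors whose sum of squares is the limiting covariance. *)
Definition limit_vectors : seq V :=
  [seq (Num.sqrt (m%:R * (1 - 2 * del)))^-1 *: (v - fset_mean Vo) | v <- Vo].

Let k0 : 0 < m%:R * (1 - 2 * del).
Proof.
apply: mulr_gt0; first by rewrite ltr0n (leq_trans _ hm2).
move: hdel; lra.
Qed.

Lemma sum_limit_vectors : \sum_(u <- limit_vectors) u^T *m u =
  (m%:R * (1 - 2 * del))^-1 *: fset_scatter Vo.
Proof.
rewrite big_map /fset_scatter scaler_sumr; apply: eq_bigr => v _.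
have trZ (a : R) (x : V) : (a *: x)^T = a *: x^T by apply/matrixP => i j; rewrite !mxE.
rewrite trZ -scalemxAl -scalemxAr scalerA; congr (_ *: _).
by rewrite -invfM -expr2 sqr_sqrtr // ltW.
Qed.

Lemma limit_variance (t : V) :
  (t *m ((m%:R * (1 - 2 * del))^-1 *: fset_scatter Vo) *m t^T) ord0 ord0 =
  fvar Vo (center Vo (dot t)) / (1 - 2 * del).
Proof.
rewrite -scalemxAr -scalemxAl mxE /fset_scatter mulmx_sumr mulmx_suml summxE.
rewrite invfM [_^-1 * _]mulrC -mulrA mulrC; congr (_ * _); rewrite /fvar; congr (_ * _).
apply: eq_bigr => v _; rewrite /center.
have -> : dot t v - m%:R^-1 * \sum_(u <- Vo) dot t u = dot t (v - fset_mean Vo).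
  by rewrite /fset_mean dotDr dotNr dotZr dot_sum.
exact: quad_dot.
Qed.

(** Chebyshev's inequality in each coordinate: outside the box of size L, the sum
    of the squares of the x_j / L is at least 1. *)
Lemma path_tail (Se So : set V) (hV : step_system Se So Ve Vo)
  (hp : 0 <= p <= 1) (hq : 0 <= q <= 1) (e : R) : 0 < e -> exists L : R, \forall n \near \oo,
  mean_tail_le (fun f : V -> R => path_mean Ve Vo p q n
    (fun s => f ((Num.sqrt n%:R)^-1 *: \sum_(v <- s) v))) L e.
Proof.
move=> e0.
have hK (j : 'I_d) : exists K : R, 0 <= K /\ forall n, (0 < n)%N ->
    path_mean Ve Vo p q n (fun s => (\sum_(v <- s) (v : V) ord0 j) ^+ 2) <= K * n%:R.
  apply: (path_second_moment (steps_opp hV) (steps_disjoint hV) hm2 hp hq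
    (erefl (gamma_coef m p q)) (erefl del) hdel) => v.
  by rewrite mxE.
have {hK} [K hK] := choice hK.
pose L : R := Num.sqrt ((\sum_j K j) / e) + 1.
have sK : 0 <= \sum_j K j by apply: sumr_ge0 => j _; case: (hK j).
have L0 : 0 < L by rewrite ltr_wpDl // sqrtr_ge0.
have KL : (\sum_j K j) / L ^+ 2 <= e.
  have A0 : 0 <= (\sum_j K j) / e by apply: divr_ge0 => //; exact: ltW.
  rewrite ler_pdivrMr ?exprn_gt0 // mulrC -ler_pdivrMr //.
  rewrite -[leLHS]sqr_sqrtr //; apply: lerXn2r; rewrite ?nnegrE ?sqrtr_ge0 ?(ltW L0) //.
  by rewrite /L lerDl.
exists L; exists 1%N => // n /= n0 f bf f01 f0.
pose hE := path_mean_average (steps_opp hV) hm2 hp hq n.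
have s0 : 0 < n%:R :> R by rewrite ltr0n.
have fle (x : V) : f x <= \sum_j (x ord0 j) ^+ 2 / L ^+ 2.
  have [h|] := pselect (forall j, `|x ord0 j| <= L).
    rewrite f0 //; apply: sumr_ge0 => j _; nonneg.
  move/existsNP => [j /negP]; rewrite -ltNge => hj.
  case/andP: (f01 x) => _ /le_trans; apply.
  rewrite (bigD1 j) //= -[1]addr0 lerD //; last by apply: sumr_ge0 => i _; nonneg.
  rewrite ler_pdivlMr ?exprn_gt0 // mul1r -[leRHS]real_normK ?num_real //.
  by apply: lerXn2r; rewrite ?nnegrE ?(ltW L0) // ltW.
apply: le_trans KL.
apply: (@le_trans _ _ (path_mean Ve Vo p q n (fun s =>
   \sum_j ((n%:R * L ^+ 2)^-1 * (\sum_(v <- s) (v : V) ord0 j) ^+ 2)))).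
  apply: (average_le hE) => s _; apply: le_trans (fle _) _.
  apply: ler_sum => j _; rewrite mxE summxE exprMn exprVn sqr_sqrtr ?(ltW s0) //.
  by rewrite invfM; lra.
rewrite (average_sum hE) mulr_suml; apply: ler_sum => j _.
rewrite (averageZ hE) invfM -mulrA [leRHS]mulrC [_^-1 * (_ * _)]mulrCA.
apply: ler_wpM2l; first by rewrite invr_ge0 sqr_ge0.
by rewrite mulrC ler_pdivrMr //; case: (hK j) => _; exact.
Qed.

End Limit.

Theorem theorem2p15 (R : realType) (d : nat) (hd : (1 <= d)%N)
  (Se So : set 'rV[R]_d) (Ve Vo : {fset 'rV[R]_d})
  (hV : step_system Se So Ve Vo)
  (m : nat) (hm : #|` Vo| = m) (hm2 : (2 <= m)%N)
  (p q : R) (hp : 0 <= p <= 1) (hq : 0 <= q <= 1)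
  (d0 : measure_display) (T : measurableType d0) (P : probability T R)
  (G : nat -> 'rV[R]_d -> {RV P >-> borel_rV R d})
  (U : nat -> {RV P >-> nat})
  (X1 : {RV P >-> borel_rV R d})
  (X S : nat -> T -> 'rV[R]_d)
  (hW : elephant_walk Ve Vo p q G U X1 X S)
  (hgamma : gamma_coef m p q < 1)
  (hdelta : delta_coef m p q < 1 / 2) :
  exists nu : probability (borel_rV R d) R,
    is_gaussian 0
      ((m%:R * (1 - 2 * delta_coef m p q))^-1 *: fset_scatter Vo) nu /\
    cvg_in_distribution P (fun n w => (Num.sqrt n%:R)^-1 *: S n w) nu.
Proof.
subst m.
have [nu [nuG nuC]] := gaussian_exists (limit_vectors Vo p q).
move: nuG nuC; rewrite (sum_limit_vectors hm2 hdelta) => nuG nuC.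
exists nu; split=> //.
pose Z n w : 'rV[R]_d := (Num.sqrt n%:R)^-1 *: S n w.
have ZE n w : Z n w = (Num.sqrt n%:R)^-1 *: \sum_(v <- path_of X n w) v.
  by rewrite /Z (position_sum hW).
have mZ n j : measurable_fun setT (fun w => Z n w ord0 j).
  under eq_fun do rewrite ZE.
  exact: (measurable_path hV hm2 hp hq hW n
    (fun s => ((Num.sqrt n%:R)^-1 *: \sum_(v <- s) v) ord0 j)).
split=> [n|f cf bf]; first exact: measurable_rV (mZ n).
have bcf : bounded_continuous f by split.
pose En n (g : 'rV[R]_d -> R) := \int[P]_w g (Z n w).
pose E (g : 'rV[R]_d -> R) := \int[nu]_x g x.
have EnE n g : En n g = path_mean Ve Vo p q n
    (fun s => g ((Num.sqrt n%:R)^-1 *: \sum_(v <- s) v)).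
  rewrite -(path_law hV hm2 hp hq hW); apply: eq_Rintegral => w _.
  by rewrite ZE.
have cvE : En n f @[n --> \oo] --> E f.
  apply: (levy_continuity (En := En) (E := E)) => //.
  - move=> n; exact: image_is_mean (mZ n).
  - exact: (image_is_mean nu (Z := fun x : borel_rV R d => x : 'rV[R]_d)
      (@measurable_coord R d)).
  - move=> e e0.
    have [L1 h1] := image_tail nu (Z := fun x : borel_rV R d => x : 'rV[R]_d)
      (@measurable_coord R d) e0.
    have [L2 h2] := path_tail hm2 hdelta hV hp hq e0.
    exists (Num.max L1 L2); split.
      by apply: mean_tail_le_mono h1; rewrite le_max lexx.
    apply: filterS h2 => n h2; apply: (@mean_tail_le_mono _ _ _ L2).
      by rewrite le_max lexx orbT.
    by move=> g bg g01 g0; rewrite EnE; exact: h2.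
  - move=> t c; rewrite /E nuC limit_variance //.
    under eq_fun do rewrite EnE.
    under [X in X @ _]eq_fun => n do
      (under [X in path_mean _ _ _ _ _ X]eq_fun => s do rewrite dotZr dot_sum).
    exact: (path_char_cvg (steps_opp hV) (steps_disjoint hV) hm2 hp hq
      (erefl _) (erefl _) hdelta hgamma (dotNr t)).
have toE (d1 : measure_display) (T1 : measurableType d1) (Q : probability T1 R)
    (g : T1 -> 'rV[R]_d) :
    (forall j, measurable_fun setT (fun w => g w ord0 j)) ->
    (\int[Q]_w (f (g w))%:E)%E = (\int[Q]_w f (g w))%:E.
  move=> mg; rewrite /Rintegral fineK //; apply: integrable_fin_num => //.
  exact: (integrable_bounded_continuous Q mg bcf).
under eq_fun do rewrite (toE _ _ _ _ (mZ _)).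
rewrite (toE _ _ nu (fun x => x) (@measurable_coord R d)).
by apply: cvg_EFin; first exact: nearW.
Qed.
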